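(* The family $$\mathcal{S}=\{G_{\rho,\alpha}\mid \rho\text{ is a quasi-periodic labelling and }\alpha\in(0,1)\setminus\mathbf{Z}[\tfrac12]\}$$ consists of finitely generated simple subgroups of $\mathrm{Homeo}^+(\mathbf{R})$ of continuum many isomorphism types (that is, every member of $\mathcal S$ is a finitely generated simple subgroup of $\mathrm{Homeo}^+(\mathbf{R})$, and $\mathcal S$ contains continuum many groups up to isomorphism).
   Context: $\mathrm{Homeo}^+(\mathbf{R})$ is the group of orientation preserving homeomorphisms of $\mathbf{R}$. All actions are right actions: $x\cdot f$ is the image of $x$ under $f$ and $x\cdot(fg)=(x\cdot f)\cdot g$. $\mathrm{Supp}(f)=\{x\mid x\cdot f\neq x\}$. $\mathrm{PL}^+([0,1])$ is the group of orientation preserving piecewise linear homeomorphisms of $[0,1]$. **The group $H$.** $F$ is Thompson's group: the elements of $\mathrm{PL}^+([0,1])$ with finitely many breakpoints (points where the derivative does not exist), all in $\mathbf{Z}[\frac12]$, and whose derivatives, where they exist, are integer powers of $2$. $F_{[r,s]}$ is the subgroup of elements of $F$ with support in $[r,s]$ (also written $F_I$ for $I=[r,s]$). $F'$ is the derived subgroup. $\iota:[0,1]\to[0,1]$ is the orientation reversing isometry. Fix $c_0\in F$ with $\mathrm{Supp}(c_0)=(0,\frac14)$, $x\cdot c_0>x$ for all $x\in(0,\frac14)$, and $t\cdot c_0=2t$ for $t\in(0,\frac1{16})$. Put $c_1=\iota\circ c_0\circ\iota$, $\nu_1=c_0c_1$, and $H=\langle F',\nu_1\rangle\leq F$. Fix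 standard generators $\nu_2,\nu_3$ (two elements generating the group $F_{[\frac1{16},\frac{15}{16}]}$). The group $H$ is generated by $\nu_1,\nu_2,\nu_3$. **Labellings.** A labelling is a map $\rho:\frac12\mathbf{Z}\to\{a,b,a^{-1},b^{-1}\}$ with $\rho(k)\in\{a,a^{-1}\}$ for $k\in\mathbf{Z}$ and $\rho(k)\in\{b,b^{-1}\}$ for $k\in\frac12\mathbf{Z}\setminus\mathbf{Z}$. A block is a set $X=\{k,k+\frac12,\dots,k+\frac12 n\}$ with $k\in\frac12\mathbf{Z}$, $n\in\mathbf{N}$ ($n\ge 0$); $W_\rho(X)$ is the formal word $\rho(k)\rho(k+\frac12)\cdots\rho(k+\frac12n)$, and $W_\rho^{-1}(X)$ is its formal inverse (the formal inverse of $w_1\cdots w_n$ is $w_n^{-1}\cdots w_1^{-1}$). $\rho$ is quasi-periodic if (1) for each block $X$ there is $n\in\mathbf{N}$ such that for every block $Y$ of size at least $n$, $W_\rho(X)$ is a subword (string of consecutive letters) of $W_\rho(Y)$; and (2) for each block $X$ there is a block $Y$ with $W_\rho(Y)=W_\rho^{-1}(X)$. **The group $G_\rho$.** For a homeomorphism $f$ of $[0,1]$ and an interval $J$ of length $1$, write $g\restriction J\cong_T f$ if $g$ preserves $J$ and $g\restriction J$ is the conjugate of $f$ by the orientation preserving isometry $[0,1]\to J$. Define homeomorphisms $\zeta_i,\chi_i$ of $\mathbf{R}$, $i=1,2,3$, by: for all $n\in\mathbf{Z}$, $\zeta_i\restriction[n,n+1]\cong_T\nu_i$ if $\rho(n+\frac12)=b$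 and $\cong_T\iota\circ\nu_i\circ\iota$ if $\rho(n+\frac12)=b^{-1}$; $\chi_i\restriction[n-\frac12,n+\frac12]\cong_T\nu_i$ if $\rho(n)=a$ and $\cong_T\iota\circ\nu_i\circ\iota$ if $\rho(n)=a^{-1}$. Then $G_\rho=\langle\zeta_1,\zeta_2,\zeta_3,\chi_1,\chi_2,\chi_3\rangle<\mathrm{Homeo}^+(\mathbf{R})$. **The group $G_{\rho,\alpha}$.** For each $\alpha\in(0,1)\setminus\mathbf{Z}[\frac12]$ fix $f_\alpha\in\mathrm{PL}^+([0,1])$ whose slope at $0$ is $\alpha$, and let $\Gamma_\alpha=\langle F,f_\alpha\rangle$. Standard dyadic intervals are closed intervals $[\frac{p}{2^n},\frac{p+1}{2^n}]$ with $p,n\in\mathbf{N}$. For each pair $I,J$ of standard dyadic intervals contained in $(0,1)$, fix $f_{I,J}\in F'$ with $I\cdot f_{I,J}=J$ and $f_{I,J}\restriction I$ linear, chosen so that $f_{I,J}^{-1}=f_{J,I}$. Fix a standard dyadic interval $I\subset(0,1)$ and $\sigma_\alpha\in\mathrm{PL}^+([0,1])$ which is the identity on $[0,1]\setminus I$ and satisfies $\langle\sigma_\alpha,F_I\rangle\restriction I\cong\Gamma_\alpha$. Fix a standard dyadic interval $J\subset(0,1)$ with $\sup(J)<\inf(I)$. Define the homeomorphism $\xi_\alpha$ of $[0,1]$ by $\xi_\alpha\restriction I=\sigma_\alpha\restriction I$, $\xi_\alpha\restriction J=f_{J,I}\,\sigma_\alpha^{-1}f_{I,J}\restriction J$, and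 $\xi_\alpha=\mathrm{id}$ on $[0,1]\setminus(I\cup J)$. Define homeomorphisms $\gamma_\alpha,\omega_\alpha$ of $\mathbf{R}$ by: for all $n\in\mathbf{Z}$, $\gamma_\alpha\restriction[n,n+1]\cong_T\xi_\alpha$ if $\rho(n+\frac12)=b$ and $\cong_T\iota\circ\xi_\alpha\circ\iota$ if $\rho(n+\frac12)=b^{-1}$; $\omega_\alpha\restriction[n-\frac12,n+\frac12]\cong_T\xi_\alpha$ if $\rho(n)=a$ and $\cong_T\iota\circ\xi_\alpha\circ\iota$ if $\rho(n)=a^{-1}$. Then $G_{\rho,\alpha}=\langle G_\rho,\gamma_\alpha,\omega_\alpha\rangle$. *)

(* Defs.v *)
From HB Require Import structures.
From mathcomp Require Import all_boot all_order all_algebra.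
From mathcomp Require Import all_classical all_reals all_analysis.
From mathcomp Require Import ring lra.

Set Implicit Arguments.
Unset Strict Implicit.
Unset Printing Implicit Defensive.

Import Order.TTheory GRing.Theory Num.Theory.
Import numFieldNormedType.Exports.

Local Open Scope classical_set_scope.
Local Open Scope ring_scope.

Definition is_subgroup (G : groupType) (A : set G) : Prop :=
  group_closed (mem A).

Definition gen (G : groupType) (X : set G) : set G := smallest (@is_subgroup G) X.

Definition finitely_generated (G : groupType) (A : set G) : Prop :=
  exists s : seq G, A = gen [set` s].

Definition normal_in (G : groupType) (N A : set G) : Prop :=
  [/\ is_subgroup N, N `<=` A & forall x y, N x -> A y -> N (x ^ y)%g].

Definition simple_group (G : groupType) (A : set G) : Prop :=
  A <> [set 1%g] /\ forall N, normal_in N A -> N = [set 1%g] \/ N = A.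

Definition derived (G : groupType) (A : set G) : set G :=
  gen [set [~ x, y]%g | x in A & y in A].

Definition group_isog (G1 G2 : groupType) (A : set G1) (B : set G2) : Prop :=
  exists2 phi : G1 -> G2, set_bij A B phi &
    forall x y, A x -> A y -> phi (x * y)%g = (phi x * phi y)%g.

Section Homeo.
Variable R : realType.

Definition is_homeo_pos (f : R -> R) : Prop :=
  (exists g : R -> R, [/\ cancel f g, cancel g f, continuous f & continuous g])
  /\ {homo f : x y / x < y}.

Record homeo := Homeo { homeo_fun :> R -> R ; _ : `[< is_homeo_pos homeo_fun >] }.

HB.instance Definition _ := [isSub for homeo_fun].
HB.instance Definition _ := [Choice of homeo by <:].

Lemma homeoP (f : homeo) : is_homeo_pos f.
Proof. by case: f => f /= /asboolP. Qed.

Lemma homeo_ext (f g : homeo) : (forall x, f x = g x) -> f = g.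
Proof. by move=> fg; apply/val_inj/funext. Qed.

Lemma homo_can_continuous (f g : R -> R) :
  cancel f g -> cancel g f -> {homo f : x y / x < y} -> continuous f.
Proof.
move=> fK gK fm x; apply/cvgrPdist_lt => e e0.
have fl : {mono f : a b / a < b}.
  by apply/leW_mono/le_mono.
have gl : {homo g : a b / a < b} by move=> a b ab; rewrite -fl !gK.
have h1 : g (f x - e) < x by rewrite -{2}(fK x); apply: gl; lra.
have h2 : x < g (f x + e) by rewrite -{1}(fK x); apply: gl; lra.
near=> y.
have y1 : f x - e < f y.
  by rewrite -(gK (f x - e)) fl; near: y; apply: lt_nbhsr_ge || apply: lt_nbhsr.
have y2 : f y < f x + e.
  by rewrite -(gK (f x + e)) fl; near: y; apply: lt_nbhsl_le || apply: lt_nbhsl.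
by rewrite ltr_norml; lra.
Unshelve. all: by end_near. Qed.

Lemma can_homo_lt (f g : R -> R) :
  cancel f g -> cancel g f -> {homo f : x y / x < y} -> {homo g : x y / x < y}.
Proof.
move=> fK gK fm a b ab; have fl : {mono f : a b / a < b} by apply/leW_mono/le_mono.
by rewrite -fl !gK.
Qed.

Lemma is_homeo_posI (f g : R -> R) :
  cancel f g -> cancel g f -> {homo f : x y / x < y} -> is_homeo_pos f.
Proof.
move=> fK gK fm; split => //; exists g; split => //.
  exact: homo_can_continuous fK gK fm.
exact: (homo_can_continuous gK fK (can_homo_lt fK gK fm)).
Qed.

Lemma is_homeo_pos_inv (f : homeo) :
  {g : R -> R | [/\ cancel f g, cancel g f & is_homeo_pos g]}.
Proof.
apply: cid; have [[g [fK gK fc gc]] fm] := homeoP f; exists g; split => //.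
exact: (is_homeo_posI gK fK (can_homo_lt fK gK fm)).
Qed.

(* Right actions: the image of x under f is [f x], and f * g is f first, then g. *)

Lemma homeo_mul_subproof (f g : homeo) : `[< is_homeo_pos (g \o f) >].
Proof.
apply/asboolP.
have [[f' [fK f'K _ _]] fm] := homeoP f; have [[g' [gK g'K _ _]] gm] := homeoP g.
apply: (@is_homeo_posI _ (f' \o g')); [exact: can_comp|exact: can_comp|].
by move=> x y xy; apply/gm/fm.
Qed.
Definition homeo_mul (f g : homeo) : homeo := Homeo (homeo_mul_subproof f g).

Lemma homeo_one_subproof : `[< is_homeo_pos id >].
Proof. by apply/asboolP; apply: (@is_homeo_posI _ id). Qed.
Definition homeo_one : homeo := Homeo homeo_one_subproof.

Lemma homeo_inv_subproof (f : homeo) : `[< is_homeo_pos (sval (is_homeo_pos_inv f)) >].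
Proof. by apply/asboolP; case: (is_homeo_pos_inv f) => g []. Qed.
Definition homeo_inv (f : homeo) : homeo := Homeo (homeo_inv_subproof f).

Lemma homeo_invK (f : homeo) : cancel f (homeo_inv f).
Proof. by rewrite /homeo_inv /=; case: (is_homeo_pos_inv f) => g []. Qed.
Lemma homeo_Kinv (f : homeo) : cancel (homeo_inv f) f.
Proof. by rewrite /homeo_inv /=; case: (is_homeo_pos_inv f) => g []. Qed.

Lemma homeo_mulA : associative homeo_mul.
Proof. by move=> f g h; apply: homeo_ext. Qed.
Lemma homeo_mul1 : left_id homeo_one homeo_mul.
Proof. by move=> f; apply: homeo_ext. Qed.
Lemma homeo_mulr1 : right_id homeo_one homeo_mul.
Proof. by move=> f; apply: homeo_ext. Qed.
Lemma homeo_mulV : left_inverse homeo_one homeo_inv homeo_mul.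
Proof. by move=> f; apply: homeo_ext => x /=; apply: homeo_Kinv. Qed.
Lemma homeo_mulVr : right_inverse homeo_one homeo_inv homeo_mul.
Proof. by move=> f; apply: homeo_ext => x /=; apply: homeo_invK. Qed.

HB.instance Definition _ := isGroup.Build homeo
  homeo_mulA homeo_mul1 homeo_mulr1 homeo_mulV homeo_mulVr.

End Homeo.

Lemma homeoM (R : realType) (f g : homeo R) x : (f * g)%g x = g (f x).
Proof. by []. Qed.

(* The homeomorphism with underlying function f (the identity if f is not an
   orientation preserving homeomorphism). *)
Definition homeo_of (R : realType) (f : R -> R) : homeo R :=
  insubd (1%g : homeo R) f.

Lemma homeo_ofE (R : realType) (f : R -> R) : is_homeo_pos f -> homeo_of f = f :> (R -> R).
Proof. by move=> hf; apply: (@insubdK _ _ (homeo R)); exact/asboolP. Qed.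

(* A homeomorphism of [0,1] (or of a subinterval I) fixing the endpoints is
   identified with its extension by the identity to the whole line, so
   that all the groups below are subgroups of [homeo R] and the restriction
   to I of a map supported in I is that map itself. *)

Section Thompson.
Variable R : realType.
Implicit Types (f g : homeo R).

Definition supp f : set R := [set x | f x != x].

Definition affine_on (f : R -> R) (A : set R) : Prop :=
  exists a b : R, forall x, A x -> f x = a * x + b.

Definition PL01 : set (homeo R) := [set f | supp f `<=` `[0, 1] /\
  exists2 B : set R, finite_set B &
    forall x y : R, 0 <= x -> x < y -> y <= 1 ->
      `]x, y[ `&` B = set0 -> affine_on f `[x, y]].

Definition dyadic : set R :=
  [set x | exists (m : int) (n : nat), x = m%:~R / 2 ^+ n].

(* The derivative is only considered inside ]0,1[: at 0 and 1, which are dyadic,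
   the extension by the identity may be nonderivable; the one-sided slopes
   there are controlled by the derivative at nearby points. *)
Definition thompsonF : set (homeo R) := [set f | [/\ PL01 f,
  forall x : R, x \in `]0, 1[ -> ~ derivable f x 1 -> dyadic x &
  forall x : R, x \in `]0, 1[ -> derivable f x 1 -> exists k : int, derive1 f x = (2 : R) ^ k :> R]].

Definition F_on (A : set R) : set (homeo R) := [set f | thompsonF f /\ supp f `<=` A].

Definition slope_at0 f (a : R) : Prop := (f x - f 0) / x @[x --> 0^'+] --> a.

Definition flip f : homeo R := homeo_of (fun x => 1 - f (1 - x)).

Lemma flipE f x : flip f x = 1 - f (1 - x).
Proof.
rewrite homeo_ofE //; have [[g [fK gK _ _]] fm] := homeoP f.
apply: (@is_homeo_posI _ _ (fun x => 1 - g (1 - x))).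
- by move=> y; rewrite subKr fK subKr.
- by move=> y; rewrite subKr gK subKr.
- by move=> y z yz; have := fm (1 - z) (1 - y); lra.
Qed.

Definition nu1 (c0 : homeo R) : homeo R := (c0 * flip c0)%g.

Definition cong_T (g : R -> R) (c : R) f : Prop :=
  forall t, 0 <= t <= 1 -> g (c + t) = c + f t.

(* The map of R that, for every n : int, acts on [s+n, s+n+1] as the translate
   of f if e n, and as the translate of flip f otherwise. *)
Definition copies (s : R) (e : int -> bool) f : R -> R := fun x =>
  let n := Num.floor (x - s) in
  let c := s + n%:~R in
  c + (if e n then f else flip f) (x - c).

Lemma supp_fix f a b x : supp f `<=` `[a, b] -> ~~ (a < x < b) -> f x = x.
Proof.
have [[g [fK gK fc gc]] fm] := homeoP f.
have fl : {mono f : a b / a < b} by apply/leW_mono/le_mono.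
move=> sf xab; apply/eqP/negPn/negP => fx.
have /= := sf x fx; rewrite in_itv /= => /andP[ax xb].
have fout y : (y < a) || (b < y) -> f y = y.
  move=> yab; apply/eqP/negPn/negP => fy.
  by have /= := sf y fy; rewrite in_itv /= => ?; lra.
have : f (f x) != f x by apply/eqP => /(can_inj fK)/eqP; exact/negP.
move=> /(sf (f x)) /=; rewrite in_itv /= => fxab.
have := sf (g x); rewrite /supp /= gK in_itv /= => gx.
have gxab : a <= g x <= b.
  by apply: gx; apply/eqP => xg; move/eqP: fx; apply; rewrite {1}xg gK.
have [fxx|xfx|//] := ltgtP (f x) x; last by move/eqP: fx.
- have : x < g x by rewrite -fl gK.
  by lra.
- have : g x < x by rewrite -fl gK.
  by lra.
Qed.

Lemma supp_in01 f t : supp f `<=` `[0, 1] -> 0 <= t < 1 -> 0 <= f t < 1.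
Proof.
move=> sf; have [[g [fK gK _ _]] fm] := homeoP f.
have f0 : f 0 = 0 by apply: supp_fix sf _; lra.
have f1 : f 1 = 1 by apply: supp_fix sf _; lra.
case/andP; rewrite le_eqVlt => /predU1P[<- _|t0 t1]; first by rewrite f0; lra.
by have := fm _ _ t0; have := fm _ _ t1; rewrite f0 f1; lra.
Qed.

Lemma supp_flip f : supp f `<=` `[0, 1] -> supp (flip f) `<=` `[0, 1].
Proof.
move=> sf x; rewrite /supp /= flipE => fx; have := sf (1 - x).
rewrite /supp /= !in_itv /= => h; suff : f (1 - x) != 1 - x by move=> /h; lra.
by apply/eqP => fx1; move/eqP: fx; apply; rewrite fx1; lra.
Qed.

Lemma supp_inv f (A : set R) : supp f `<=` A -> supp (f^-1)%g `<=` A.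
Proof.
move=> sf x fx; apply: sf; rewrite /supp /=; apply: contra fx => /eqP fx.
by apply/eqP; rewrite -{1}fx; exact: homeo_invK.
Qed.

Lemma floor_unit (n : int) (t : R) : 0 <= t < 1 -> Num.floor (n%:~R + t) = n.
Proof. by move=> t01; apply: floor_def; rewrite intrD; lra. Qed.

Lemma floor_decomp (s x : R) :
  exists (n : int) (t : R), [/\ 0 <= t < 1, x = s + n%:~R + t & Num.floor (x - s) = n].
Proof.
exists (Num.floor (x - s)), (x - s - (Num.floor (x - s))%:~R); split => //; last by lra.
by have := floor_itv (x - s); rewrite intrD; lra.
Qed.

Lemma copiesE s e f (n : int) (t : R) : 0 <= t < 1 ->
  copies s e f (s + n%:~R + t) = s + n%:~R + (if e n then f else flip f) t.
Proof.
move=> t01; rewrite /copies (_ : _ + t - s = n%:~R + t); last by lra.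
by rewrite floor_unit // (_ : _ + t - (s + n%:~R) = t) //; lra.
Qed.

Lemma flipV f : (flip f^-1)%g = (flip f)^-1%g.
Proof.
apply: (mulgI (flip f)); rewrite mulgV; apply: homeo_ext => x /=.
by rewrite !flipE subKr homeo_invK subKr.
Qed.

Lemma copies_can s e f : supp f `<=` `[0, 1] ->
  cancel (copies s e f) (copies s e (f^-1)%g).
Proof.
move=> sf x; have [n [t [t01 -> _]]] := floor_decomp s x.
rewrite copiesE // copiesE; last first.
  by case: ifP => _; apply: supp_in01 => //; exact: supp_flip.
by congr (_ + _); case: ifP => _; [|rewrite flipV]; exact: homeo_invK.
Qed.

Lemma copies_homeo s e f : supp f `<=` `[0, 1] -> is_homeo_pos (copies s e f).
Proof.
move=> sf; apply: (@is_homeo_posI _ _ (copies s e (f^-1)%g)).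
- exact: copies_can.
- by rewrite -{2}(invgK f); apply: copies_can; exact: supp_inv.
move=> x y; have [n [t [t01 -> _]]] := floor_decomp s x.
have [m [u [u01 -> _]]] := floor_decomp s y => xy; rewrite !copiesE //.
have h k v : 0 <= v < 1 -> 0 <= (if e k then f else flip f) v < 1.
  by move=> v01; case: ifP => _; apply: supp_in01 => //; exact: supp_flip.
have [nm|mn|nm] := ltgtP n m.
- have : (n + 1)%:~R <= m%:~R :> R by rewrite ler_int lezD1.
  by rewrite intrD; have := h n t t01; have := h m u u01; lra.
- have : (m + 1)%:~R <= n%:~R :> R by rewrite ler_int lezD1.
  by rewrite intrD; lra.
- rewrite -nm ltrD2l; have tu : t < u by move: xy; rewrite nm; lra.
  by case: ifP => _; [case: (homeoP f)|case: (homeoP (flip f))] => _; apply.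
Qed.

Lemma copies_cong_T s e f : supp f `<=` `[0, 1] ->
  forall n : int, cong_T (copies s e f) (s + n%:~R) (if e n then f else flip f).
Proof.
move=> sf n t t01; have [t1|t1] := ltP t 1; first by rewrite copiesE //; lra.
have -> : t = 1 by lra.
have fix01 h v : supp h `<=` `[0, 1] -> ~~ (0 < v < 1) -> h v = v by exact: supp_fix.
have -> : (if e n then f else flip f) 1 = 1.
  by case: ifP => _; apply: fix01; rewrite ?ltxx ?andbF //; exact: supp_flip.
rewrite (_ : s + n%:~R + 1 = s + (n + 1)%:~R + 0); last by rewrite intrD; lra.
rewrite copiesE; last lra.
by case: ifP => _; rewrite fix01 ?ltxx //; exact: supp_flip.
Qed.

(* [(p, n)] is the standard dyadic interval [p/2^n, (p+1)/2^n]. *)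
Definition sd_itv (I : nat * nat) : set R :=
  `[I.1%:R / 2 ^+ I.2, I.1.+1%:R / 2 ^+ I.2].

Definition inner (I : nat * nat) : Prop := sd_itv I `<=` `]0, 1[.

Definition is_transfer (fI : nat * nat -> nat * nat -> homeo R) : Prop :=
  forall I J : nat * nat, inner I -> inner J ->
    [/\ derived thompsonF (fI I J), fI I J @` sd_itv I = sd_itv J,
        affine_on (fI I J) (sd_itv I) & (fI I J)^-1%g = fI J I].

Definition xi_fun (fI : nat * nat -> nat * nat -> homeo R) (I J : nat * nat)
    (sigma : homeo R) : R -> R := fun x =>
  if x \in sd_itv I then sigma x
  else if x \in sd_itv J then (fI J I * sigma^-1 * fI I J)%g x
  else x.

Definition xi fI (I J : nat * nat) sigma : homeo R := homeo_of (xi_fun fI I J sigma).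

Lemma xi_homeo fI (I J : nat * nat) sigma : is_transfer fI -> inner I -> inner J ->
  sup (sd_itv J) < inf (sd_itv I) -> supp sigma `<=` sd_itv I ->
  is_homeo_pos (xi_fun fI I J sigma).
Proof.
move=> hfI iI iJ JI ss; have [_ fJI _ fV] := hfI _ _ iJ iI.
set h := (fI J I * sigma^-1 * fI I J)%g.
have nz (n : nat) : 0 < 2 ^+ n :> R by rewrite exprn_gt0.
have le_itv K : K.1%:R / 2 ^+ K.2 <= K.1.+1%:R / 2 ^+ K.2 :> R.
  by rewrite ler_pM2r ?invr_gt0 // ler_nat.
move: JI; rewrite /sd_itv sup_itv ?inf_itv ?bnd_simp // -/(sd_itv I) => JI.
have hs : supp h `<=` sd_itv J.
  move=> x hx; apply: contrapT => xJ.
  move/negP: hx; apply; apply/eqP; rewrite /h !homeoM -fV.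
  have -> : (sigma^-1)%g (fI J I x) = fI J I x.
    apply/eqP/negPn/negP => /(supp_inv ss); rewrite -fJI => -[y yJ yx].
    by apply: xJ; rewrite -(homeo_invK (fI J I) x) -yx homeo_invK.
  exact: homeo_invK.
suff -> : xi_fun fI I J sigma = (sigma * h)%g by exact: homeoP.
apply/funext => x; rewrite /xi_fun /=; case: ifPn => [|xI].
  rewrite inE => xI; apply/esym/eqP/negPn/negP => /hs sJ.
  have [[g [sK gK _ _]] sm] := homeoP sigma.
  have : sd_itv I (sigma x).
    have [-> //|sx] := eqVneq (sigma x) x.
    by apply: ss; rewrite /supp /=; apply: contra sx => /eqP /(can_inj sK) ->.
  move: sJ; rewrite /sd_itv /= !in_itv /=; lra.
have -> : sigma x = x.
  by apply/eqP/negPn/negP => /ss sx; move: xI; rewrite mem_set.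
case: ifPn => // xJ; apply/esym/eqP/negPn/negP => /hs hx.
by move: xJ; rewrite mem_set.
Qed.

End Thompson.

Arguments dyadic R : clear implicits.
Arguments thompsonF R : clear implicits.
Arguments sd_itv R I : clear implicits.

Inductive letter := la | lb | la_inv | lb_inv.

Definition letter_code (l : letter) : nat :=
  match l with la => 0 | lb => 1 | la_inv => 2 | lb_inv => 3 end.
Definition letter_decode (n : nat) : option letter :=
  nth None [:: Some la; Some lb; Some la_inv; Some lb_inv] n.
Lemma letter_codeK : pcancel letter_code letter_decode. Proof. by case. Qed.
HB.instance Definition _ := Countable.copy letter (pcan_type letter_codeK).

Definition inv_letter (l : letter) : letter :=
  match l with la => la_inv | lb => lb_inv | la_inv => la | lb_inv => lb end.

(* Half-integers are indexed by their doubles: [rho m] is the label of m/2. *)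
Definition labelling (rho : int -> letter) : Prop := forall n : int,
  rho (2 * n) \in [:: la; la_inv] /\ rho (2 * n + 1) \in [:: lb; lb_inv].

(* The word of the block {m/2, (m+1)/2, ..., (m+n)/2}, which has size n+1. *)
Definition block_word (rho : int -> letter) (m : int) (n : nat) : seq letter :=
  mkseq (fun i => rho (m + i%:Z)) n.+1.

Definition inv_word (w : seq letter) : seq letter := rev (map inv_letter w).

Definition quasi_periodic (rho : int -> letter) : Prop :=
  (forall m n, exists N : nat, forall m' n', (N <= n'.+1)%N ->
     infix (block_word rho m n) (block_word rho m' n')) /\
  (forall m n, exists m' n', block_word rho m' n' = inv_word (block_word rho m n)).

Section Groups.
Variable R : realType.
Implicit Types (rho : int -> letter) (f : homeo R).

Definition zeta rho f : homeo R :=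
  homeo_of (copies 0 (fun n => rho (2 * n + 1) == lb) f).

Definition chi rho f : homeo R :=
  homeo_of (copies (- 2^-1) (fun n => rho (2 * n) == la) f).

Lemma zeta_cong_T rho f : supp f `<=` `[0, 1] -> forall n : int,
  cong_T (zeta rho f) n%:~R (if rho (2 * n + 1) == lb then f else flip f).
Proof.
move=> sf n; rewrite /zeta homeo_ofE; last exact: copies_homeo.
by rewrite -[n%:~R]add0r; apply: (copies_cong_T 0 (fun n => rho (2 * n + 1) == lb)).
Qed.

Lemma chi_cong_T rho f : supp f `<=` `[0, 1] -> forall n : int,
  cong_T (chi rho f) (n%:~R - 2^-1) (if rho (2 * n) == la then f else flip f).
Proof.
move=> sf n; rewrite /chi homeo_ofE; last exact: copies_homeo.
by rewrite addrC; apply: (copies_cong_T (- 2^-1) (fun n => rho (2 * n) == la)).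
Qed.

Definition G_rho (nu_1 nu_2 nu_3 : homeo R) rho : set (homeo R) :=
  gen [set zeta rho nu_1; zeta rho nu_2; zeta rho nu_3;
           chi rho nu_1; chi rho nu_2; chi rho nu_3].

Definition G_rho_alpha (nu_1 nu_2 nu_3 : homeo R) (xi_alpha : homeo R) rho :
    set (homeo R) :=
  gen (G_rho nu_1 nu_2 nu_3 rho `|` [set zeta rho xi_alpha; chi rho xi_alpha]).

End Groups.

(* Main.v *)
Require Import Defs.
From HB Require Import structures.
From mathcomp Require Import all_boot all_order all_algebra.
From mathcomp Require Import all_classical all_reals all_analysis.
From mathcomp Require Import ring lra zify.

Set Implicit Arguments.
Unset Strict Implicit.
Unset Printing Implicit Defensive.

Import Order.TTheory GRing.Theory Num.Theory.
Import numFieldNormedType.Exports.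

Local Open Scope classical_set_scope.
Local Open Scope ring_scope.

(* Part 1. F' consists of the elements of F with compact support in ]0, 1[, and it
   is perfect: the copies of a standard generator r in all standard dyadic
   intervals are conjugate, generate, and the pentagon relation makes r trivial in
   the abelianization. Cut the line into half cells [j/2, (j+1)/2]; commutators of
   elements of zeta(F') and chi(F') produce elements of G which act by copies of a
   given map on the half cells around which rho reads a given word W, and trivially
   elsewhere. Conversely every f in G moves points boundedly and acts near x in a
   way which only depends on the labels near x. As rho is neither periodic nor
   symmetric, f in a normal subgroup N <> 1 moves some small interval in a half
   cell off itself, and off its copies in all half cells with the same long
   surrounding word W0; commutators with f hence put in N the elements localized at
   W0, then by quasi-periodicity those localized at every sufficiently long word,
   and, splitting long words, all of zeta(F') and chi(F'). Their complement in the
   list of generators follows since nu_1 acts near the ends of cells as an element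
   of F' of the other family, and since xi xi^f = xi^u for some f, u in F'.

   Part 2. For a fixed rho (the paperfolding sequence), xi is determined by the
   isomorphism type of the group with the generators nu_1, nu_2, nu_3, xi marked,
   as commutation with elements of F' detects supports. A countable group has
   countably many such markings; likewise for the groups Gamma_alpha, from which
   the slope alpha is recovered. So isomorphism classes are countable-to-one in
   alpha, and Konig's diagonal argument yields continuum many of them, without
   assuming the continuum hypothesis. *)

(** Localizing at a longer word costs a commutator: from elements acting by g and g' one only
    obtains an element acting by [g, g'], and perfectness of F' gives back every g at each
    lengthening. An element localized at W necessarily acts by the reflection of g wherever rho
    reads the inverse of W, because a cell with an inverse label carries reflected maps. To keep the
    two kinds of action from interacting in commutators, g is confined to a standard dyadic interval
    on one side of the midpoint of a half cell, so that it commutes with the reflection of every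
    such map.

    In the second part, sigma_alpha is prescribed only through an abstract isomorphism between the
    group generated by sigma_alpha and F_I and the group Gamma_alpha, which need not respect
    generators; so alpha cannot be read off as a slope of xi_alpha. This is why the passage from
    isomorphism types to alpha has two steps, each countable-to-one rather than injective: from the
    group to sigma_alpha, and from sigma_alpha to f_alpha. *)

Section GroupFacts.
Variable G : groupType.
Implicit Types (A X : set G) (x y z : G).

Lemma subgroupP A : is_subgroup A <->
  [/\ A 1%g, forall x y, A x -> A y -> A (x * y)%g & forall x, A x -> A (x^-1)%g].
Proof.
split=> [gA|[A1 AM AV]].
  have AV := group_closedV gA; have AM := group_closedM gA.
  case: gA => A1 _; split.
  - exact: (set_mem A1).
  - by move=> x y /mem_set xA /mem_set yA; exact: (set_mem (AM x y xA yA)).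
  - by move=> x /mem_set xA; exact: (set_mem (AV x xA)).
by split=> [|x y /set_mem xA /set_mem yA]; apply: mem_set => //; apply: AM => //; apply: AV.
Qed.

Lemma gen_subgroup X : is_subgroup (gen X).
Proof.
apply/subgroupP; split.
- by move=> A [/subgroupP[A1 _ _] _].
- by move=> x y xX yX A hA; case: (hA) => /subgroupP[_ AM _] _; apply: AM; [exact: xX|exact: yX].
- by move=> x xX A hA; case: (hA) => /subgroupP[_ _ AV] _; apply: AV; exact: xX.
Qed.

Lemma sub_gen X : X `<=` gen X. Proof. by move=> x Xx A [_]; apply. Qed.

Lemma gen_sub X A : is_subgroup A -> X `<=` A -> gen X `<=` A.
Proof. by move=> gA XA; apply: smallest_sub. Qed.

Lemma gen1 X : gen X 1%g. Proof. by have /subgroupP[] := gen_subgroup X. Qed.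
Lemma genM X x y : gen X x -> gen X y -> gen X (x * y)%g.
Proof. by have /subgroupP[_ h _] := gen_subgroup X; exact: h. Qed.
Lemma genV X x : gen X x -> gen X (x^-1)%g.
Proof. by have /subgroupP[_ _ h] := gen_subgroup X; exact: h. Qed.

Lemma genS X Y : X `<=` Y -> gen X `<=` gen Y.
Proof. by move=> XY; apply: gen_sub; [exact: gen_subgroup|move=> x /XY; exact: sub_gen]. Qed.

Lemma subgroupJ A x y : is_subgroup A -> A x -> A y -> A (x ^ y)%g.
Proof. by move=> /subgroupP[_ AM AV] Ax Ay; rewrite conjgE; apply: (AM); [exact: AV|exact: AM]. Qed.

Lemma subgroupR A x y : is_subgroup A -> A x -> A y -> A [~ x, y]%g.
Proof.
move=> gA Ax Ay; have /subgroupP[_ AM AV] := gA; rewrite commgEl.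
by apply: AM; [exact: AV|exact: subgroupJ].
Qed.

Lemma subgroupX A x n : is_subgroup A -> A x -> A (x ^+ n)%g.
Proof.
move=> /subgroupP[A1 AM _] Ax; elim: n => [|n IH]; first by rewrite expg0.
by rewrite expgS; apply: AM.
Qed.

Lemma derivedJ A x y : is_subgroup A -> derived A x -> A y -> derived A (x ^ y)%g.
Proof.
move=> gA Dx Ay; suff : gen [set [~ u, v]%g | u in A & v in A] `<=`
  [set x | derived A (x ^ y)%g] by apply.
apply: gen_sub.
  apply/subgroupP; split=> [|u v|u] /=; rewrite ?conj1g ?conjMg ?conjVg.
  - exact: gen1.
  - exact: genM.
  - exact: genV.
move=> _ [u Au] [v Av <-]; rewrite /= conjRg; apply: sub_gen.
by exists (u ^ y)%g; [exact: subgroupJ|exists (v ^ y)%g => //; exact: subgroupJ].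
Qed.

End GroupFacts.

(** * Homeomorphisms of the line and their supports *)

Section HomeoFacts.
Variable R : realType.
Implicit Types (f g h : homeo R) (x y a b : R).

Lemma homeo1 x : (1%g : homeo R) x = x. Proof. by []. Qed.
Lemma homeoK f x : (f^-1)%g (f x) = x. Proof. exact: homeo_invK. Qed.
Lemma homeoVK f x : f ((f^-1)%g x) = x. Proof. exact: homeo_Kinv. Qed.
Lemma homeo_ltE f : {mono f : x y / x < y}.
Proof. by have [_ fm] := homeoP f; apply/leW_mono/le_mono. Qed.
Lemma homeo_leE f : {mono f : x y / x <= y}.
Proof. by have [_ fm] := homeoP f; apply/le_mono. Qed.
Lemma homeo_inj f : injective f. Proof. exact: can_inj (homeoK f). Qed.
Lemma homeoJ f g x : (g ^ f)%g (f x) = f (g x).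
Proof. by rewrite conjgE !homeoM homeoK. Qed.
Lemma homeoJE f g x : (g ^ f)%g x = f (g ((f^-1)%g x)).
Proof. by rewrite -{1}(homeoVK f x) homeoJ. Qed.

(** Stated with the open interval, so that maps on adjacent intervals have disjoint sets of moved
    points; a homeomorphism with support in [a, b] fixes the endpoints anyway. *)
Definition supported a b f : Prop := forall x, ~~ (a < x < b) -> f x = x.

Lemma supportedP a b f : supported a b f <-> supp f `<=` `[a, b].
Proof.
split=> [h x|h x]; last exact: supp_fix.
rewrite /supp /= in_itv /= => fx; apply: contraTT fx => xab; rewrite negbK.
by apply/eqP/h; apply: contra xab => /andP[/ltW -> /ltW ->].
Qed.

Lemma supportedS a b c d f : supported a b f -> c <= a -> b <= d -> supported c d f.
Proof.
move=> h ca bd x xcd; apply: h; apply: contra xcd => /andP[ax xb].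
by rewrite (le_lt_trans ca ax) (lt_le_trans xb bd).
Qed.

Lemma supported1 a b : supported a b 1%g. Proof. by []. Qed.
Lemma supportedM a b f g : supported a b f -> supported a b g -> supported a b (f * g)%g.
Proof. by move=> hf hg x xab; rewrite homeoM hf // hg. Qed.
Lemma supportedV a b f : supported a b f -> supported a b (f^-1)%g.
Proof. by move=> hf x xab; rewrite -{1}(hf x xab) homeoK. Qed.
Lemma supportedJ a b f g : supported a b f -> supported (g a) (g b) (f ^ g)%g.
Proof.
move=> hf x xab; rewrite -{1}(homeoVK g x) homeoJ hf ?homeoVK //.
by rewrite -(homeo_ltE g) -(homeo_ltE g _ b) homeoVK.
Qed.
Lemma supported_itv a b f x : supported a b f -> (a < f x < b) = (a < x < b).
Proof.
move=> hf; apply/idP/idP => [|xab].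
  by apply: contraTT => xab; rewrite hf.
apply: contraTT (xab) => fx; have := supportedV hf fx; rewrite homeoK => ->; exact: fx.
Qed.
Lemma supported_in a b f x : supported a b f -> a <= x <= b -> a <= f x <= b.
Proof.
move=> hf; have [ab|] := boolP (a < x < b); last by move=> /hf ->.
by move: ab; rewrite -(supported_itv _ hf) => /andP[? ?] _; apply/andP; split; apply: ltW.
Qed.
Lemma supported_comm a b c f g : supported a b f -> supported b c g -> commute f g.
Proof.
move=> hf hg; apply: homeo_ext => x; rewrite !homeoM.
have [ab|ab] := boolP (a < x < b).
  have := ab; rewrite -(supported_itv _ hf) => fab.
  have out y : a < y < b -> ~~ (b < y < c) by move=> /andP[_ yb]; rewrite ltNge ltW.
  by rewrite !(hg _ (out _ _)).
rewrite (hf _ ab) hf //; have [bc|bc] := boolP (b < x < c); last by rewrite hg.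
by move: bc; rewrite -(supported_itv _ hg) => /andP[/ltW bx _]; rewrite negb_and -!leNgt bx orbT.
Qed.

(** Conjugation only sees the conjugator on the support. This lets transfer maps be replaced by
    affine maps, which need not preserve [0, 1]. *)
Lemma conj_agree a b f g h : supported a b f ->
  (forall x, a <= x <= b -> g x = h x) -> (f ^ g)%g = (f ^ h)%g.
Proof.
move=> hf gh; apply: homeo_ext => x.
have [ab|ab] := boolP (a < (g^-1)%g x < b).
  have xE : x = h ((g^-1)%g x) by rewrite -gh ?homeoVK //; case/andP: ab => ? ?; rewrite !ltW.
  rewrite -{1}(homeoVK g x) {2}xE !homeoJ gh //.
  by apply: supported_in => //; case/andP: ab => ? ?; rewrite !ltW.
have [ab'|ab'] := boolP (a < (h^-1)%g x < b); last by rewrite !homeoJE !hf // !homeoVK.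
have xE : x = g ((h^-1)%g x) by rewrite gh ?homeoVK //; case/andP: ab' => ? ?; rewrite !ltW.
by move: ab; rewrite xE homeoK ab'.
Qed.

End HomeoFacts.

(** * Dyadic piecewise linear homeomorphisms of the line *)

Section Dyadic.
Variable R : realType.
Implicit Types (x y a b c : R) (f g : homeo R).

Lemma pow2_gt0 (n : nat) : 0 < 2 ^+ n :> R. Proof. by rewrite exprn_gt0. Qed.
Lemma pow2z_gt0 (k : int) : 0 < 2 ^ k :> R. Proof. by rewrite exprz_gt0. Qed.

Lemma dyadicZ (m : int) : dyadic R m%:~R.
Proof. by exists m, 0; rewrite expr0 divr1. Qed.
Lemma dyadic_nat (m : nat) : dyadic R m%:R. Proof. exact: (dyadicZ m). Qed.
Lemma dyadic0 : dyadic R 0. Proof. exact: (dyadic_nat 0). Qed.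
Lemma dyadic1 : dyadic R 1. Proof. exact: (dyadic_nat 1). Qed.
Lemma dyadicM x y : dyadic R x -> dyadic R y -> dyadic R (x * y).
Proof.
move=> [m [n ->]] [p [q ->]]; exists (m * p), (n + q)%N.
by rewrite intrM exprD invfM; ring.
Qed.
Lemma dyadicD x y : dyadic R x -> dyadic R y -> dyadic R (x + y).
Proof.
move=> [m [n ->]] [p [q ->]]; exists (m * 2 ^+ q + p * 2 ^+ n), (n + q)%N.
have := pow2_gt0 n; have := pow2_gt0 q => *.
rewrite intrD !intrM !rmorphXn /= exprD; field.
by rewrite !lt0r_neq0.
Qed.
Lemma dyadicN x : dyadic R x -> dyadic R (- x).
Proof. by move=> [m [n ->]]; exists (- m), n; rewrite mulrNz mulNr. Qed.
Lemma dyadicB x y : dyadic R x -> dyadic R y -> dyadic R (x - y).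
Proof. by move=> dx dy; apply: dyadicD => //; exact: dyadicN. Qed.
Lemma dyadicV2X n : dyadic R (2 ^+ n)^-1.
Proof. by exists 1, n; rewrite mul1r. Qed.
Lemma dyadic2X n : dyadic R (2 ^+ n).
Proof. by exists (2 ^+ n), 0%N; rewrite rmorphXn /= expr0 divr1. Qed.
Lemma dyadic2z (k : int) : dyadic R (2 ^ k).
Proof. by case: k => n; [exact: dyadic2X|exact: dyadicV2X]. Qed.

(* Unlike that of [thompsonF], this description refers to no derivative. *)
Definition dpl_on (s : seq R) (f : R -> R) : Prop :=
  forall x y, x < y -> (forall b, b \in s -> ~~ (x < b < y)) ->
  exists (k : int) c, dyadic R c /\ forall z, x <= z <= y -> f z = 2 ^ k * z + c.

Definition dpl f : Prop :=
  exists2 s : seq R, (forall b, b \in s -> dyadic R b) & dpl_on s f.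

Lemma free_right (s : seq R) x : exists2 y, x < y & forall b, b \in s -> ~~ (x < b < y).
Proof.
elim: s => [|a s [y xy IH]]; first by exists (x + 1) => //; rewrite ltrDl.
have [xa|ax] := ltP x a.
  exists (Num.min a y); first by rewrite lt_min xa.
  move=> b; rewrite inE => /predU1P[->|/IH]; first by rewrite lt_min ltxx andbF.
  by apply: contra; rewrite lt_min => /and3P[-> _ ->].
exists y => // b; rewrite inE => /predU1P[->|/IH] //.
by rewrite (le_gtF ax).
Qed.

Lemma free_left (s : seq R) x : exists2 y, y < x & forall b, b \in s -> ~~ (y < b < x).
Proof.
have [y xy h] := free_right (map -%R s) (- x); exists (- y); first by rewrite ltrNl.
move=> b bs; have := h (- b); rewrite mem_map; last exact: oppr_inj.
by move=> /(_ bs); apply: contra; rewrite ltrNl ltrN2 andbC.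
Qed.

Lemma dpl_right f x : dpl f -> exists (y : R) (k : int) c,
  [/\ x < y, dyadic R c & forall z, x <= z <= y -> f z = 2 ^ k * z + c].
Proof.
move=> [s _ sf]; have [y xy h] := free_right s x.
by have [k [c [dc e]]] := sf _ _ xy h; exists y, k, c.
Qed.

Lemma dpl_dyadic f x : dpl f -> dyadic R x -> dyadic R (f x).
Proof.
move=> /(dpl_right x)[y [k [c [xy dc e]]]] dx.
rewrite e; last by rewrite lexx ltW.
by apply: dyadicD => //; apply: dyadicM => //; exact: dyadic2z.
Qed.

Lemma dplV_dyadic f x : dpl f -> dyadic R x -> dyadic R ((f^-1)%g x).
Proof.
move=> /(dpl_right ((f^-1)%g x))[y [k [c [xy dc e]]]] dx.
have /e : (f^-1)%g x <= (f^-1)%g x <= y by rewrite lexx ltW.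
rewrite homeoVK => xe; have -> : (f^-1)%g x = 2 ^ (- k) * (x - c).
  by rewrite {2}xe addrK mulrA -expfzDr ?pnatr_eq0 // addNr expr0z mul1r.
by apply: dyadicM; [exact: dyadic2z|exact: dyadicB].
Qed.

Lemma dpl1 : dpl 1%g.
Proof.
exists [::] => // x y xy _; exists 0, 0; split; first exact: dyadic0.
by move=> z _; rewrite expr0z mul1r addr0.
Qed.

Lemma dplM f g : dpl f -> dpl g -> dpl (f * g)%g.
Proof.
move=> df dg; have [s ds sf] := df; have [t dt tg] := dg.
exists (s ++ map (f^-1)%g t).
  move=> b; rewrite mem_cat => /orP[/ds //|/mapP[c ct ->]].
  by apply: dplV_dyadic => //; exact: dt.
move=> x y xy h.
have [|k [c [dc ec]]] := sf x y xy; first by move=> b bs; apply: h; rewrite mem_cat bs.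
have [||l [d [dd ed]]] := tg (f x) (f y); first by rewrite homeo_ltE.
  move=> b bt; have := h ((f^-1)%g b); rewrite mem_cat map_f ?orbT //.
  by move=> /(_ isT); apply: contra; rewrite -(homeo_ltE f x) -(homeo_ltE f _ y) homeoVK.
exists (k + l), (2 ^ l * c + d); split.
  by apply: dyadicD => //; apply: dyadicM => //; exact: dyadic2z.
move=> z xzy; rewrite homeoM ed ?homeo_leE // ec //.
by rewrite expfzDr ?pnatr_eq0 //; ring.
Qed.

Lemma dplV f : dpl f -> dpl (f^-1)%g.
Proof.
move=> df; have [s ds sf] := df; exists (map f s).
  by move=> b /mapP[c cs ->]; apply: dpl_dyadic => //; exact: ds.
move=> x y xy h; have [||k [c [dc ec]]] := sf ((f^-1)%g x) ((f^-1)%g y).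
- by rewrite homeo_ltE.
- move=> b bs; have := h (f b) (map_f _ bs); apply: contra.
  by rewrite -(homeo_ltE f ((f^-1)%g x)) -(homeo_ltE f _ ((f^-1)%g y)) !homeoVK.
exists (- k), (- (2 ^ (- k) * c)); split.
  by apply: dyadicN; apply: dyadicM => //; exact: dyadic2z.
move=> z xzy; have /ec : (f^-1)%g x <= (f^-1)%g z <= (f^-1)%g y by rewrite !homeo_leE.
rewrite homeoVK => {2}->; rewrite mulrDr mulrA -expfzDr ?pnatr_eq0 // addNr expr0z.
by rewrite mul1r addrK.
Qed.

Lemma dplJ f g : dpl f -> dpl g -> dpl (f ^ g)%g.
Proof. by move=> df dg; rewrite conjgE; do ?[apply: dplM|apply: dplV]. Qed.

Lemma dplR f g : dpl f -> dpl g -> dpl [~ f, g]%g.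
Proof. by move=> df dg; rewrite commgEl; apply: dplM; [exact: dplV|exact: dplJ]. Qed.

(* The identity unless a > 0. *)
Definition aff a b : homeo R := homeo_of (fun x => a * x + b).

Lemma affE a b x : 0 < a -> aff a b x = a * x + b.
Proof.
move=> a0; rewrite homeo_ofE //; apply: (@is_homeo_posI _ _ (fun x => (x - b) / a)).
- by move=> y; field; rewrite lt0r_neq0.
- by move=> y; field; rewrite lt0r_neq0.
- by move=> y z yz; rewrite ltrD2r ltr_pM2l.
Qed.

Lemma dpl_aff (k : int) b : dyadic R b -> dpl (aff (2 ^ k) b).
Proof.
move=> db; exists [::] => // x y xy _; exists k, b; split=> // z _.
by rewrite affE // pow2z_gt0.
Qed.

Lemma affVE a b x : 0 < a -> ((aff a b)^-1)%g x = (x - b) / a.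
Proof.
move=> a0; apply: (@homeo_inj _ (aff a b)); rewrite homeoVK affE //.
by field; rewrite lt0r_neq0.
Qed.

Lemma dpl_flip f : dpl f -> dpl (flip f).
Proof.
move=> [s ds sf]; exists (map (fun b => 1 - b) s).
  by move=> b /mapP[c cs ->]; apply: dyadicB; [exact: dyadic1|exact: ds].
move=> x y xy h; have [||k [c [dc ec]]] := sf (1 - y) (1 - x).
- by rewrite ltrD2l ltrN2.
- move=> b bs; have := h (1 - b) (map_f _ bs); apply: contra => /andP[? ?].
  by apply/andP; split; lra.
exists k, (1 - 2 ^ k - c); split.
  by do 2![apply: dyadicB => //]; [exact: dyadic1|exact: dyadic2z].
move=> z xzy; rewrite flipE ec; first by ring.
by move: xzy => /andP[? ?]; apply/andP; split; lra.
Qed.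

Lemma flipK f : flip (flip f) = f.
Proof. by apply: homeo_ext => x; rewrite !flipE !subKr. Qed.
Lemma flipM f g : flip (f * g)%g = (flip f * flip g)%g.
Proof. by apply: homeo_ext => x; rewrite homeoM !flipE homeoM !subKr. Qed.
Lemma flip1 : flip 1%g = 1%g :> homeo R.
Proof. by apply: homeo_ext => x; rewrite !flipE !homeo1 subKr. Qed.
Lemma supported_flip a b f : supported a b f -> supported (1 - b) (1 - a) (flip f).
Proof.
move=> hf x xab; rewrite flipE hf ?subKr //; apply: contra xab => /andP[? ?].
by apply/andP; split; lra.
Qed.

End Dyadic.

(** * F without derivatives *)

Section ThompsonDpl.
Variable R : realType.
Implicit Types (x y a b c : R) (f g : homeo R).

(** The limit may be tested along increments that stay in [u, v], where the difference quotient is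
    constant. As x may be an endpoint, two affine pieces meeting at a point of derivability have the
    same slope. *)
Lemma derive_side (f : R -> R) a c x (u v : R) : u < v -> u <= x <= v ->
  (forall z, u <= z <= v -> f z = a * z + c) -> derivable f x 1 -> derive1 f x = a.
Proof.
move=> uv uxv fE df; rewrite derive1E /derive.
have {df} := df; rewrite /derivable; set q := (fun h : R => _).
move=> /cvg_ex[L qL]; have -> : lim (q @ 0^') = L by apply: cvg_lim.
apply/eqP/negPn/negP => La.
have e0 : 0 < `|L - a| by rewrite normr_gt0 subr_eq0.
have /cvgrPdist_lt/(_ _ e0) := qL.
move=> /nbhs_ballP[/= d d0 hd].
have [h [h0 hb hE]] : exists h : R, [/\ h != 0, `|h| < d & u <= h + x <= v].
  case/andP: uxv => ux xv; have [vx|xv'] := leP v x.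
    exists (- (Num.min (d / 2) (v - u))).
    have m0 : 0 < Num.min (d / 2) (v - u) by rewrite lt_min; apply/andP; split; lra.
    rewrite oppr_eq0 gt_eqF // normrN gtr0_norm //; split=> //.
      by rewrite gt_min; apply/orP; left; lra.
    have : Num.min (d / 2) (v - u) <= v - u by rewrite ge_min lexx orbT.
    by move=> ?; apply/andP; split; lra.
  exists (Num.min (d / 2) (v - x)).
  have m0 : 0 < Num.min (d / 2) (v - x) by rewrite lt_min; apply/andP; split; lra.
  rewrite gt_eqF // gtr0_norm //; split=> //.
    by rewrite gt_min; apply/orP; left; lra.
  have : Num.min (d / 2) (v - x) <= v - x by rewrite ge_min lexx orbT.
  by move=> ?; apply/andP; split; lra.
have := hd h; rewrite /ball /= sub0r normrN => /(_ hb h0).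
rewrite /q /= [h *: 1]mulr1 !fE // (_ : _ *: _ = a); first by rewrite ltxx.
by rewrite /GRing.scale /=; field.
Qed.

Lemma affine_derivable (f : R -> R) a c x (u v : R) : u < x < v ->
  (forall z, u <= z <= v -> f z = a * z + c) -> derivable f x 1.
Proof.
move=> /andP[ux xv] fE; rewrite /derivable; set q := (fun h : R => _).
apply: (cvgP a); apply/cvgrPdist_lt => e e0.
have d0 : 0 < Num.min (x - u) (v - x) by rewrite lt_min; apply/andP; split; lra.
apply/nbhs_ballP; exists (Num.min (x - u) (v - x)) => //= h.
rewrite /ball /= sub0r normrN lt_min => /andP[h1 h2] h0.
have xE : f x = a * x + c by rewrite fE // !ltW.
have hE : f (h + x) = a * (h + x) + c.
  by move: h1 h2; rewrite !ltr_norml => /andP[? ?] /andP[? ?]; rewrite fE //; apply/andP; split; lra.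
rewrite /q /= [h *: 1]mulr1 xE hE (_ : _ *: _ = a); first by rewrite subrr normr0.
by rewrite /GRing.scale /=; field.
Qed.

Definition PL_off (f : R -> R) (P : R -> Prop) := forall x y : R, 0 <= x -> x < y -> y <= 1 ->
  (forall b, P b -> ~~ (x < b < y)) -> affine_on f `[x, y].

(** Both pieces at b have the derivative as slope and the same value at b, hence they form one
    affine piece. *)
Lemma PL_off_drop (f : R -> R) (P : R -> Prop) b :
  PL_off f (fun z => z = b \/ P z) -> (0 < b < 1 -> derivable f b 1) -> PL_off f P.
Proof.
move=> hf db x y x0 xy y1 h.
have [xb|xb] := boolP (x < b < y); last first.
  by apply: hf => // z [->|/h].
case/andP: (xb) => xb1 by1.
have [a [c e]] : affine_on f `[x, b].
  apply: hf => //; first lra.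
  move=> z [->|/h]; first by rewrite ltxx andbF.
  by apply: contra => /andP[-> /lt_trans->].
have [a' [c' e']] : affine_on f `[b, y].
  apply: hf => //; first lra.
  move=> z [->|/h]; first by rewrite ltxx.
  by apply: contra => /andP[/(lt_trans xb1) -> ->].
have {db}db : derivable f b 1 by apply: db; apply/andP; split; lra.
have E : derive1 f b = a.
  by apply: (@derive_side f a c b x b) => //; rewrite lexx ltW.
have E' : derive1 f b = a'.
  by apply: (@derive_side f a' c' b b y) => //; rewrite lexx ltW.
have aa : a' = a by rewrite -E'.
have cc : c' = c.
  have := e b; have := e' b; rewrite /= !in_itv /= !lexx (ltW xb1) (ltW by1) aa.
  by move=> /(_ isT) -> /(_ isT) /addrI.
exists a, c => z; rewrite /= in_itv /= => /andP[xz zy].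
have [zb|bz] := leP z b; first by apply: e; rewrite /= in_itv /= xz.
by rewrite -aa -cc; apply: e'; rewrite /= in_itv /= zy ltW.
Qed.

(** Candidates are discarded one at a time; [P] collects those set aside while the induction treats
    the rest of the list. What remains are points of non-derivability inside ]0, 1[, which are
    dyadic for elements of F. *)
Lemma PL_off_bad (f : R -> R) (s : seq R) (P : R -> Prop) :
  PL_off f (fun z => z \in s \/ P z) ->
  PL_off f (fun z => (0 < z < 1 /\ ~ derivable f z 1) /\ z \in s \/ P z).
Proof.
elim: s P => [|b s IH] P hf.
  by move=> x y x0 xy y1 h; apply: hf => // z [//|Pz]; apply: h; right.
have {}IH := IH (fun z => z = b \/ P z).
have {IH} IH : PL_off f (fun z => (0 < z < 1 /\ ~ derivable f z 1) /\ z \in s \/ z = b \/ P z).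
  apply: IH => x y x0 xy y1 h; apply: hf => // z [|Pz]; last by apply: h; right; right.
  by rewrite inE => /predU1P[->|zs]; apply: h; [right; left|left].
have [bad|good] := pselect (0 < b < 1 /\ ~ derivable f b 1).
  move=> x y x0 xy y1 h; apply: IH => // z [[zb zs]|[->|Pz]].
  - by apply: h; left; split=> //; rewrite inE zs orbT.
  - by apply: h; left; split=> //; rewrite inE eqxx.
  - by apply: h; right.
apply: (@PL_off_drop f _ b).
  move=> x y x0 xy y1 h; apply: IH => // z [[zb zs]|[->|Pz]].
  - by apply: h; right; left; split; [exact: zb|rewrite inE zs orbT].
  - by apply: h; left.
  - by apply: h; right; right.
by move=> b01; apply: contrapT => nd; apply: good.
Qed.

Lemma dyadic_common (s : seq R) : (forall b, b \in s -> dyadic R b) ->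
  exists N : nat, forall n, (N <= n)%N -> forall b, b \in s -> exists m : int, b = m%:~R / 2 ^+ n.
Proof.
elim: s => [|a s IH] ds; first by exists 0%N.
have [|N hN] := IH; first by move=> b bs; apply: ds; rewrite inE bs orbT.
have [|m [k ak]] := ds a; first by rewrite inE eqxx.
exists (maxn N k) => n; rewrite geq_max => /andP[Nn kn] b; rewrite inE => /predU1P[->|]; last exact: hN.
exists (m * 2 ^+ (n - k)); rewrite ak intrM rmorphXn /= -{2}(subnK kn) exprD.
have := pow2_gt0 R k; have := pow2_gt0 R (n - k) => ? ?.
by field; rewrite !gt_eqF.
Qed.

Definition grid (N : nat) : seq R := [seq i%:R / 2 ^+ N | i <- iota 0 (2 ^ N).+1].

Lemma gridP N b : reflect (exists2 i : nat, (i <= 2 ^ N)%N & b = i%:R / 2 ^+ N) (b \in grid N).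
Proof.
apply: (iffP mapP) => [[i]|[i iN ->]]; first by rewrite mem_iota /= add0n ltnS; exists i.
by exists i => //; rewrite mem_iota /= add0n ltnS.
Qed.

Lemma grid_dyadic N b : b \in grid N -> dyadic R b.
Proof. by move=> /gridP[i _ ->]; exists (i : int), N. Qed.

Lemma grid_free N x y : x < y -> (forall b, b \in grid N -> ~~ (x < b < y)) ->
  [\/ y <= 0, 1 <= x | exists2 p : nat, (p < 2 ^ N)%N & p%:R / 2 ^+ N <= x /\ y <= p.+1%:R / 2 ^+ N].
Proof.
move=> xy h; have [y0|y0] := leP y 0; first exact: Or31.
have [x1|x1] := leP 1 x; first exact: Or32.
have h0 := pow2_gt0 R N.
have x0 : 0 <= x.
  rewrite leNgt; apply/negP => x0; have /h : (0 : R) \in grid N.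
    by apply/gridP; exists 0%N => //; rewrite mul0r.
  by rewrite x0 y0.
apply: Or33; have := floor_itv (x * 2 ^+ N).
have : 0 <= Num.floor (x * 2 ^+ N) by rewrite floor_ge0 mulr_ge0 // ltW.
case: (Num.floor _) => // p _; rewrite intrD => /andP[p1 p2].
have pN : (p < 2 ^ N)%N.
  rewrite -(ltr_nat R) natrX; apply: (le_lt_trans p1).
  by rewrite -{2}[2 ^+ N]mul1r ltr_pM2r.
exists p => //; rewrite ler_pdivrMr //; split=> //.
rewrite leNgt; apply/negP => py; have /h : (p.+1%:R / 2 ^+ N : R) \in grid N.
  by apply/gridP; exists p.+1.
by rewrite py andbT ltr_pdivlMr // -[p.+1%:R]natr1 => /negP[]; exact: p2.
Qed.

(** A fine enough dyadic grid contains all breakpoints inside ]0, 1[. On a cell, the slope is the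
    derivative at the midpoint, a power of 2; the values at grid points, and with them the constant
    terms, are dyadic by induction from [f 0 = 0]. *)
Lemma thompson_grid f : thompsonF R f -> exists N0 : nat, forall N, (N0 <= N)%N ->
  forall p : nat, (p < 2 ^ N)%N -> exists (k : int) c, dyadic R c /\
    forall z, p%:R / 2 ^+ N <= z <= p.+1%:R / 2 ^+ N -> f z = 2 ^ k * z + c.
Proof.
case=> -[sf [B fB hB]] nd der.
have /finite_seqP[s sB] := fB.
pose bad z := 0 < z < 1 /\ ~ derivable f z 1.
have hf : PL_off f (fun z => bad z /\ z \in s).
  have : PL_off f (fun z => bad z /\ z \in s \/ False).
    apply: PL_off_bad => x y x0 xy y1 h; apply: hB => //.
    apply/seteqP; split=> // z [/= zxy]; rewrite sB /= => zs.
    by have := h z (or_introl zs); move: zxy; rewrite in_itv /= => ->.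
  by move=> h x y x0 xy y1 h'; apply: h => // b [/h'|].
pose s' := [seq z <- s | `[< bad z >]].
have [N0 hN0] : exists N : nat, forall n, (N <= n)%N -> forall b, b \in s' ->
    exists m : int, b = m%:~R / 2 ^+ n.
  apply: dyadic_common => b; rewrite mem_filter => /andP[/asboolP[b01 ndb] _].
  by apply: nd => //; rewrite in_itv.
exists N0 => N /hN0 {hN0}hN; have h0 := pow2_gt0 R N.
have cell p : (p < 2 ^ N)%N -> exists (k : int) c,
    forall z, p%:R / 2 ^+ N <= z <= p.+1%:R / 2 ^+ N -> f z = 2 ^ k * z + c.
  move=> pN; have uv : p%:R / 2 ^+ N < p.+1%:R / 2 ^+ N :> R.
    by rewrite ltr_pM2r ?invr_gt0 // ltr_nat.
  have p0 : 0 <= p%:R / 2 ^+ N :> R by rewrite divr_ge0 // ltW.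
  have p1 : p.+1%:R / 2 ^+ N <= 1 :> R by rewrite ler_pdivrMr // mul1r -natrX ler_nat.
  have [|a [c e]] := hf (p%:R / 2 ^+ N) (p.+1%:R / 2 ^+ N) p0 uv p1.
    move=> b [bb bs]; have [|m ->] := hN b.
      by rewrite mem_filter bs andbT; apply/asboolP.
    rewrite !ltr_pM2r ?invr_gt0 // [p%:R]pmulrn [p.+1%:R]pmulrn !ltr_int.
    by apply/negP => /andP[]; lia.
  have {}e z : p%:R / 2 ^+ N <= z <= p.+1%:R / 2 ^+ N -> f z = a * z + c.
    by move=> hz; apply: e; rewrite /= in_itv.
  set u := _ / _ in uv p0 e; set v := _ / _ in uv p1 e.
  pose m := (u + v) / 2.
  have umv : u < m < v by rewrite /m; apply/andP; split; lra.
  have dm := affine_derivable umv e.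
  have [|k dk] := der m _ dm; first by rewrite in_itv /=; apply/andP; split; lra.
  exists k, c; rewrite -dk (derive_side uv _ e dm) //.
  by case/andP: umv => ? ?; rewrite !ltW.
have dyad p : (p <= 2 ^ N)%N -> dyadic R (f (p%:R / 2 ^+ N)).
  elim: p => [|p IH] pN.
    rewrite mul0r (supp_fix sf) ?ltxx //; exact: dyadic0.
  have [k [c e]] := cell p pN.
  have uv : p%:R / 2 ^+ N <= p.+1%:R / 2 ^+ N :> R.
    by rewrite ler_pM2r ?invr_gt0 // ler_nat.
  have -> : f (p.+1%:R / 2 ^+ N) = f (p%:R / 2 ^+ N) + 2 ^ k * (2 ^+ N)^-1.
    by rewrite !e ?lexx ?uv // -[p.+1%:R]natr1; ring.
  apply: dyadicD; first exact: IH (ltnW pN).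
  by apply: dyadicM; [exact: dyadic2z|exact: dyadicV2X].
move=> p pN; have [k [c e]] := cell p pN; exists k, c; split=> //.
have uv : p%:R / 2 ^+ N <= p.+1%:R / 2 ^+ N :> R.
  by rewrite ler_pM2r ?invr_gt0 // ler_nat.
have -> : c = f (p%:R / 2 ^+ N) - 2 ^ k * (p%:R / 2 ^+ N) by rewrite e ?lexx ?uv //; ring.
apply: dyadicB; first by apply: dyad; exact: ltnW.
apply: dyadicM; [exact: dyadic2z|apply: dyadicM; [exact: dyadic_nat|exact: dyadicV2X]].
Qed.

Lemma thompsonFP f : thompsonF R f <-> dpl f /\ supported 0 1 f.
Proof.
split=> [fF|[[s ds sf] s01]].
  have s01 : supported 0 1 f by apply/supportedP; case: fF => -[].
  split=> //; have [N hN] := thompson_grid fF; have {hN} cell := hN N (leqnn N).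
  exists (grid N); first exact: grid_dyadic.
  move=> x y xy h; have [y0|x1|[p pN [px yp]]] := grid_free xy h.
  - exists 0, 0; split; first exact: dyadic0.
    move=> z /andP[_ zy]; rewrite expr0z mul1r addr0 s01 //.
    by apply/negP => /andP[]; lra.
  - exists 0, 0; split; first exact: dyadic0.
    move=> z /andP[xz _]; rewrite expr0z mul1r addr0 s01 //.
    by apply/negP => /andP[]; lra.
  have [k [c [dc e]]] := cell p pN; exists k, c; split=> // z /andP[xz zy].
  by apply: e; rewrite (le_trans px xz) (le_trans zy yp).
split.
- split; first exact/supportedP.
  exists [set` s]; first exact: finite_seq.
  move=> x y x0 xy y1 /seteqP[h _].
  have [|k [c [_ e]]] := sf x y xy.
    by move=> b bs; apply/negP => xby; apply: (h b); split=> //=; rewrite in_itv.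
  by exists (2 ^ k), c => z; rewrite /= in_itv /=; exact: e.
- move=> x x01 nd; apply: ds; apply: contrapT => /negP xs; apply: nd.
  have [u ux hu] := free_left s x; have [v xv hv] := free_right s x.
  have [|k [c [_ e]]] := sf u v (lt_trans ux xv).
    move=> b bs; apply/negP => /andP[ub bv].
    have [bx|xb|bx] := ltgtP b x; last by rewrite -bx bs in xs.
      by have := hu b bs; rewrite ub bx.
    by have := hv b bs; rewrite xb bv.
  by apply: (@affine_derivable f (2 ^ k) c x u v) => //; rewrite ux xv.
move=> x x01 dx; have [v xv hv] := free_right s x.
have [k [c [_ e]]] := sf x v xv hv; exists k.
by apply: (derive_side xv _ e dx); rewrite lexx ltW.
Qed.

Lemma thompsonF_subgroup : is_subgroup (thompsonF R).
Proof.
apply/subgroupP; split.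
- by apply/thompsonFP; split; [exact: dpl1|exact: supported1].
- move=> f g /thompsonFP[df sf] /thompsonFP[dg sg]; apply/thompsonFP.
  by split; [exact: dplM|exact: supportedM].
- move=> f /thompsonFP[df sf]; apply/thompsonFP.
  by split; [exact: dplV|exact: supportedV].
Qed.

End ThompsonDpl.

(** * The derived subgroup of F *)

Section CompactlySupported.
Variable R : realType.
Implicit Types (x y z a b : R) (f g u : homeo R).

(* The elements of F supported in a compact subset of ]0, 1[; this is F'. *)
Definition Fc : set (homeo R) :=
  [set f | dpl f /\ exists2 e : R, 0 < e & supported e (1 - e) f].

Lemma Fc_of f a b : dpl f -> 0 < a -> b < 1 -> supported a b f -> Fc f.
Proof.
move=> df a0 b1 sf; split=> //; exists (Num.min a (1 - b)).
  by rewrite lt_min a0 subr_gt0.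
apply: supportedS sf _ _; first by rewrite ge_min lexx.
by rewrite lerBrDr addrC -lerBrDr ge_min lexx orbT.
Qed.

Lemma Fc_supp f : Fc f -> exists a b, [/\ 0 < a, a < b, b < 1 & supported a b f].
Proof.
move=> [_ [e e0 sf]]; have m0 : 0 < Num.min e (1 / 4) by rewrite lt_min e0; lra.
have m1 : Num.min e (1 / 4) <= 1 / 4 by rewrite ge_min lexx orbT.
exists (Num.min e (1 / 4)), (1 - Num.min e (1 / 4)); split=> //; try lra.
by apply: supportedS sf _ _; [rewrite ge_min lexx|rewrite lerD2l lerN2 ge_min lexx].
Qed.

Lemma Fc_dpl f : Fc f -> dpl f. Proof. by case. Qed.

Lemma Fc_sub01 f : Fc f -> supported 0 1 f.
Proof. by move=> [_ [e e0 sf]]; apply: supportedS sf _ _; lra. Qed.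

Lemma Fc_F f : Fc f -> thompsonF R f.
Proof. by move=> cf; apply/thompsonFP; split; [exact: Fc_dpl|exact: Fc_sub01]. Qed.

Lemma Fc_subgroup : is_subgroup Fc.
Proof.
apply/subgroupP; split.
- by split; [exact: dpl1|exists 1 => //; exact: supported1].
- move=> f g [df [e e0 sf]] [dg [d d0 sg]]; split; first exact: dplM.
  have m0 : 0 < Num.min e d by rewrite lt_min e0.
  have me : Num.min e d <= e by rewrite ge_min lexx.
  have md : Num.min e d <= d by rewrite ge_min lexx orbT.
  exists (Num.min e d) => //; apply: supportedM; [apply: supportedS sf _ _|apply: supportedS sg _ _] => //; lra.
- by move=> f [df [e e0 sf]]; split; [exact: dplV|exists e => //; exact: supportedV].
Qed.

Lemma FcM f g : Fc f -> Fc g -> Fc (f * g)%g.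
Proof. by have /subgroupP[_ h _] := Fc_subgroup; exact: h. Qed.
Lemma FcV f : Fc f -> Fc (f^-1)%g.
Proof. by have /subgroupP[_ _ h] := Fc_subgroup; exact: h. Qed.
Lemma FcJ f g : Fc f -> Fc g -> Fc (f ^ g)%g.
Proof. exact: subgroupJ Fc_subgroup. Qed.
Lemma FcR f g : Fc f -> Fc g -> Fc [~ f, g]%g.
Proof. exact: subgroupR Fc_subgroup. Qed.

Lemma Fc_flip f : Fc f -> Fc (flip f).
Proof.
move=> [df [e e0 sf]]; split; first exact: dpl_flip.
by exists e => //; have := supported_flip sf; rewrite subKr.
Qed.

Lemma germ0 f : thompsonF R f -> exists (k : int) e,
  0 < e /\ forall z, 0 <= z <= e -> f z = 2 ^ k * z.
Proof.
move=> /thompsonFP[df sf]; have [y [k [c [y0 _ e]]]] := dpl_right 0 df.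
have c0 : c = 0.
  have := e 0; rewrite lexx ltW // sf ?ltxx // mulr0 add0r.
  by move=> /(_ isT) <-.
by exists k, y; split=> // z /e ->; rewrite c0 addr0.
Qed.

(** Near 0 both maps are multiplications by constants, hence commute. The bound [d] keeps z, f z and
    g z within the ranges where this holds; the commutator is then trivial below the image of [d]
    under [g * f]. *)
Lemma commg_germ0 f g : thompsonF R f -> thompsonF R g ->
  exists2 e, 0 < e & forall z, z <= e -> [~ f, g]%g z = z.
Proof.
move=> Ff Fg; have [k [a [a0 fE]]] := germ0 Ff; have [l [b [b0 gE]]] := germ0 Fg.
have k0 := pow2z_gt0 R k; have l0 := pow2z_gt0 R l.
have [/thompsonFP[_ sf] /thompsonFP[_ sg]] := (Ff, Fg).
pose d := Num.min (Num.min a b) (Num.min (a / 2 ^ l) (b / 2 ^ k)).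
have d0 : 0 < d by rewrite !lt_min a0 b0 !divr_gt0.
have [da db dal dbk] : [/\ d <= a, d <= b, d <= a / 2 ^ l & d <= b / 2 ^ k].
  by split; rewrite !ge_min lexx ?orbT.
have E z : 0 <= z <= d -> (f * g)%g z = (g * f)%g z.
  move=> /andP[z0 zd]; rewrite !homeoM fE ?z0 ?(le_trans zd) //.
  rewrite (gE z) ?z0 ?(le_trans zd) //.
  rewrite gE; last first.
    apply/andP; split; first by apply: mulr_ge0 => //; exact: ltW.
    by rewrite mulrC -ler_pdivlMr // (le_trans zd).
  rewrite fE; last first.
    apply/andP; split; first by apply: mulr_ge0 => //; exact: ltW.
    by rewrite mulrC -ler_pdivlMr // (le_trans zd).
  by ring.
have RE : [~ f, g]%g = ((g * f)^-1 * (f * g))%g.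
  by rewrite commgEl conjgE invgM !mulgA.
exists ((g * f)%g d).
  by rewrite -[X in X < _](_ : (g * f)%g 0 = 0) ?homeo_ltE // homeoM sg ?sf ?ltxx.
move=> z zd; have [z0|z0] := leP z 0.
  have z01 : ~~ (0 < z < 1) by rewrite (le_gtF z0).
  have sR : supported 0 1 [~ f, g]%g.
    rewrite commgEl conjgE; apply: supportedM; first exact: supportedV.
    by apply: supportedM; [exact: supportedV|exact: supportedM].
  exact: sR.
rewrite RE homeoM E; first by rewrite homeoVK.
rewrite -(homeo_leE (g * f)%g 0) -(homeo_leE (g * f)%g _ d) homeoVK zd andbT.
by rewrite homeoM sg ?sf ?ltxx // ltW.
Qed.

(** The germ at 1 is the germ at 0 of the reflected maps. The inclusion serves to place the transfer
    maps [fI I J] in [Fc]. *)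
Lemma derivedF_Fc : derived (thompsonF R) `<=` Fc.
Proof.
apply: gen_sub; first exact: Fc_subgroup.
move=> _ [f Ff] [g Fg <-].
have flipF h : thompsonF R h -> thompsonF R (flip h).
  move=> /thompsonFP[dh sh]; apply/thompsonFP; split; first exact: dpl_flip.
  by have := supported_flip sh; rewrite subrr subr0.
have [e e0 hE] := commg_germ0 Ff Fg.
have [d d0 hD] := commg_germ0 (flipF _ Ff) (flipF _ Fg).
have [/thompsonFP[df _] /thompsonFP[dg _]] := (Ff, Fg).
split; first exact: dplR.
have m0 : 0 < Num.min e d by rewrite lt_min e0.
have me : Num.min e d <= e by rewrite ge_min lexx.
have md : Num.min e d <= d by rewrite ge_min lexx orbT.
have RE : [~ flip f, flip g]%g = flip [~ f, g]%g.
  by rewrite !commgEl !conjgE !flipM !flipV.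
exists (Num.min e d) => // z; rewrite negb_and -!leNgt => /orP[ze|dz].
  by apply: hE; lra.
have := hD (1 - z); rewrite RE flipE subKr => h; have : 1 - z <= d by lra.
by move=> /h; lra.
Qed.

End CompactlySupported.
Arguments Fc R : clear implicits.

(** * Standard dyadic intervals and transfer maps *)

Section StandardIntervals.
Variable R : realType.
Implicit Types (x y z a b : R) (f g u : homeo R) (I J : nat * nat).

Definition sd_aff I : homeo R := aff (2 ^ (- (I.2 : int))) (I.1%:R / 2 ^+ I.2).

Lemma sd_affE I x : sd_aff I x = (I.1%:R + x) / 2 ^+ I.2.
Proof. by rewrite affE ?pow2z_gt0 // -exprnN mulrC mulrDl addrC. Qed.

Lemma sd_aff_dpl I : dpl (sd_aff I).
Proof.
by apply: dpl_aff; apply: dyadicM; [exact: dyadic_nat|exact: dyadicV2X].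
Qed.

Lemma sd_aff0 I : sd_aff I 0 = I.1%:R / 2 ^+ I.2.
Proof. by rewrite sd_affE addr0. Qed.
Lemma sd_aff1 I : sd_aff I 1 = I.1.+1%:R / 2 ^+ I.2.
Proof. by rewrite sd_affE natr1. Qed.

Lemma sd_itvE I x : sd_itv R I x <-> sd_aff I 0 <= x <= sd_aff I 1.
Proof. by rewrite /sd_itv /= in_itv sd_aff0 sd_aff1. Qed.

Lemma innerP I : inner R I <-> (0 < I.1)%N /\ (I.1.+1 < 2 ^ I.2)%N.
Proof.
have h0 := pow2_gt0 R I.2.
have -> : (0 < I.1)%N = (0 < sd_aff I 0) by rewrite sd_aff0 pmulr_lgt0 ?invr_gt0 // ltr0n.
have -> : (I.1.+1 < 2 ^ I.2)%N = (sd_aff I 1 < 1).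
  by rewrite sd_aff1 ltr_pdivrMr // mul1r -natrX ltr_nat.
have le01 : sd_aff I 0 <= sd_aff I 1 by rewrite homeo_leE.
split=> [h|[h1 h2] x /sd_itvE /andP[xl xr]].
  have := h (sd_aff I 0); have := h (sd_aff I 1).
  rewrite /= !in_itv /= => h1 h2; have := h1; have := h2.
  by rewrite !sd_itvE !lexx le01 => /(_ isT)/andP[-> _] /(_ isT)/andP[_ ->].
by rewrite /= in_itv /= (lt_le_trans h1 xl) (le_lt_trans xr h2).
Qed.

Lemma inner_aff I : inner R I -> 0 < sd_aff I 0 /\ sd_aff I 1 < 1.
Proof.
have h0 := pow2_gt0 R I.2; move=> /innerP[i0 i1]; split.
  by rewrite sd_aff0 pmulr_lgt0 ?invr_gt0 // ltr0n.
by rewrite sd_aff1 ltr_pdivrMr // mul1r -natrX ltr_nat.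
Qed.

Variable fI : nat * nat -> nat * nat -> homeo R.
Hypothesis fI_transfer : is_transfer fI.

Lemma fI_Fc I J : inner R I -> inner R J -> Fc R (fI I J).
Proof. by move=> iI iJ; have [h _ _ _] := fI_transfer iI iJ; exact: derivedF_Fc. Qed.

(** An increasing map of one interval onto another matches endpoints, and an affine map is
    determined by two values. *)
Lemma fI_aff I J x : inner R I -> inner R J -> 0 <= x <= 1 ->
  fI I J (sd_aff I x) = sd_aff J x.
Proof.
move=> iI iJ x01; have [_ im [a [b fE]] _] := fI_transfer iI iJ.
have I01 : sd_aff I 0 <= sd_aff I 1 by rewrite homeo_leE.
have J01 : sd_aff J 0 <= sd_aff J 1 by rewrite homeo_leE.
have fJ z : sd_aff I 0 <= z <= sd_aff I 1 -> sd_aff J 0 <= fI I J z <= sd_aff J 1.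
  by move=> hz; apply/sd_itvE; rewrite -im; exists z => //; apply/sd_itvE.
have E0 : fI I J (sd_aff I 0) = sd_aff J 0.
  have : sd_itv R J (sd_aff J 0) by apply/sd_itvE; rewrite lexx.
  rewrite -im => -[z /sd_itvE /andP[z0 _] zE]; apply/eqP; rewrite eq_le -{1}zE homeo_leE z0.
  have /fJ : sd_aff I 0 <= sd_aff I 0 <= sd_aff I 1 by rewrite lexx.
  by case/andP.
have E1 : fI I J (sd_aff I 1) = sd_aff J 1.
  have : sd_itv R J (sd_aff J 1) by apply/sd_itvE; rewrite lexx J01.
  rewrite -im => -[z /sd_itvE /andP[_ z1] zE]; apply/eqP; rewrite eq_le -{2}zE homeo_leE z1 andbT.
  have /fJ : sd_aff I 0 <= sd_aff I 1 <= sd_aff I 1 by rewrite lexx I01.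
  by case/andP.
have aE z : 0 <= z <= 1 -> fI I J (sd_aff I z) = a * sd_aff I z + b.
  by move=> z01; apply: fE; apply/sd_itvE; rewrite !homeo_leE.
move: E0 E1; rewrite !aE ?lexx ?ler01 // !sd_affE.
set c := (2 ^+ I.2)^-1; set d := (2 ^+ J.2)^-1 => E0 E1.
have acd : a * c = d by lra.
have -> : a * ((I.1%:R + x) * c) + b = a * ((I.1%:R + 0) * c) + b + (a * c) * x by ring.
by rewrite E0 acd; ring.
Qed.

Lemma conj_fI I J f : inner R I -> inner R J -> supported 0 1 f ->
  ((f ^ sd_aff I) ^ fI I J)%g = (f ^ sd_aff J)%g.
Proof.
move=> iI iJ sf; rewrite -conjgM; apply: conj_agree sf _ => x x01.
by rewrite homeoM fI_aff.
Qed.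

Lemma copy_Fc I f : inner R I -> dpl f -> supported 0 1 f -> Fc R (f ^ sd_aff I)%g.
Proof.
move=> /inner_aff[i0 i1] df sf; apply: (Fc_of _ i0 i1); last exact: supportedJ.
by apply: dplJ => //; exact: sd_aff_dpl.
Qed.

End StandardIntervals.

(** * Displacing points by dyadic maps with small support *)

Section Pushing.
Variable R : realType.
Implicit Types (x y z a b : R) (f g u : homeo R) (I J : nat * nat).
Variable c0 : homeo R.
Hypothesis c0_F : thompsonF R c0.
Hypothesis c0_supp : supp c0 = `]0, 1 / 4[%classic.
Hypothesis c0_gt : forall x : R, 0 < x < 1 / 4 -> x < c0 x.

Lemma pow2_small (e : R) : 0 < e -> exists n : nat, (2 ^+ n)^-1 < e.
Proof.
move=> e0; have := floor_itv (e^-1); rewrite intrD => /andP[_].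
have : 0 <= Num.floor e^-1 by rewrite floor_ge0 invr_ge0 ltW.
case: (Num.floor _) => // n _ h; exists n.+1; rewrite invf_plt ?posrE //.
apply: (lt_le_trans h); rewrite natr1 -natrX ler_nat ltnW //.
exact: ltn_expl.
Qed.

Lemma c0_supported : supported 0 (1 / 4) c0.
Proof. by apply/supportedP; rewrite c0_supp; apply: subset_itvW. Qed.

(** A copy of [c0] scaled by [w = 2^-n], with w smaller than the distances from y to a and b. Its
    left end [l] is the largest multiple of w/8 strictly below y, so that y lies in ]l, l + w/8],
    inside the support ]l, l + w/4[. *)
Lemma bump a y b : a < y -> y < b -> exists f l r,
  [/\ dpl f, a < l, r < b, l < y < r & supported l r f /\ forall z, l < z < r -> z < f z].
Proof.
move=> ay yb; have e0 : 0 < Num.min (y - a) (b - y) by rewrite lt_min !subr_gt0 ay.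
have [n] := pow2_small e0; rewrite lt_min => /andP[na nb].
pose w : R := (2 ^+ n)^-1; have w0 : 0 < w by rewrite invr_gt0 pow2_gt0.
rewrite -/w in na nb.
pose k := Num.ceil (y / (w / 8)); pose l := (k - 1)%:~R * (w / 8).
have := ceil_itv (y / (w / 8)); rewrite -/k ltr_pdivlMr ?ler_pdivrMr; try lra.
rewrite -/l => /andP[ly yk].
have lE : k%:~R * (w / 8) = l + w / 8 by rewrite /l intrD; ring.
have dl : dyadic R l.
  apply: dyadicM; first exact: dyadicZ.
  apply: dyadicM; first exact: dyadicV2X.
  have -> : (8 : R)^-1 = (2 ^+ 3)^-1 by congr (_^-1); ring.
  exact: dyadicV2X.
pose A := aff w l.
have AE z : A z = w * z + l by rewrite affE.
have dA : dpl A by rewrite /A /w exprnN; apply: dpl_aff.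
have A0 : A 0 = l by rewrite AE mulr0 add0r.
have A1 : A (1 / 4) = l + w / 4 by rewrite AE; ring.
exists (c0 ^ A)%g, l, (l + w / 4); split.
- by apply: dplJ => //; have /thompsonFP[] := c0_F.
- by lra.
- by lra.
- by apply/andP; split; lra.
split; first by have := supportedJ (g := A) c0_supported; rewrite A0 A1.
move=> z; rewrite -A1 -A0 -(homeoVK A z); move: ((A^-1)%g z) => v; rewrite homeoJ !homeo_ltE.
exact: c0_gt.
Qed.

(** If no image of x reached y, the supremum [Y] of the images would be less than b, and a bump
    around [Y] would carry an image close enough to [Y] beyond it. *)
Lemma push a x y b : a < x -> y < b -> exists u l r,
  [/\ dpl u, a < l, r < b, supported l r u & y <= u x \/ b <= x].
Proof.
move=> ax yb; have [bx|xb] := leP b x.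
  exists 1%g, (a + 1), (b - 1); split; try lra; [exact: dpl1|exact: supported1].
pose S := [set z : R | exists u l r,
  [/\ dpl u, a < l, r < b, supported l r u & z = u x]].
have [[z [[u [l [r [du al rb su ->]]]] yz]]|hS] := pselect (exists z, S z /\ y <= z).
  by exists u, l, r; split=> //; left.
exfalso.
have Sx : S x by exists 1%g, x, x; split=> //; exact: dpl1.
have Sy z : S z -> z <= y.
  by move=> Sz; rewrite leNgt; apply/negP => yz; apply: hS; exists z; split=> //; exact: ltW.
have hs : has_sup S by split; [exists x|exists y => z; exact: Sy].
pose Y := sup S.
have xY : x <= Y by apply: ub_le_sup => //; case: hs.
have Yy : Y <= y by apply: ge_sup => //; exists x.
have [c [l [r [dc al rb lYr [sc cgt]]]]] := bump (lt_le_trans ax xY) (le_lt_trans Yy yb).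
have cY : 0 < Y - (c^-1)%g Y by rewrite subr_gt0 -(homeo_ltE c) homeoVK; exact: cgt.
have [z [u [l' [r' [du al' rb' su ->]]]]] := sup_adherent cY hs.
rewrite subKr => h; have {h} : Y < c (u x) by rewrite -(homeoVK c Y) homeo_ltE.
rewrite ltNge => /negP; apply; apply: ub_le_sup; first by case: hs.
exists (u * c)%g, (Num.min l l'), (Num.max r r'); split.
- exact: dplM.
- by rewrite lt_min al al'.
- by rewrite gt_max rb rb'.
- apply: supportedM.
    by apply: supportedS su _ _; [rewrite ge_min lexx orbT|rewrite le_max lexx orbT].
  by apply: supportedS sc _ _; [rewrite ge_min lexx|rewrite le_max lexx].
- by rewrite homeoM.
Qed.

(** One map pushes e beyond the middle m of ]p, q[, possibly sending e' far to the right; the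
    inverse of a second one, which fixes p and pushes m beyond the image of e', then brings that
    image back to at most m. *)
Lemma squeeze (e e' p q : R) : 0 < e -> e' < 1 -> 0 < p -> p < q -> q < 1 ->
  exists u, [/\ Fc R u, p < u e & u e' < q].
Proof.
move=> e0 e1 p0 pq q1; pose x := Num.min e (p / 2); pose m := (p + q) / 2.
have x0 : 0 < x by rewrite lt_min e0; lra.
have xe : x <= e by rewrite ge_min lexx.
have xp : x <= p / 2 by rewrite ge_min lexx orbT.
have m1 : m < 1 by rewrite /m; lra.
have pm : p < m by rewrite /m; lra.
have mq : m < q by rewrite /m; lra.
have [u [l [r [du l0 r1 su [mu|]]]]] := push x0 m1; last by lra.
have cu : Fc R u by exact: Fc_of su.
have ue1 : u e' < 1.
  have u1 : u 1 = 1 by apply: (Fc_sub01 cu); rewrite ltxx andbF.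
  by rewrite -[X in _ < X]u1 homeo_ltE.
have [v [l' [r' [dv l0' r1' sv [mv|]]]]] := push pm ue1; last by lra.
have cv : Fc R v by apply: Fc_of sv => //; lra.
exists (u * v^-1)%g; split.
- by apply: FcM => //; exact: FcV.
- rewrite homeoM -(homeo_ltE v) homeoVK sv; last by rewrite (ltNge l') ltW.
  by apply: (lt_le_trans pm); apply: (le_trans mu); rewrite homeo_leE.
- rewrite homeoM -(homeo_ltE v) homeoVK; apply: (le_lt_trans mv).
  by rewrite homeo_ltE.
Qed.

Lemma move_point a x b : a < x -> x < b -> exists f,
  [/\ dpl f, supported a b f & f x != x].
Proof.
move=> ax xb; have [f [l [r [df al rb lxr [sf fgt]]]]] := bump ax xb.
exists f; split=> //; first by apply: supportedS sf _ _; apply: ltW.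
by rewrite gt_eqF // fgt.
Qed.

End Pushing.

(** * Generation of F and perfectness of F' *)

Section Rotation.
Variable R : realType.
Implicit Types (x y z : R).

(** A standard generator of Thompson's group: the rotation of the binary tree ((a b) c) to (a (b
    c)), with slopes 2, 1 and 1/2 on the three leaves. *)
Definition rotation_fun x : R :=
  if x <= 0 then x else if x <= 1 / 4 then 2 * x else
  if x <= 1 / 2 then x + 1 / 4 else if x <= 1 then (x + 1) / 2 else x.

Definition rotation_inv x : R :=
  if x <= 0 then x else if x <= 1 / 2 then x / 2 else
  if x <= 3 / 4 then x - 1 / 4 else if x <= 1 then 2 * x - 1 else x.

Lemma rotation_homeo : is_homeo_pos rotation_fun.
Proof.
apply: (@is_homeo_posI _ _ rotation_inv).
- move=> x; rewrite /rotation_fun.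
  case: (leP x 0) => h0; first by rewrite /rotation_inv h0.
  case: (leP x (1 / 4)) => h1.
    rewrite /rotation_inv; case: (leP (2 * x) 0) => ?; first lra.
    by case: (leP (2 * x) (1 / 2)) => ?; lra.
  case: (leP x (1 / 2)) => h2.
    rewrite /rotation_inv; case: (leP (x + 1 / 4) 0) => ?; first lra.
    case: (leP (x + 1 / 4) (1 / 2)) => ?; first lra.
    by case: (leP (x + 1 / 4) (3 / 4)) => ?; lra.
  case: (leP x 1) => h3; rewrite /rotation_inv.
    case: (leP ((x + 1) / 2) 0) => ?; first lra.
    case: (leP ((x + 1) / 2) (1 / 2)) => ?; first lra.
    case: (leP ((x + 1) / 2) (3 / 4)) => ?; first lra.
    by case: (leP ((x + 1) / 2) 1) => ?; lra.
  case: (leP x 0) => ?; first lra.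
  case: (leP x (1 / 2)) => ?; first lra.
  case: (leP x (3 / 4)) => ?; first lra.
  by case: (leP x 1) => ?; lra.
- move=> x; rewrite /rotation_inv.
  case: (leP x 0) => h0; first by rewrite /rotation_fun h0.
  case: (leP x (1 / 2)) => h1.
    rewrite /rotation_fun; case: (leP (x / 2) 0) => ?; first lra.
    by case: (leP (x / 2) (1 / 4)) => ?; lra.
  case: (leP x (3 / 4)) => h2.
    rewrite /rotation_fun; case: (leP (x - 1 / 4) 0) => ?; first lra.
    case: (leP (x - 1 / 4) (1 / 4)) => ?; first lra.
    by case: (leP (x - 1 / 4) (1 / 2)) => ?; lra.
  case: (leP x 1) => h3; rewrite /rotation_fun.
    case: (leP (2 * x - 1) 0) => ?; first lra.
    case: (leP (2 * x - 1) (1 / 4)) => ?; first lra.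
    case: (leP (2 * x - 1) (1 / 2)) => ?; first lra.
    by case: (leP (2 * x - 1) 1) => ?; lra.
  case: (leP x 0) => ?; first lra.
  case: (leP x (1 / 4)) => ?; first lra.
  case: (leP x (1 / 2)) => ?; first lra.
  by case: (leP x 1) => ?; lra.
move=> x y xy; rewrite /rotation_fun; case: (leP x 0) => h0.
  case: (leP y 0) => h1; first lra.
  case: (leP y (1 / 4)) => h2; first lra.
  case: (leP y (1 / 2)) => h3; first lra.
  by case: (leP y 1) => h4; lra.
have /negbTE-> : ~~ (y <= 0) by rewrite -ltNge; lra.
case: (leP x (1 / 4)) => h1.
  case: (leP y (1 / 4)) => h2; first lra.
  case: (leP y (1 / 2)) => h3; first lra.
  by case: (leP y 1) => h4; lra.
have /negbTE-> : ~~ (y <= 1 / 4) by rewrite -ltNge; lra.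
case: (leP x (1 / 2)) => h2.
  case: (leP y (1 / 2)) => h3; first lra.
  by case: (leP y 1) => h4; lra.
have /negbTE-> : ~~ (y <= 1 / 2) by rewrite -ltNge; lra.
by case: (leP x 1) => h3; case: (leP y 1) => ?; lra.
Qed.

Definition rotation : homeo R := homeo_of rotation_fun.

Lemma rotationE x : rotation x = rotation_fun x.
Proof. by rewrite /rotation homeo_ofE //; exact: rotation_homeo. Qed.

Lemma rotation_le0 x : x <= 0 -> rotation x = x.
Proof. by move=> x0; rewrite rotationE /rotation_fun x0. Qed.

Lemma rotation_ge1 x : 1 <= x -> rotation x = x.
Proof.
move=> x1; rewrite rotationE /rotation_fun; case: (leP x 0) => ?; first lra.
case: (leP x (1 / 4)) => ?; first lra.
case: (leP x (1 / 2)) => ?; first lra.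
by case: (leP x 1) => ?; lra.
Qed.

Lemma rotation_in1 x : 0 <= x <= 1 / 4 -> rotation x = 2 * x.
Proof.
move=> /andP[? x1]; rewrite rotationE /rotation_fun; case: (leP x 0) => ?; first lra.
by rewrite x1.
Qed.

Lemma rotation_in2 x : 1 / 4 <= x <= 1 / 2 -> rotation x = x + 1 / 4.
Proof.
move=> /andP[? x1]; rewrite rotationE /rotation_fun; case: (leP x 0) => ?; first lra.
by case: (leP x (1 / 4)) => ?; [lra|rewrite x1].
Qed.

Lemma rotation_in3 x : 1 / 2 <= x <= 1 -> rotation x = (x + 1) / 2.
Proof.
move=> /andP[? x1]; rewrite rotationE /rotation_fun; case: (leP x 0) => ?; first lra.
case: (leP x (1 / 4)) => ?; first lra.
by case: (leP x (1 / 2)) => ?; [lra|rewrite x1].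
Qed.

Lemma rotation_supported : supported 0 1 rotation.
Proof.
by move=> x; rewrite negb_and -!leNgt => /orP[/rotation_le0|/rotation_ge1].
Qed.

Lemma rotation_dpl : dpl rotation.
Proof.
have d2 : dyadic R (1 / 2) by exists 1, 1%N; rewrite expr1.
have d4 : dyadic R (1 / 4) by exists 1, 2%N; rewrite -natrX.
exists [:: 0; 1 / 4; 1 / 2; 1].
  move=> b; rewrite !inE => /or4P[]/eqP-> //; [exact: dyadic0|exact: dyadic1].
move=> x y xy h.
have h0 : ~~ (x < 0 < y) by apply: h; rewrite !inE eqxx.
have h1 : ~~ (x < 1 / 4 < y) by apply: h; rewrite !inE eqxx ?orbT.
have h2 : ~~ (x < 1 / 2 < y) by apply: h; rewrite !inE eqxx ?orbT.
have h3 : ~~ (x < 1 < y) by apply: h; rewrite !inE eqxx ?orbT.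
have [y0|y0] := leP y 0.
  exists 0, 0; split; first exact: dyadic0.
  by move=> z /andP[_ zy]; rewrite rotation_le0 ?expr0z ?(le_trans zy) //; ring.
have {h0} x0 : 0 <= x by move: h0; rewrite y0 andbT -leNgt.
have [y1|y1] := leP y (1 / 4).
  exists 1, 0; split; first exact: dyadic0.
  move=> z /andP[xz zy]; rewrite rotation_in1.
    by rewrite expr1z addr0.
  by rewrite (le_trans x0) ?(le_trans zy).
have {h1} x1 : 1 / 4 <= x by move: h1; rewrite y1 andbT -leNgt.
have [y2|y2] := leP y (1 / 2).
  exists 0, (1 / 4); split => // z /andP[xz zy]; rewrite rotation_in2.
    by rewrite expr0z [1 * z]mul1r.
  by rewrite (le_trans x1) ?(le_trans zy).
have {h2} x2 : 1 / 2 <= x by move: h2; rewrite y2 andbT -leNgt.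
have [y3|y3] := leP y 1.
  exists (- 1), (1 / 2); split => // z /andP[xz zy]; rewrite rotation_in3 ?exprN1.
    by field.
  by rewrite (le_trans x2) ?(le_trans zy).
have {h3} x3 : 1 <= x by move: h3; rewrite y3 andbT -leNgt.
exists 0, 0; split; first exact: dyadic0.
by move=> z /andP[xz _]; rewrite rotation_ge1 ?expr0z ?(le_trans x3) //; ring.
Qed.

End Rotation.
Arguments rotation R : clear implicits.

(** * Binary trees as dyadic subdivisions, and generation of F by rotations *)

Inductive tree := Leaf | Node of tree & tree.

Fixpoint leaves (t : tree) : seq (seq bool) :=
  if t is Node l r then map (cons false) (leaves l) ++ map (cons true) (leaves r)
  else [:: [::]].

(** The normal form to which rotations bring every tree with n + 1 leaves. *)
Fixpoint comb (n : nat) : tree := if n is n'.+1 then Node Leaf (comb n') else Leaf.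

Lemma leaves_gt0 t : (0 < size (leaves t))%N.
Proof. by elim: t => //= l IH r _; rewrite size_cat !size_map ltn_addr. Qed.

Section Trees.
Variable R : realType.
Implicit Types (x y z a c : R) (b : bool) (f g h u : homeo R) (w : seq bool) (s : seq (seq bool)).

Definition half_aff (b : bool) : homeo R := aff (2 ^ (-1 : int)) (if b then 1 / 2 else 0).

Lemma half_affE b x : half_aff b x = x / 2 + (if b then 1 / 2 else 0).
Proof. by rewrite affE ?pow2z_gt0 // exprN1; ring. Qed.

(* Standard dyadic intervals are addressed by vertices of the binary tree. *)
Fixpoint addr w : homeo R := if w is b :: w' then (addr w' * half_aff b)%g else 1%g.

Lemma addr_cons b w x : addr (b :: w) x = half_aff b (addr w x). Proof. by []. Qed.

Lemma addr01 w x : 0 <= x <= 1 -> 0 <= addr w x <= 1.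
Proof.
move=> x01; elim: w => [//|b w /andP[IH0 IH1]]; rewrite addr_cons half_affE.
by case: b; apply/andP; split; lra.
Qed.

Lemma addr_ge0 w : 0 <= addr w 0.
Proof. by have := @addr01 w 0; rewrite lexx ler01 => /(_ isT)/andP[]. Qed.

Lemma addr_le1 w : addr w 1 <= 1.
Proof. by have := @addr01 w 1; rewrite lexx ler01 => /(_ isT)/andP[]. Qed.

Lemma addr_lt w : addr w 0 < addr w 1. Proof. by rewrite homeo_ltE. Qed.

Lemma addr_pair w : exists2 I : nat * nat, (I.1 < 2 ^ I.2)%N &
  forall x, addr w x = (I.1%:R + x) / 2 ^+ I.2.
Proof.
elim: w => [|b w [[p n] /= pn IH]]; first by exists (0, 0)%N => //= x; rewrite add0r divr1.
have := pow2_gt0 R n => h0.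
exists (p + b * 2 ^ n, n.+1)%N => [|x] /=; first by rewrite expnS; case: b; lia.
rewrite half_affE IH exprS natrD natrM natrX.
by case: b; rewrite ?mul0r ?mul1r; field; rewrite gt_eqF.
Qed.

Lemma pair_addr p n : (p < 2 ^ n)%N -> exists w, forall x, addr w x = (p%:R + x) / 2 ^+ n.
Proof.
elim: n p => [|n IH] p; first by rewrite expn0 ltnS leqn0 => /eqP->; exists [::] => x /=; rewrite add0r divr1.
have := pow2_gt0 R n => h0 pn; have [pn'|np] := ltnP p (2 ^ n).
  have [w wE] := IH p pn'; exists (false :: w) => x; rewrite addr_cons half_affE wE exprS.
  by field; rewrite gt_eqF.
have [|w wE] := IH (p - 2 ^ n)%N; first by move: pn; rewrite expnS; lia.
exists (true :: w) => x; rewrite addr_cons half_affE wE exprS natrB // natrX.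
by field; rewrite gt_eqF.
Qed.

(** When s and s' list the leaves of two trees, this is a tree pair diagram of f. *)
Fixpoint maps f s s' : Prop := match s, s' with
  | w :: t, w' :: t' => (forall x, 0 <= x <= 1 -> f (addr w x) = addr w' x) /\ maps f t t'
  | [::], [::] => True
  | _, _ => False
  end.

Lemma maps_size f s s' : maps f s s' -> size s = size s'.
Proof. by elim: s s' => [|w s IH] [|w' s'] //= [_ /IH->]. Qed.

Lemma maps_cat f s1 s1' s2 s2' : maps f s1 s1' -> maps f s2 s2' ->
  maps f (s1 ++ s2) (s1' ++ s2').
Proof. by elim: s1 s1' => [|w s IH] [|w' s'] // [h hs] ?; split=> //; exact: IH. Qed.

Lemma mapsM f g s s' s'' : maps f s s' -> maps g s' s'' -> maps (f * g)%g s s''.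
Proof.
elim: s s' s'' => [|w s IH] [|w' s'] [|w'' s''] // [h hs] [h' hs']; split; last exact: IH hs hs'.
by move=> x x01; rewrite ?homeoM h ?h'.
Qed.

Lemma mapsV f s s' : maps f s s' -> maps (f^-1)%g s' s.
Proof.
elim: s s' => [|w s IH] [|w' s'] // [h hs]; split; last exact: IH.
by move=> x x01; rewrite -h // homeoK.
Qed.

Lemma maps1 s : maps 1%g s s. Proof. by elim: s. Qed.

Lemma maps_half f b s s' : maps f s s' ->
  maps (f ^ half_aff b)%g (map (cons b) s) (map (cons b) s').
Proof.
elim: s s' => [|w s IH] [|w' s'] // [h hs]; split; last exact: IH.
by move=> x x01; rewrite !addr_cons homeoJ h.
Qed.

Lemma maps_fix f b s : supported 0 1 f ->
  maps (f ^ half_aff (~~ b))%g (map (cons b) s) (map (cons b) s).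
Proof.
move=> sf; elim: s => // w s IH; split=> // x x01.
apply: (supportedJ (g := half_aff (~~ b)) sf).
have := addr01 w x01; rewrite addr_cons !half_affE.
by case: b {IH} => /= /andP[? ?]; apply/negP => /andP[]; lra.
Qed.

Lemma maps_left f t t' r : supported 0 1 f -> maps f (leaves t) (leaves t') ->
  maps (f ^ half_aff false)%g (leaves (Node t r)) (leaves (Node t' r)).
Proof. by move=> sf ft; apply: maps_cat; [exact: maps_half|exact: (@maps_fix f true)]. Qed.

Lemma maps_right f t t' l : supported 0 1 f -> maps f (leaves t) (leaves t') ->
  maps (f ^ half_aff true)%g (leaves (Node l t)) (leaves (Node l t')).
Proof. by move=> sf ft; apply: maps_cat; [exact: (@maps_fix f false)|exact: maps_half]. Qed.

Lemma maps_rotation (a b r : tree) : maps (rotation R) (leaves (Node (Node a b) r)) (leaves (Node a (Node b r))).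
Proof.
rewrite /= !map_cat -!map_comp -catA; do ?apply: maps_cat.
- elim: (leaves a) => // w s IH; split=> // x x01.
  have /andP[? ?] := addr01 w x01; rewrite /= !half_affE rotation_in1; first lra.
  by apply/andP; split; lra.
- elim: (leaves b) => // w s IH; split=> // x x01.
  have /andP[? ?] := addr01 w x01; rewrite /= !half_affE rotation_in2; first lra.
  by apply/andP; split; lra.
- elim: (leaves r) => // w s IH; split=> // x x01.
  have /andP[? ?] := addr01 w x01; rewrite /= !half_affE rotation_in3; first lra.
  by apply/andP; split; lra.
Qed.

Fixpoint chain a s c : Prop :=
  if s is w :: t then addr w 0 = a /\ chain (addr w 1) t c else a = c.

Lemma chain_le a s c : chain a s c -> a <= c.
Proof.
elim: s a => [a -> //|w s IH a /= [<- /IH]]; apply: le_trans.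
by rewrite ltW // addr_lt.
Qed.

Lemma chain_cat a s c s' d : chain a s c -> chain c s' d -> chain a (s ++ s') d.
Proof. by elim: s a => [a -> //|w s IH a /= [<- h] h']; split=> //; exact: IH. Qed.

Lemma chain_half b s x y : chain x s y -> chain (half_aff b x) (map (cons b) s) (half_aff b y).
Proof. by elim: s x => [x -> //|w s IH x /= [<- h]]; split=> //; exact: IH. Qed.

Lemma chain_leaves t : chain 0 (leaves t) 1.
Proof.
elim: t => [//|l IHl r IHr] /=; apply: (@chain_cat _ _ (1 / 2)).
  have := chain_half false IHl; rewrite !half_affE; congr chain; lra.
by have := chain_half true IHr; rewrite !half_affE; congr chain; lra.
Qed.

Lemma maps_agree f g s s' a c : chain a s c -> maps f s s' -> maps g s s' ->
  forall x, a <= x <= c -> x < c -> f x = g x.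
Proof.
elim: s s' a => [|w s IH] [|w' s'] a //=.
  by move=> -> _ _ x /andP[? ?] ?; lra.
move=> [wa hs] [hf fs] [hg gs] x /andP[ax xb] xb'.
have [xw|wx] := leP x (addr w 1); last by apply: (IH s' (addr w 1)) => //; rewrite ltW.
rewrite -(homeoVK (addr w) x) hf ?hg //.
  by rewrite -(homeo_leE (addr w) 0) -(homeo_leE (addr w) _ 1) homeoVK xw wa ax.
by rewrite -(homeo_leE (addr w) 0) -(homeo_leE (addr w) _ 1) homeoVK xw wa ax.
Qed.

Lemma maps_eq f g s s' : supported 0 1 f -> supported 0 1 g -> chain 0 s 1 ->
  maps f s s' -> maps g s s' -> f = g.
Proof.
move=> sf sg hs hf hg; apply: homeo_ext => x.
have [x01|x01] := boolP (0 < x < 1); last by rewrite sf ?sg.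
by case/andP: x01 => x0 x1; apply: (maps_agree hs hf hg) => //; rewrite !ltW.
Qed.

(** The two sides are the two paths, of two and of three rotations, from the left comb to the right
    comb with four leaves; a tree pair diagram determines the map. *)
Lemma pentagon : ((rotation R) * (rotation R) = (rotation R) ^ half_aff false * ((rotation R) * (rotation R) ^ half_aff true))%g.
Proof.
have sh b : supported 0 1 ((rotation R) ^ half_aff b)%g.
  by apply: supportedS (supportedJ (g := half_aff b) (@rotation_supported R)) _ _; rewrite half_affE; case: b; lra.
apply: (@maps_eq _ _ (leaves (Node (Node (Node Leaf Leaf) Leaf) Leaf))
  (leaves (Node Leaf (Node Leaf (Node Leaf Leaf))))).
- by apply: supportedM; exact: rotation_supported.
- by apply: supportedM; [exact: sh|apply: supportedM; [exact: rotation_supported|exact: sh]].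
- exact: chain_leaves.
- exact: mapsM (maps_rotation _ _ _) (maps_rotation _ _ _).
apply: mapsM; first exact: maps_left (@rotation_supported R) (maps_rotation _ _ _).
by apply: mapsM (maps_rotation _ _ _) _; exact: maps_right (@rotation_supported R) (maps_rotation _ _ _).
Qed.

Definition rots : set (homeo R) := gen (range (fun w => ((rotation R) ^ addr w)%g)).

Lemma rots_half b f : rots f -> rots (f ^ half_aff b)%g.
Proof.
move=> hf; suff : rots `<=` [set f | rots (f ^ half_aff b)%g] by apply.
apply: gen_sub.
  apply/subgroupP; split=> [|u v|u] /=; rewrite ?conj1g ?conjMg ?conjVg.
  - exact: gen1.
  - exact: genM.
  - exact: genV.
by move=> _ [w _ <-]; apply: sub_gen; exists (b :: w) => //=; rewrite conjgM.
Qed.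

Lemma rots_supported f : rots f -> supported 0 1 f.
Proof.
move=> hf; suff : rots `<=` [set f | supported 0 1 f] by apply.
apply: gen_sub; first by apply/subgroupP; split; [exact: supported1|exact: supportedM|exact: supportedV].
move=> _ [w _ <-] /=; apply: supportedS (supportedJ (g := addr w) (@rotation_supported R)) _ _.
  exact: addr_ge0.
exact: addr_le1.
Qed.

(** If the left subtree is a leaf, the right subtree is treated by induction; otherwise a rotation
    at the root replaces the left subtree by its own left subtree. *)
Lemma rots_comb n t : size (leaves t) = n.+1 ->
  exists2 f, rots f & maps f (leaves t) (leaves (comb n)).
Proof.
elim/ltn_ind: n t => n IHn [|l r].
  by case: n IHn => // _ _; exists 1%g; [exact: gen1|exact: maps1].
elim: l r => [|a IHa b _] r.
  rewrite /= size_map => -[]; case: n IHn => [|n] IHn rn.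
    by have := leaves_gt0 r; rewrite rn.
  have [f hf fm] := IHn n (ltnSn n) r rn; exists (f ^ half_aff true)%g; first exact: rots_half.
  exact: (maps_right Leaf (rots_supported hf) fm).
move=> hn; have [|f hf fm] := IHa (Node b r).
  by rewrite -hn /= !map_cat !size_cat !size_map; lia.
exists ((rotation R) * f)%g; last exact: mapsM (maps_rotation _ _ _) fm.
by apply: genM => //; apply: sub_gen; exists [::] => //=; rewrite conjg1.
Qed.

Lemma chain_upper a s : chain a s 1 -> 1 / 2 <= a -> all (fun w => w != [::]) s ->
  exists2 s', s = map (cons true) s' & chain (2 * a - 1) s' 1.
Proof.
elim: s a => [|w s IH] a /=; first by move=> -> _ _; exists [::] => //=; lra.
case: w => [//|b w] [wa hs] a2 /= hall.
have h1 : a <= addr (b :: w) 1 by rewrite -wa ltW // addr_lt.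
have [s' -> hs'] := IH _ hs (le_trans a2 h1) hall.
have w0 := addr_ge0 w.
have w1 := addr_le1 w.
have w01 := addr_lt w; rewrite ?addr_cons ?homeoM !half_affE in wa hs'.
case: b wa hs' {hs h1} => [wa hs'|wa _]; last lra.
exists (w :: s') => //=; split; first lra.
by move: hs'; congr chain; lra.
Qed.

(** No standard dyadic interval other than [0, 1] has 1/2 in its interior, so a tiling that avoids
    the root address splits at 1/2. *)
Lemma chain_split a s : chain a s 1 -> a <= 1 / 2 -> all (fun w => w != [::]) s ->
  exists s0 s1, [/\ s = map (cons false) s0 ++ map (cons true) s1,
    chain (2 * a) s0 1 & chain 0 s1 1].
Proof.
elim: s a => [|w s IH] a /=; first by move=> ->; lra.
case: w => [//|b w] [wa hs] a2 /= hall.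
have w0 := addr_ge0 w.
have w1 := addr_le1 w.
have w01 := addr_lt w; rewrite ?addr_cons ?homeoM !half_affE in wa.
case: b wa hs => [wa hs|wa hs].
  have a12 : a = 1 / 2 by lra.
  have [||s1 sE hs1] := @chain_upper a (([:: true & w]) :: s) _ _ hall; last 1 first.
  - exists [::], s1; split=> //=; first by rewrite a12; lra.
    by move: hs1; rewrite a12; congr chain; lra.
  - by split=> //=; rewrite ?homeoM !half_affE.
  - by rewrite a12.
have [|s0 [s1 [-> hs0 hs1]]] := IH _ hs _ hall.
  by rewrite ?homeoM half_affE; lra.
exists (w :: s0), s1; split=> //=; split; first lra.
by move: hs0; rewrite ?homeoM half_affE; congr chain; lra.
Qed.

Lemma chain_tree s : chain 0 s 1 -> exists t, s = leaves t.
Proof.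
have [n] := ubnP (size s); elim: n s => // n IH [|w s] /=; first by move=> _; lra.
rewrite ltnS => sn [w0 hs]; case: w w0 hs => [|b w] w0 hs.
  exists Leaf; case: s hs {sn} => //= w' s [w'0 /chain_le].
  by have := addr_lt w'; rewrite w'0 => h1 h2; exfalso; lra.
have hall : all (fun w => w != [::]) (([:: b & w]) :: s).
  have {w0} : 0 < addr (b :: w) 1 by rewrite -w0 addr_lt.
  move: (addr _ 1) hs => a /=; elim: s {sn} a => //= w' s IHs a [<- hs] a0.
  have {IHs} -> : all (fun w => w != [::]) s.
    by apply: IHs hs _; apply: lt_trans a0 (addr_lt _).
  by rewrite andbT; apply/eqP => w'E; move: a0; rewrite w'E /= ltxx.
have [||s0 [s1 [sE hs0 hs1]]] := @chain_split 0 (([:: b & w]) :: s) _ _ hall; first by [].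
  by lra.
rewrite mulr0 in hs0.
have sz : (size s).+1 = (size s0 + size s1)%N.
  by have := congr1 size sE; rewrite /= size_cat !size_map.
have s0_gt0 : (0 < size s0)%N by case: s0 hs0 {sE sz} => //=; lra.
have s1_gt0 : (0 < size s1)%N by case: s1 hs1 {sE sz} => //=; lra.
have [|t0 t0E] := IH s0 _ hs0; first by lia.
have [|t1 t1E] := IH s1 _ hs1; first by lia.
by exists (Node t0 t1); rewrite sE t0E t1E.
Qed.

(** A cell of level N on which f has slope 2^k is mapped to an interval of length 2^-n with
    [n = N - k]; the image is standard once the constant term is a multiple of 2^-n. If [B] bounds
    the exponents k and those of the denominators of the constant terms, level N0 + 2B suffices,
    since then n is at least N0 + B. *)
Lemma thompson_cells f : thompsonF R f -> exists N, forall p, (p < 2 ^ N)%N ->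
  exists w, forall x, 0 <= x <= 1 -> f ((p%:R + x) / 2 ^+ N) = addr w x.
Proof.
move=> Ff; have [N0 hN0] := thompson_grid Ff; have {hN0} cell := hN0 _ (leqnn N0).
have /thompsonFP[_ sf] := Ff.
have [B hB] : exists B : nat, forall p, (p < 2 ^ N0)%N -> exists (k : int) c,
    [/\ k <= B, forall b : nat, (B <= b)%N -> exists m : int, c = m%:~R / 2 ^+ b &
      forall z, p%:R / 2 ^+ N0 <= z <= p.+1%:R / 2 ^+ N0 -> f z = 2 ^ k * z + c].
  elim: (2 ^ N0)%N cell => [|n IH] cell; first by exists 0%N.
  have [p pn|B hB] := IH; first by apply: cell; exact: ltnW.
  have [k [c [dc e]]] := cell n (ltnSn n).
  have [|M hM] := @dyadic_common R [:: c]; first by move=> b; rewrite inE => /eqP->.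
  exists (maxn B (maxn M `|k|)) => p; rewrite ltnS leq_eqVlt => /predU1P[->|/hB].
    exists k, c; split=> //; first by lia.
    by move=> b hb; have [||m mE] := hM b _ c; [lia|rewrite inE|exists m].
  move=> [k' [c' [kB cB e']]]; exists k', c'; split=> //; first by lia.
  by move=> b hb; apply: cB; lia.
pose N := (N0 + B + B)%N; exists N => p pN.
have NE : (N0 + (B + B))%N = N by rewrite /N addnA.
have q0 : (0 < 2 ^ (B + B))%N by rewrite expn_gt0.
pose p0 := (p %/ 2 ^ (B + B))%N.
have [|k [c [kB cB e]]] := hB p0; first by rewrite ltn_divLR // -expnD NE.
have [n nE] : exists n : nat, (n : int) = N%:Z - k by exists `|N%:Z - k|%N; lia.
have [|m cE] := cB n; first by lia.
have fE x : 0 <= x <= 1 -> f ((p%:R + x) / 2 ^+ N) = ((p%:Z + m)%:~R + x) / 2 ^+ n.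
  move=> x01; rewrite e; last first.
    have := leq_divM p (2 ^ (B + B)); have := ltn_ceil p q0; rewrite -/p0 => pu pl.
    have NE' : (2 ^+ N : R) = 2 ^+ N0 * (2 ^ (B + B))%:R by rewrite natrX -exprD NE.
    have g0 := pow2_gt0 R N0.
    have D0 : 0 < (2 ^ (B + B))%:R :> R by rewrite ltr0n.
    rewrite ler_pdivrMr // ler_pdivlMr // NE'.
    have -> : (p%:R + x) / (2 ^+ N0 * (2 ^ (B + B))%:R) * 2 ^+ N0 = (p%:R + x) / (2 ^ (B + B))%:R.
      by rewrite invfM mulrA mulrAC divfK // gt_eqF.
    rewrite ler_pdivlMr // ler_pdivrMr // -!natrM.
    have {pl} : (p0 * 2 ^ (B + B))%:R <= p%:R :> R by rewrite ler_nat.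
    have {pu} : p%:R + 1 <= (p0.+1 * 2 ^ (B + B))%:R :> R by rewrite natr1 ler_nat.
    by move: (_ * _)%:R (_ * _)%:R => u v ? ?; case/andP: x01 => ? ?; apply/andP; split; lra.
  have -> : (2 : R) ^ k = 2 ^+ N / 2 ^+ n.
    have -> : k = N%:Z - n%:Z by lia.
    by rewrite expfzDr ?pnatr_eq0 // -exprnN.
  rewrite cE intrD; have := pow2_gt0 R N; have := pow2_gt0 R n => ? ?.
  by field; rewrite !gt_eqF.
have fin x : 0 <= x <= 1 -> 0 <= f ((p%:R + x) / 2 ^+ N) <= 1.
  move=> x01; apply: supported_in => //; have g0 := pow2_gt0 R N.
  have : p.+1%:R <= 2 ^+ N :> R by rewrite -natrX ler_nat.
  rewrite -natr1 ler_pdivlMr // mul0r ler_pdivrMr // mul1r.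
  by have := ler0n R p; case/andP: x01 => *; apply/andP; split; lra.
have := fin 0; rewrite fE ?lexx ler01 // addr0 => /(_ isT)/andP[f0 _].
have := fin 1; rewrite fE ?lexx ler01 // => /(_ isT)/andP[_ f1].
have g0 := pow2_gt0 R n.
have [q qE] : exists q : nat, p%:Z + m = q.
  have : 0 <= p%:Z + m by rewrite -(ler_int R); move: f0; rewrite ler_pdivlMr // mul0r.
  by case: (p%:Z + m) => // q _; exists q.
have [|w wE] := @pair_addr q n.
  by move: f1; rewrite ler_pdivrMr // mul1r qE -natrX natr1 ler_nat.
by exists w => x x01; rewrite fE // wE qE.
Qed.

(** The source and the target subdivision of f are trees with equally many leaves; products of
    rotations carry both to the same comb. *)
Lemma thompson_rots f : thompsonF R f -> rots f.
Proof.
move=> Ff; have /thompsonFP[_ sf] := Ff.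
have [N hN] := thompson_cells Ff; have g0 := pow2_gt0 R N.
have [s [s' [fs hs hs']]] : exists s s',
    [/\ maps f s s', chain 0 s 1 & chain 0 s' 1].
  (* The two tilings are built from the right end; [d] counts the cells already listed. *)
  have : forall d, (d <= 2 ^ N)%N -> exists s s', [/\ maps f s s',
      chain ((2 ^ N - d)%:R / 2 ^+ N) s 1 & chain (f ((2 ^ N - d)%:R / 2 ^+ N)) s' 1].
    elim=> [|d IH] dN.
      exists [::], [::]; rewrite subn0 natrX divff ?gt_eqF //; split=> //=.
      by apply: sf; rewrite ltxx andbF.
    have [s [s' [fs hs hs']]] := IH (ltnW dN); pose p := (2 ^ N - d.+1)%N.
    have pN : (p < 2 ^ N)%N by rewrite /p; lia.
    have pS : (2 ^ N - d)%N = p.+1 by rewrite /p; lia.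
    have [w wE] := pair_addr pN; have [w' w'E] := hN p pN.
    have fw x : 0 <= x <= 1 -> f (addr w x) = addr w' x by move=> x01; rewrite wE w'E.
    exists (w :: s), (w' :: s'); rewrite -/p; split=> //=.
      by rewrite !wE addr0 natr1 -pS.
    by rewrite -!fw ?lexx ?ler01 // !wE addr0 natr1 -pS.
  move=> /(_ _ (leqnn _)); rewrite subnn mul0r sf ?ltxx //.
have [t tE] := chain_tree hs; have [t' t'E] := chain_tree hs'.
have [n sn] : exists n, size (leaves t) = n.+1.
  by have := leaves_gt0 t; case: size => // n _; exists n.
have [g gr gm] := rots_comb sn.
have [|g' gr' gm'] := @rots_comb n t'; first by rewrite -sn -tE -t'E (maps_size fs).
have hr : rots (g * g'^-1)%g by apply: genM => //; exact: genV.
suff -> : f = (g * g'^-1)%g by [].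
apply: (maps_eq sf (rots_supported hr) hs fs); rewrite tE t'E.
by apply: mapsM gm _; exact: mapsV.
Qed.

End Trees.

Lemma pentagon_commutator (G : groupType) (r d0 d1 : G) :
  (r * r = (r * d0) * (r * (r * d1)))%g -> (r = (d0^-1) ^ r * d1^-1)%g.
Proof.
move=> E; have {}E : (r = d0 * (r * (r * d1)))%g by apply: (mulgI r); rewrite {1}E !mulgA.
apply: (mulIg d1); rewrite mulgVK conjgE; apply: (mulgI r); rewrite mulVKg.
by apply: (mulgI d0); rewrite -E mulVKg.
Qed.

Section Perfect.
Variable R : realType.
Implicit Types (x y z a b : R) (f g u : homeo R) (I J : nat * nat).
Variable c0 : homeo R.
Hypothesis c0_F : thompsonF R c0.
Hypothesis c0_supp : supp c0 = `]0, 1 / 4[%classic.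
Hypothesis c0_gt : forall x : R, 0 < x < 1 / 4 -> x < c0 x.
Variable fI : nat * nat -> nat * nat -> homeo R.
Hypothesis fI_transfer : is_transfer fI.

Lemma sd_aff_half I (b : bool) :
  sd_aff R (I.1.*2 + b, I.2.+1)%N = (half_aff R b * sd_aff R I)%g.
Proof.
apply: homeo_ext => x; rewrite homeoM !sd_affE half_affE /= exprS natrD -muln2 natrM.
by have := pow2_gt0 R I.2 => ?; case: b => /=; field; rewrite gt_eqF.
Qed.

Lemma inner_half I (b : bool) : inner R I -> inner R (I.1.*2 + b, I.2.+1)%N.
Proof. by move=> /innerP[i0 i1]; apply/innerP => /=; rewrite expnS; case: b; lia. Qed.

(* Modulo the derived subgroup all copies of the rotation agree, so the pentagon
   relation reads 2 r = 3 r. *)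
Lemma rotation_derived I : inner R I -> derived (Fc R) (rotation R ^ sd_aff R I)%g.
Proof.
move=> iI; set D := derived (Fc R); set r := (rotation R ^ sd_aff R I)%g.
have gF := @Fc_subgroup R.
have Fr : Fc R r by apply: copy_Fc => //; [exact: rotation_dpl|exact: rotation_supported].
have rb (b : bool) : exists2 d, D d & ((rotation R ^ half_aff R b) ^ sd_aff R I = r * d)%g.
  exists [~ r, fI I (I.1.*2 + b, I.2.+1)%N]%g.
    apply: sub_gen; exists r => //; exists (fI I (I.1.*2 + b, I.2.+1)%N) => //.
    by apply: fI_Fc => //; exact: inner_half.
  rewrite -conjgM -sd_aff_half commgEl mulVKg /r conj_fI //; first exact: inner_half.
  exact: rotation_supported.
have [d0 D0 e0] := rb false; have [d1 D1 e1] := rb true.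
have : ((rotation R * rotation R) ^ sd_aff R I = (rotation R ^ half_aff R false *
  (rotation R * rotation R ^ half_aff R true)) ^ sd_aff R I)%g by rewrite pentagon.
rewrite (conjMg _ (rotation R)) (conjMg (rotation R ^ half_aff R false)%g) (conjMg (rotation R)) e0 e1 -/r => E.
rewrite (pentagon_commutator E).
by apply: genM; [apply: derivedJ => //; exact: genV|exact: genV].
Qed.

(** Conjugation in [Fc] brings the support into [K], the interval [1/4, 1/2], where f becomes the
    copy of an element of F. That element is a product of rotations in standard intervals, and the
    copies of these intervals in [K] are all inner. *)
Lemma Fc_perfect : Fc R `<=` derived (Fc R).
Proof.
move=> f Ff; have [a [b [a0 ab b1 sf]]] := Fc_supp Ff.
have gF := @Fc_subgroup R.
pose K := (1, 2)%N.
have [|||u [Fu ua ub]] := @squeeze R c0 c0_F c0_supp c0_gt a b (1 / 4) (1 / 2) a0 b1; try lra.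
pose s := ((f ^ u) ^ (sd_aff R K)^-1)%g.
have K0 : sd_aff R K 0 = 1 / 4 by rewrite sd_affE /= -natrX addr0.
have K1 : sd_aff R K 1 = 1 / 2 by rewrite sd_affE /= -natrX; lra.
have dK := sd_aff_dpl R K.
have Fs : thompsonF R s.
  apply/thompsonFP; split.
    apply: dplJ; last exact: dplV.
    by apply: dplJ; exact: Fc_dpl.
  rewrite -(homeoK (sd_aff R K) 0) -(homeoK (sd_aff R K) 1) K0 K1; apply: supportedJ.
  by apply: supportedS (supportedJ (g := u) sf) _ _; exact: ltW.
suff Ds : derived (Fc R) (s ^ sd_aff R K)%g.
  have -> : f = ((s ^ sd_aff R K) ^ u^-1)%g by rewrite /s conjgKV conjgK.
  by apply: derivedJ => //; exact: FcV.
have : @rots R `<=` [set s | derived (Fc R) (s ^ sd_aff R K)%g].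
  apply: gen_sub.
    apply/subgroupP; split=> [|x y|x] /=; rewrite ?conj1g ?conjMg ?conjVg.
    - exact: gen1.
    - exact: genM.
    - exact: genV.
  move=> _ [w _ <-] /=; rewrite -conjgM; have [[q n] /= qn wE] := addr_pair R w.
  have -> : (addr R w * sd_aff R K = sd_aff R (2 ^ n + q, n.+2)%N)%g.
    apply: homeo_ext => x; rewrite homeoM !sd_affE wE /= !exprS expr0 natrD natrX.
    by have := pow2_gt0 R n => ?; field; rewrite gt_eqF.
  by apply: rotation_derived; apply/innerP => /=; rewrite !expnS; lia.
by apply; exact: thompson_rots.
Qed.

End Perfect.

(** * The elements nu_1, nu_2 and nu_3 *)

Section Nu.
Variable R : realType.
Implicit Types (x y z a b t : R) (f g u : homeo R) (I J : nat * nat).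
Variable c0 : homeo R.
Hypothesis c0_F : thompsonF R c0.
Hypothesis c0_supp : supp c0 = `]0, 1 / 4[%classic.
Hypothesis c0_gt : forall x : R, 0 < x < 1 / 4 -> x < c0 x.
Hypothesis c0_double : forall t : R, 0 < t < 1 / 16 -> c0 t = 2 * t.
Variables (nu2 nu3 : homeo R).
Hypothesis nu23_gen : gen [set nu2; nu3] = F_on `[1 / 16, 15 / 16]%classic.

Let c0s : supported 0 (1 / 4) c0 := c0_supported c0_supp.

Lemma flip_c0s : supported (3 / 4) 1 (flip c0).
Proof.
by have := supported_flip c0s; rewrite subr0 (_ : 1 - 1 / 4 = 3 / 4) //; lra.
Qed.

Lemma flip_nu1 : flip (nu1 c0) = nu1 c0.
Proof.
have s4 : supported (1 / 4) 1 (flip c0) by apply: supportedS flip_c0s _ _; lra.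
by rewrite /nu1 flipM flipK (supported_comm c0s s4).
Qed.

Lemma nu1_F : thompsonF R (nu1 c0).
Proof.
have /thompsonFP[dc sc] := c0_F; apply/thompsonFP; split.
  by apply: dplM => //; exact: dpl_flip.
by apply: supportedM => //; apply: supportedS flip_c0s _ _; lra.
Qed.

Lemma nu1_sub01 : supported 0 1 (nu1 c0).
Proof. by have /thompsonFP[] := nu1_F. Qed.

Lemma nu1_left t : t <= 1 / 2 -> nu1 c0 t = c0 t.
Proof.
move=> t2; rewrite /nu1 homeoM flip_c0s //; apply/negP => /andP[].
have [t4|t4] := boolP (0 < t < 1 / 4); last by rewrite c0s //; lra.
by have := t4; rewrite -(supported_itv _ c0s) => /andP[_]; lra.
Qed.

Lemma nu1_right t : t <= 1 / 2 -> nu1 c0 (1 - t) = 1 - c0 t.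
Proof. by move=> t2; rewrite -nu1_left // -{1}flip_nu1 flipE subKr. Qed.

(** Below 1/16 each step doubles, and an orbit that has reached 1/16 never falls below it again. *)
Lemma nu1_expand n z : 0 < z -> Num.min (2 ^+ n * z) (1 / 16) <= (nu1 c0 ^+ n)%g z.
Proof.
move=> z0; elim: n => [|n IH]; first by rewrite expg0 expr0 mul1r ge_min lexx.
rewrite expgSr homeoM; set y := homeo_fun (nu1 c0 ^+ n)%g z in IH *.
have y0 : 0 < y by apply: lt_le_trans IH; rewrite lt_min mulr_gt0 ?pow2_gt0 //=; lra.
have [y16|y16] := ltP y (1 / 16).
  have -> : nu1 c0 y = 2 * y by rewrite nu1_left ?c0_double ?y0 //; lra.
  have : 2 ^+ n * z <= y by move: IH; rewrite ge_min => /orP[//|]; lra.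
  by rewrite ge_min exprS => ?; apply/orP; left; lra.
rewrite ge_min; apply/orP; right; have [y4|y4] := leP (1 / 4) y.
  have n4 : nu1 c0 (1 / 4) = 1 / 4 by rewrite nu1_left ?c0s ?ltxx ?andbF //; lra.
  apply: (@le_trans _ _ (1 / 4)); first lra.
  by rewrite -[X in X <= _]n4 homeo_leE.
apply: (le_trans y16); rewrite nu1_left; last lra.
by apply/ltW/c0_gt; rewrite y0.
Qed.

(** A power of nu_1 expands the support of f into [1/16, 15/16], where nu_2 and nu_3 generate. As
    nu_1 is invariant under reflection, the same power works at both ends. *)
Lemma Fc_gen_nu : Fc R `<=` gen [set nu1 c0; nu2; nu3].
Proof.
move=> f Ff; have [a [b [a0 ab b1 sf]]] := Fc_supp Ff.
have m0 : 0 < Num.min a (1 - b) by rewrite lt_min a0 subr_gt0.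
have [n hn] : exists n, 1 / 16 <= 2 ^+ n * Num.min a (1 - b).
  have [n hn] := pow2_small m0; exists n.
  have := pow2_gt0 R n => h0; move: hn; rewrite -[X in X < _]mul1r ltr_pdivrMr // mulrC.
  by lra.
set v := (nu1 c0 ^+ n)%g.
have Fv : thompsonF R v := subgroupX n (@thompsonF_subgroup R) nu1_F.
have vflip z : v (1 - z) = 1 - v z.
  have vE : v = flip v.
    rewrite /v; elim: n {hn v Fv} => [|n IH]; first by rewrite expg0 flip1.
    by rewrite expgS flipM -IH flip_nu1.
  by rewrite {1}vE flipE subKr.
have big z : Num.min a (1 - b) <= z -> 1 / 16 <= v z.
  move=> hz; have z0 : 0 < z by exact: lt_le_trans hz.
  apply: le_trans (nu1_expand n z0); rewrite le_min lexx andbT (le_trans hn) //.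
  by rewrite ler_pM2l ?pow2_gt0.
have va : 1 / 16 <= v a by apply: big; rewrite ge_min lexx.
have vb : v b <= 15 / 16.
  have := big (1 - b); rewrite ge_min lexx orbT vflip => /(_ isT); lra.
have /thompsonFP[dv _] := Fv.
have h : gen [set nu2; nu3] (f ^ v)%g.
  rewrite nu23_gen; split.
    exact: (subgroupJ (@thompsonF_subgroup R) (Fc_F Ff) Fv).
  by apply/supportedP; apply: supportedS (supportedJ (g := v) sf) va vb.
set A := gen [set nu1 c0; nu2; nu3]; have gA : is_subgroup A by exact: gen_subgroup.
have hv : A (v^-1)%g.
  by apply: genV; apply: (subgroupX n gA); apply: sub_gen; left; left.
have h' : A (f ^ v)%g by apply: (genS _ h) => x [->|->]; [left; right|right].
by rewrite -(conjgK v f); exact: (subgroupJ gA h' hv).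
Qed.

Lemma nu2_Fc : Fc R nu2 /\ Fc R nu3.
Proof.
have h (x : homeo R) : [set nu2; nu3] x -> Fc R x.
  move=> /sub_gen; rewrite nu23_gen => -[/thompsonFP[dx _] /supportedP sx].
  by apply: (Fc_of dx _ _ sx); lra.
by split; apply: h; [left|right].
Qed.

(* Near the endpoints of each cell, nu1 is the copy of a compactly supported
   element centred at these endpoints. *)
Lemma nu1_swap : exists d, [/\ Fc R d, flip d = d,
  forall t, 0 <= t <= 1 / 2 -> d (1 / 2 + t) = 1 / 2 + nu1 c0 t &
  forall t, 0 <= t <= 1 / 2 -> nu1 c0 (1 / 2 + t) = 1 / 2 + d t].
Proof.
pose T : homeo R := aff (2 ^ (0 : int)) (1 / 2).
have dT : dpl T by apply: dpl_aff; exists 1, 1%N; rewrite expr1.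
have TE x : T x = x + 1 / 2 by rewrite affE ?expr0z ?mul1r.
have TVE x : (T^-1)%g x = x - 1 / 2 by rewrite affVE ?expr0z ?divr1.
have /thompsonFP[dc sc] := c0_F.
(* The two bumps of nu_1 moved by 1/2: the left one to [1/2, 3/4], the right one to [1/4, 1/2]. *)
pose A := (c0 ^ T)%g; pose B := (flip c0 ^ T^-1)%g.
have sA : supported (1 / 2) (3 / 4) A.
  by have := supportedJ (g := T) c0s; rewrite !TE; congr supported; lra.
have sB : supported (1 / 4) (1 / 2) B.
  by have := supportedJ (g := (T^-1)%g) flip_c0s; rewrite !TVE; congr supported; lra.
have AE t : A t = 1 / 2 + c0 (t - 1 / 2) by rewrite homeoJE TE TVE; lra.
have BE t : B t = 1 / 2 - c0 (1 / 2 - t).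
  by rewrite homeoJE TVE invgK TE flipE (_ : 1 - (t + 1 / 2) = 1 / 2 - t); lra.
have AB : commute B A := supported_comm sB sA.
have flA : flip A = B by apply: homeo_ext => x; rewrite flipE AE BE (_ : 1 - x - 1 / 2 = 1 / 2 - x); lra.
exists (B * A)%g; split.
- have d : dpl (B * A)%g.
    by apply: dplM; apply: dplJ => //; [exact: dpl_flip|exact: dplV].
  have s : supported (1 / 4) (3 / 4) (B * A)%g.
    by apply: supportedM; [apply: supportedS sB _ _|apply: supportedS sA _ _]; lra.
  by apply: (Fc_of d _ _ s); lra.
- by rewrite flipM flA -flA flipK flA AB.
- move=> t /andP[t0 t2]; rewrite homeoM sB; last by apply/negP => /andP[]; lra.
  by rewrite AE (_ : 1 / 2 + t - 1 / 2 = t) ?nu1_left //; lra.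
move=> t /andP[t0 t2]; have -> : (B * A)%g t = A (B t) by [].
rewrite sA; last first.
  have [t4|t4] := boolP (1 / 4 < t < 1 / 2); last by rewrite sB //; apply/negP => /andP[]; lra.
  by have := t4; rewrite -(supported_itv _ sB) => h; apply/negP => /andP[]; lra.
have -> : 1 / 2 + t = 1 - (1 / 2 - t) by lra.
by rewrite nu1_right ?BE; lra.
Qed.

End Nu.

(** * Labels, cells, and elements localized at patterns of labels *)

Definition isb (l : letter) : bool := match l with lb | lb_inv => true | _ => false end.
Definition pos (l : letter) : bool := match l with la | lb => true | _ => false end.

Lemma inv_letterK : involutive inv_letter. Proof. by case. Qed.
Lemma isb_inv l : isb (inv_letter l) = isb l. Proof. by case: l. Qed.
Lemma pos_inv l : pos (inv_letter l) = ~~ pos l. Proof. by case: l. Qed.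
Lemma inv_letter_neq l : (inv_letter l == l) = false. Proof. by case: l. Qed.
Lemma letter_cases l l' : isb l = isb l' -> l = l' \/ l = inv_letter l'.
Proof. by case: l; case: l' => //= _; [left|right|left|right|right|left|right|left]. Qed.

Lemma labelling_isb rho (c : int) : labelling rho -> isb (rho c) = ((c %% 2)%Z == 1).
Proof.
move=> hrho; have [n [b cE]] : exists (n : int) (b : bool), c = 2 * n + b.
  exists (c %/ 2)%Z, ((c %% 2)%Z == 1); rewrite {1}(divz_eq c 2) mulrC; congr (_ + _).
  by have := modz_ge0 c (isT : (2 : int) != 0); have := ltz_mod c (isT : (2 : int) != 0); lia.
have [h0 h1] := hrho n; rewrite {}cE; case: b.
  rewrite (_ : ((_ + _) %% 2)%Z = 1); last by lia.
  by move: h1; rewrite !inE => /orP[] /eqP->.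
rewrite (_ : ((_ + _) %% 2)%Z = 0); last by lia.
by rewrite addr0; move: h0; rewrite !inE => /orP[] /eqP->.
Qed.

Lemma labelling_isbD rho (c d : int) : labelling rho ->
  (isb (rho c) == isb (rho d)) = ((c - d) %% 2 == 0)%Z.
Proof. by move=> hrho; rewrite !labelling_isb //; lia. Qed.

Section Cells.
Variable R : realType.
Implicit Types (f g h u w z : homeo R) (c j : int) (t : R).

Lemma supportedJ_in (a b : R) f g : supported a b f -> supported a b g -> supported a b (f ^ g)%g.
Proof.
move=> sf sg; rewrite conjgE; apply: supportedM; first exact: supportedV.
exact: supportedM.
Qed.

Definition tau : homeo R := aff (2 ^ (0 : int)) (1 / 2).

Lemma tauE t : tau t = t + 1 / 2.
Proof. by rewrite affE ?expr0z ?mul1r. Qed.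
Lemma tauVE t : (tau^-1)%g t = t - 1 / 2.
Proof. by rewrite affVE ?expr0z ?divr1. Qed.

(* The reflection of [f] in 1/4, the midpoint of the half cell [0, 1/2]. *)
Definition hflip f : homeo R := (flip f ^ tau^-1)%g.

Lemma hflipE f t : hflip f t = 1 / 2 - f (1 / 2 - t).
Proof. by rewrite homeoJE tauVE invgK tauE flipE (_ : 1 - (t + 1 / 2) = 1 / 2 - t); lra. Qed.
Lemma hflipM f g : hflip (f * g)%g = (hflip f * hflip g)%g.
Proof. by rewrite /hflip flipM conjMg. Qed.
Lemma hflipV f : hflip (f^-1)%g = ((hflip f)^-1)%g.
Proof. by rewrite /hflip flipV conjVg. Qed.
Lemma hflip1 : hflip 1%g = 1%g.
Proof. by rewrite /hflip flip1 conj1g. Qed.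
Lemma hflipR f g : hflip [~ f, g]%g = [~ hflip f, hflip g]%g.
Proof. by rewrite !commgEl !conjgE !(hflipM, hflipV). Qed.
Lemma supported_hflip f (a b : R) : supported a b f -> supported (1 / 2 - b) (1 / 2 - a) (hflip f).
Proof.
move=> sf; have := supportedJ (g := (tau^-1)%g) (supported_flip sf); rewrite !tauVE.
by congr supported; lra.
Qed.

Lemma flipJ f g : flip (f ^ g)%g = (flip f ^ flip g)%g.
Proof. by rewrite !conjgE !flipM flipV. Qed.
Lemma flip_tau : flip tau = (tau^-1)%g.
Proof. by apply: homeo_ext => t; rewrite flipE tauVE tauE; lra. Qed.

(* The half cell j is [j/2, (j+1)/2]; the cell c is the union of the half
   cells c-1 and c, so that cells with an odd (resp. even) index are those on
   which zeta (resp. chi) acts. *)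
Definition hc j : R := j%:~R / 2.

Lemma hcS j : hc (j + 1) = hc j + 1 / 2.
Proof. by rewrite /hc intrD; lra. Qed.

Definition acts h j u : Prop := forall t, 0 <= t <= 1 / 2 -> h (hc j + t) = hc j + u t.
Definition actc h c w : Prop := forall t, 0 <= t <= 1 -> h (hc (c - 1) + t) = hc (c - 1) + w t.

Lemma hc_decomp (x : R) : exists j t, 0 <= t <= 1 / 2 /\ x = hc j + t.
Proof.
exists (Num.floor (2 * x)), (x - hc (Num.floor (2 * x))); split; last by lra.
by have := floor_itv (2 * x); rewrite intrD /hc => /andP[? ?]; apply/andP; split; lra.
Qed.

Lemma acts_ext h h' : (forall j, exists2 u, acts h j u & acts h' j u) -> h = h'.
Proof.
move=> hh; apply: homeo_ext => x; have [j [t [t01 ->]]] := hc_decomp x.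
by have [u hu hu'] := hh j; rewrite hu ?hu'.
Qed.

Lemma actsM h h' j u u' : supported 0 (1 / 2) u -> acts h j u -> acts h' j u' ->
  acts (h * h')%g j (u * u')%g.
Proof. by move=> su hu hu' t t2; rewrite !homeoM hu // hu' //; exact: supported_in. Qed.
Lemma actsV h j u : supported 0 (1 / 2) u -> acts h j u -> acts (h^-1)%g j (u^-1)%g.
Proof.
move=> su hu t t2; apply: (@homeo_inj _ h); rewrite homeoVK hu ?homeoVK //.
by apply: supported_in => //; exact: supportedV.
Qed.
Lemma actsR h h' j u u' : supported 0 (1 / 2) u -> supported 0 (1 / 2) u' ->
  acts h j u -> acts h' j u' -> acts [~ h, h']%g j [~ u, u']%g.
Proof.
move=> su su' hu hu'; rewrite !commgEl !conjgE.
have [vu vu'] := (supportedV su, supportedV su').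
apply: actsM; [by []|exact: actsV|apply: actsM; [by []|exact: actsV|exact: actsM]].
Qed.

Lemma actc_half h c w : actc h c w <->
  (forall t, 0 <= t <= 1 / 2 -> h (hc (c - 1) + t) = hc (c - 1) + w t) /\
  (forall t, 0 <= t <= 1 / 2 -> h (hc c + t) = hc c + (w (1 / 2 + t) - 1 / 2)).
Proof.
have e : hc c = hc (c - 1) + 1 / 2 by rewrite -hcS subrK.
split=> [hw|[hl hr] t /andP[t0 t1]].
  split=> t /andP[t0 t2]; first by apply: hw; apply/andP; split; lra.
  by rewrite e -addrA hw; [lra|apply/andP; split; lra].
have [t2|t2] := leP t (1 / 2); first by apply: hl; rewrite t0.
have -> : hc (c - 1) + t = hc c + (t - 1 / 2) by rewrite e; lra.
rewrite hr; last by apply/andP; split; lra.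
have -> : 1 / 2 + (t - 1 / 2) = t by lra.
by rewrite e; lra.
Qed.

Lemma actc_left h c w : supported 0 (1 / 2) w ->
  actc h c w <-> acts h (c - 1) w /\ acts h c 1%g.
Proof.
move=> sw; rewrite actc_half; split=> -[hl hr]; split=> // t t2.
  by rewrite hr // sw ?homeo1; [lra|case/andP: t2 => ? ?; apply/negP => /andP[]; lra].
by rewrite hr // sw ?homeo1; [lra|case/andP: t2 => ? ?; apply/negP => /andP[]; lra].
Qed.

Lemma actc_right h c w : supported 0 (1 / 2) w ->
  actc h c (w ^ tau)%g <-> acts h (c - 1) 1%g /\ acts h c w.
Proof.
move=> sw; have sl t : 0 <= t <= 1 / 2 -> (w ^ tau)%g t = t.
  move=> /andP[t0 t2]; rewrite homeoJE tauVE tauE sw; first lra.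
  by apply/negP => /andP[]; lra.
have sr t : (w ^ tau)%g (1 / 2 + t) - 1 / 2 = w t.
  by rewrite homeoJE tauVE tauE (_ : 1 / 2 + t - 1 / 2 = t); lra.
rewrite actc_half; split=> -[hl hr]; split=> t t2.
- by rewrite hl // sl.
- by rewrite hr // sr.
- by rewrite hl // sl.
- by rewrite hr // sr.
Qed.

Lemma actcJ h z c w f : supported 0 1 w -> supported 0 1 f ->
  actc h c w -> actc z c f -> actc (h ^ z)%g c (w ^ f)%g.
Proof.
move=> sw sf hw hf t t01.
have vf : 0 <= (f^-1)%g t <= 1 by apply: supported_in => //; exact: supportedV.
rewrite -{1}(homeoVK f t) -hf // homeoJ hw // hf; last exact: supported_in.
by rewrite -homeoJ homeoVK.
Qed.

Lemma actcV z c f : supported 0 1 f -> actc z c f -> actc (z^-1)%g c (f^-1)%g.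
Proof.
move=> sf hf t t01; apply: (@homeo_inj _ z); rewrite homeoVK hf ?homeoVK //.
by apply: supported_in => //; exact: supportedV.
Qed.

Variable rho : int -> letter.
Hypothesis hrho : labelling rho.

Definition Z (b : bool) f : homeo R := if b then zeta rho f else chi rho f.

Lemma Z_actc b f c : supported 0 1 f -> isb (rho c) = b ->
  actc (Z b f) c (if pos (rho c) then f else flip f).
Proof.
move=> /supportedP sf; rewrite labelling_isb // => cb t t01; rewrite /Z.
case: b cb => /eqP cb.
  have cE : c = 2 * (c %/ 2)%Z + 1 by lia.
  have := @zeta_cong_T R rho f sf (c %/ 2)%Z t t01; rewrite -cE.
  have -> : (c %/ 2)%Z%:~R = hc (c - 1) by rewrite {2}cE addrK /hc intrM; lra.
  move=> ->; congr (_ + homeo_fun _ _).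
  by have [_] := hrho (c %/ 2)%Z; rewrite -cE !inE => /orP[] /eqP->.
have cE : c = 2 * (c %/ 2)%Z by lia.
have := @chi_cong_T R rho f sf (c %/ 2)%Z t t01; rewrite -cE.
have -> : (c %/ 2)%Z%:~R - 2^-1 = hc (c - 1) by rewrite {2}cE /hc intrB intrM; lra.
move=> ->; congr (_ + homeo_fun _ _).
by have [] := hrho (c %/ 2)%Z; rewrite -cE !inE => /orP[] /eqP->.
Qed.

Lemma actc_ext b h h' : (forall c, isb (rho c) = b -> exists2 w, actc h c w & actc h' c w) ->
  h = h'.
Proof.
move=> hh; apply: homeo_ext => x; have [j [t [t01 ->]]] := hc_decomp x.
have [jb|jb] := eqVneq (isb (rho j)) b.
  have [w hw hw'] := hh j jb; have [_ hr] := (actc_half h j w).1 hw.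
  by have [_ hr'] := (actc_half h' j w).1 hw'; rewrite hr ?hr'.
have [|w hw hw'] := hh (j + 1).
  have := labelling_isbD j (j + 1) hrho; rewrite (_ : (_ == 0)%Z = false); last by lia.
  by move: jb; case: b {hh}; case: (isb (rho j)); case: (isb _).
have [hl _] := (actc_half h _ w).1 hw; have [hl' _] := (actc_half h' _ w).1 hw'.
by rewrite addrK in hl hl'; rewrite hl ?hl'.
Qed.

Lemma ZM b f g : supported 0 1 f -> supported 0 1 g -> Z b (f * g)%g = (Z b f * Z b g)%g.
Proof.
move=> sf sg; apply: (@actc_ext b) => c cb; have sfg := supportedM sf sg.
exists (if pos (rho c) then (f * g)%g else flip (f * g)%g); first exact: Z_actc.
have hf := Z_actc sf cb; have hg := Z_actc sg cb => t t01; rewrite homeoM hf // hg.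
  by case: ifP => _; rewrite ?flipM.
by case: ifP => _; apply: supported_in => //; have := supported_flip sf; rewrite subrr subr0.
Qed.

Lemma Z1 b : Z b 1%g = 1%g.
Proof.
apply: (@actc_ext b) => c cb; exists 1%g => //.
by have := Z_actc (@supported1 R 0 1) cb; rewrite flip1 if_same.
Qed.

Lemma ZV b f : supported 0 1 f -> Z b (f^-1)%g = ((Z b f)^-1)%g.
Proof.
move=> sf; have sV := supportedV sf.
by apply: (mulgI (Z b f)); rewrite -ZM // !mulgV Z1.
Qed.

Lemma ZJ b f g : supported 0 1 f -> supported 0 1 g -> Z b (f ^ g)%g = (Z b f ^ Z b g)%g.
Proof.
move=> sf sg; have sV := supportedV sg; rewrite !conjgE ZM ?ZM ?ZV //.
exact: supportedM.
Qed.

Lemma Z_inj b f g : supported 0 1 f -> supported 0 1 g -> Z b f = Z b g -> f = g.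
Proof.
move=> sf sg fg; have [c cb] : exists c, isb (rho c) = b.
  by exists b%:Z; rewrite labelling_isb //; case: b {fg}.
have hf := Z_actc sf cb; have hg := Z_actc sg cb.
have E t : 0 <= t <= 1 -> (if pos (rho c) then f else flip f) t = (if pos (rho c) then g else flip g) t.
  by move=> t01; apply: (addrI (hc (c - 1))); rewrite -hf // fg hg.
apply: homeo_ext => t; have [t01|t01] := boolP (0 < t < 1); last by rewrite sf ?sg.
case/andP: t01 => t0 t1; case: ifP E => _ E.
  by apply: E; rewrite !ltW.
have := E (1 - t); rewrite !flipE subKr => /(_ _)/addrI/oppr_inj; apply.
by apply/andP; split; lra.
Qed.

(** A pair (q, l) asks for the label l at offset q from the left end of a half cell: offset 0 is the
    left end, offset 1 the right end. Reflection in the midpoint exchanges the offsets q and 1 - q,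
    whence the index j + 1 - q in [bwd]. *)
Definition pattern := seq (int * letter).
Implicit Types P : pattern.

Definition fwd P j := all (fun ql => rho (j + ql.1) == ql.2) P.
Definition bwd P j := all (fun ql => rho (j + 1 - ql.1) == inv_letter ql.2) P.

(* [h] acts as [g] on the half cells around which [rho] reads [P], as the
   reflection of [g] on those around which it reads the inverse of [P], and
   trivially elsewhere. *)
Definition lambda P g h : Prop := forall j,
  [/\ fwd P j -> acts h j g, bwd P j -> acts h j (hflip g)
    & ~~ fwd P j -> ~~ bwd P j -> acts h j 1%g].

(** The positions j + q and j + 1 - q have different parities, so their labels are in different
    families, while a letter and its inverse are in the same one. *)
Lemma fwd_bwd P j : P != [::] -> fwd P j -> bwd P j = false.
Proof.
case: P => [//|[q l] P] _ /= /andP[/eqP hl _]; apply/negP => /andP[/eqP hl' _].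
have := labelling_isbD (j + q) (j + 1 - q) hrho; rewrite hl hl' isb_inv eqxx; lia.
Qed.

Lemma lambda_uniq P g h h' : lambda P g h -> lambda P g h' -> h = h'.
Proof.
move=> hh hh'; apply: acts_ext => j; have [h1 h2 h3] := hh j; have [h1' h2' h3'] := hh' j.
have [Pj|Pj] := boolP (fwd P j); first by exists g; auto.
by have [Bj|Bj] := boolP (bwd P j); [exists (hflip g)|exists 1%g]; auto.
Qed.

Lemma lambda1 P : lambda P 1%g 1%g.
Proof. by move=> j; split=> // _; rewrite hflip1. Qed.

Lemma supported_hflip2 g : supported 0 (1 / 2) g -> supported 0 (1 / 2) (hflip g).
Proof. by move=> /supported_hflip; congr supported; lra. Qed.

Lemma lambdaM P g g' h h' : supported 0 (1 / 2) g -> lambda P g h -> lambda P g' h' ->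
  lambda P (g * g')%g (h * h')%g.
Proof.
move=> sg hh hh' j; have [h1 h2 h3] := hh j; have [h1' h2' h3'] := hh' j; split=> [p|p|p p'].
- by apply: actsM; auto.
- by rewrite hflipM; apply: actsM; auto; exact: supported_hflip2.
- by rewrite -[1%g]mulg1; apply: actsM; auto; exact: supported1.
Qed.

Lemma lambdaV P g h : supported 0 (1 / 2) g -> lambda P g h -> lambda P (g^-1)%g (h^-1)%g.
Proof.
move=> sg hh j; have [h1 h2 h3] := hh j; split=> [p|p|p p'].
- by apply: actsV; auto.
- by rewrite hflipV; apply: actsV; auto; exact: supported_hflip2.
- by rewrite -[1%g]invg1; apply: actsV; auto; exact: supported1.
Qed.

Lemma lambda_eq P P' g h : fwd P =1 fwd P' -> bwd P =1 bwd P' -> lambda P g h -> lambda P' g h.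
Proof. by move=> ef eb hh j; have := hh j; rewrite ef eb. Qed.

Lemma hflip_comm (a b : R) g g' : b <= 1 / 4 \/ 1 / 4 <= a ->
  supported a b g -> supported a b g' -> commute g (hflip g').
Proof.
move=> [b4|a4] sg /supported_hflip sg'.
  by apply: supported_comm sg _; apply: supportedS sg' _ _ => //; lra.
by apply/commute_sym; apply: supported_comm sg' _; apply: supportedS sg _ _ => //; lra.
Qed.

(** Where only one pattern is read, one of the two actions is trivial; where one is read forwards
    and the other backwards, a map meets a reflected one, and they commute since [a, b] lies on one
    side of 1/4. *)
Lemma lambdaR (a b : R) P P' g g' h h' : 0 <= a -> b <= 1 / 2 -> b <= 1 / 4 \/ 1 / 4 <= a ->
  supported a b g -> supported a b g' -> lambda P g h -> lambda P' g' h' ->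
  lambda (P ++ P') [~ g, g']%g [~ h, h']%g.
Proof.
move=> a0 b2 ab sg sg' hh hh' j.
have s2 k : supported a b k -> supported 0 (1 / 2) k by move=> sk; apply: supportedS sk _ _.
have [tg tg'] := (s2 _ sg, s2 _ sg'); have [ug ug'] := (supported_hflip2 tg, supported_hflip2 tg').
have s1 := @supported1 R 0 (1 / 2).
have [h1 h2 h3] := hh j; have [h1' h2' h3'] := hh' j; rewrite /fwd /bwd !all_cat.
rewrite -/(fwd P j) -/(fwd P' j) -/(bwd P j) -/(bwd P' j); split.
- by move=> /andP[p p']; apply: actsR; auto.
- by move=> /andP[p p']; rewrite hflipR; apply: actsR; auto.
have triv u u' : supported 0 (1 / 2) u -> supported 0 (1 / 2) u' -> commute u u' ->
    acts h j u -> acts h' j u' -> acts [~ h, h']%g j 1%g.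
  by move=> su su' /commgP/eqP <- hu hu'; apply: actsR.
have c1 (u : homeo R) : commute u 1%g by exact: commute1.
have c1' (u : homeo R) : commute 1%g u by apply: commute_sym; exact: commute1.
have cg := hflip_comm ab sg sg'; have cg' := commute_sym (hflip_comm ab sg' sg).
case: (boolP (fwd P j)) => p; case: (boolP (fwd P' j)) => p' //= _.
- by case: (boolP (bwd P' j)) => q' _; [apply: (triv g (hflip g'))|apply: (triv g 1%g)]; auto.
- by case: (boolP (bwd P j)) => q _; [apply: (triv (hflip g) g')|apply: (triv 1%g g')]; auto.
case: (boolP (bwd P j)) => q; case: (boolP (bwd P' j)) => q' //= _.
- by apply: (triv (hflip g) 1%g); auto.
- by apply: (triv 1%g (hflip g')); auto.
- by apply: (triv 1%g 1%g); auto.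
Qed.

(** The same labels, with the half cell moved one place to the right relative to them. *)
Definition shiftp P : pattern := [seq (ql.1 - 1, ql.2) | ql <- P].

Lemma fwd_shift P j : fwd (shiftp P) j = fwd P (j - 1).
Proof. by rewrite /fwd all_map; apply: eq_all => -[q l] /=; congr (rho _ == _); lia. Qed.
Lemma bwd_shift P j : bwd (shiftp P) j = bwd P (j + 1).
Proof. by rewrite /bwd all_map; apply: eq_all => -[q l] /=; congr (rho _ == _); lia. Qed.

Lemma isb_next c : isb (rho (c + 1)) = ~~ isb (rho c).
Proof.
by have := labelling_isbD (c + 1) c hrho; rewrite (_ : (_ == 0)%Z = false); [case: isb; case: isb|lia].
Qed.

Section Shift.
Variables (l : letter) (P : pattern).
Hypothesis lP : (1, l) \in P.

Lemma fwd_letter j : fwd P j -> rho (j + 1) = l.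
Proof. by move=> /allP/(_ _ lP)/eqP. Qed.
Lemma bwd_letter j : bwd P j -> rho j = inv_letter l.
Proof. by move=> /allP/(_ _ lP)/eqP /=; rewrite addrK. Qed.

(** As P prescribes the label l at the right end of the half cell j, the cell j + 1 centred there
    belongs to the family of l and contains the half cells j and j + 1. So elements localized at P,
    and at the shift of P, can be described on the cells of that family. *)
Lemma lambda_cells g h : supported 0 (1 / 2) g -> lambda P g h <->
  forall c, isb (rho c) = isb l -> actc h c
    (if rho c == l then if fwd P (c - 1) then g else 1%g
     else if bwd P c then flip g else 1%g).
Proof.
move=> sg; have flg : flip g = (hflip g ^ tau)%g by rewrite /hflip conjgKV.
have sf := supported_hflip2 sg.
have nb c : isb (rho c) = isb l -> bwd P (c - 1) = false.
  by move=> cb; apply/negP => /bwd_letter e; have := isb_next (c - 1); rewrite subrK e cb isb_inv; case: isb.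
have nf c : isb (rho c) = isb l -> fwd P c = false.
  by move=> cb; apply/negP => /fwd_letter e; have := isb_next c; rewrite e cb; case: isb.
have other c : isb (rho c) = isb l -> if rho c == l then bwd P c = false else fwd P (c - 1) = false.
  move=> cb; case: ifPn => [/eqP cl|cl]; apply/negP.
    by move=> /bwd_letter /eqP; rewrite cl eq_sym inv_letter_neq.
  by move=> /fwd_letter /eqP; rewrite subrK (negbTE cl).
split=> [hh c cb|hh j].
  have [h1 h2 h3] := hh (c - 1); have [h1' h2' h3'] := hh c.
  have := other c cb; have := nb c cb; have := nf c cb; case: ifPn => cl nf' nb' ot.
    have t1 : acts h c 1%g by apply: h3'; rewrite ?nf' ?ot.
    by case: ifPn => p; apply/actc_left => //; split=> //; [exact: h1|apply: h3; rewrite ?nb'].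
  have t1 : acts h (c - 1) 1%g by apply: h3; rewrite ?nb' ?ot.
  case: ifPn => p; first by rewrite flg; apply/actc_right => //; split=> //; exact: h2'.
  by apply/actc_left => //; split=> //; apply: h3'; rewrite ?nf'.
have [jb|jb] := eqVneq (isb (rho j)) (isb l).
  rewrite (nf j jb); split=> // [p|_ p].
    have := hh j jb; rewrite p (negbTE (_ : rho j != l)); last first.
      by rewrite (bwd_letter p) inv_letter_neq.
    by rewrite flg => /(actc_right _ _ sf)[].
  have := hh j jb; rewrite (negbTE p); case: ifP => _; last by move=> /(actc_left _ _ (@supported1 R _ _))[].
  by case: ifP => _ /actc_left[].
have jb' : isb (rho (j + 1)) = isb l by rewrite isb_next; move: jb; case: isb; case: isb.
have := nb _ jb'; rewrite addrK => ->; split=> // [p|p _].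
  have := hh _ jb'; rewrite addrK p (fwd_letter p) eqxx => /(actc_left _ _ sg).
  by rewrite addrK => -[].
have := hh _ jb'; rewrite addrK (negbTE p); case: ifP => _.
  by move=> /(actc_left _ _ (@supported1 R _ _)); rewrite addrK => -[].
case: ifP => _.
  by rewrite flg => /(actc_right _ _ sf); rewrite addrK => -[].
by move=> /(actc_left _ _ (@supported1 R _ _)); rewrite addrK => -[].
Qed.

Lemma lambda_shift_cells g h : supported 0 (1 / 2) g -> lambda (shiftp P) g h <->
  forall c, isb (rho c) = isb l -> actc h c
    (if rho c == l then if fwd P (c - 1) then (g ^ tau)%g else 1%g
     else if bwd P c then hflip g else 1%g).
Proof.
move=> sg; have sf := supported_hflip2 sg.
have nb c : isb (rho c) = isb l -> bwd P (c + 1) = false.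
  by move=> cb; apply/negP => /bwd_letter e; have := isb_next c; rewrite e cb isb_inv; case: isb.
have nf c : isb (rho c) = isb l -> fwd P (c - 1 - 1) = false.
  move=> cb; apply/negP => /fwd_letter e; have := isb_next (c - 1); rewrite subrK cb.
  by rewrite subrK in e; rewrite e; case: isb.
have other c : isb (rho c) = isb l -> if rho c == l then bwd P c = false else fwd P (c - 1) = false.
  move=> cb; case: ifPn => [/eqP cl|cl]; apply/negP.
    by move=> /bwd_letter /eqP; rewrite cl eq_sym inv_letter_neq.
  by move=> /fwd_letter /eqP; rewrite subrK (negbTE cl).
split=> [hh c cb|hh j].
  have := hh (c - 1); have := hh c; rewrite !fwd_shift !bwd_shift subrK.
  move=> [h1 h2 h3] [h1' h2' h3'].
  have := other c cb; have := nb c cb; have := nf c cb; case: ifPn => cl nf' nb' ot.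
    have t1 : acts h (c - 1) 1%g by apply: h3'; rewrite ?nf' ?ot.
    case: ifPn => p; first by apply/actc_right => //; split=> //; exact: h1.
    by apply/actc_left => //; split=> //; apply: h3; rewrite ?nb'.
  have t1 : acts h c 1%g by apply: h3; rewrite ?nb' ?ot.
  case: ifPn => p; apply/actc_left => //; split=> //; first exact: h2'.
  by apply: h3'; rewrite ?nf'.
rewrite fwd_shift bwd_shift; have [jb|jb] := eqVneq (isb (rho j)) (isb l).
  rewrite (nb j jb); split=> // [p|p _].
    have := fwd_letter p; rewrite subrK => jl; have := hh j jb; rewrite p jl eqxx.
    by move=> /(actc_right _ _ sg)[].
  have := hh j jb; rewrite (negbTE p); case: ifP => _; first by move=> /(actc_left _ _ (@supported1 R _ _))[].
  by case: ifP => _ /actc_left[].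
have jb' : isb (rho (j + 1)) = isb l by rewrite isb_next; move: jb; case: isb; case: isb.
have := nf _ jb'; rewrite addrK => ->; split=> // [p|_ p].
  have := hh _ jb'; rewrite addrK p (bwd_letter p) inv_letter_neq => /(actc_left _ _ sf).
  by rewrite addrK => -[].
have := hh _ jb'; rewrite addrK (negbTE p); case: ifP => _.
  case: ifP => _; first by move=> /(actc_right _ _ sg); rewrite addrK => -[].
  by move=> /(actc_left _ _ (@supported1 R _ _)); rewrite addrK => -[].
by move=> /(actc_left _ _ (@supported1 R _ _)); rewrite addrK => -[].
Qed.

Variables (a b : R) (f g : homeo R).
Hypotheses (a0 : 0 <= a) (b2 : b <= 1 / 2) (sg : supported a b g) (sf : supported 0 1 f).
Hypothesis f_tau : forall t, a <= t <= b -> f t = t + 1 / 2.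

Let z := Z (isb l) (if pos l then f else flip f).

Let sg2 : supported 0 (1 / 2) g. Proof. exact: supportedS sg _ _. Qed.

Let gf : (g ^ f = g ^ tau)%g.
Proof. by apply: conj_agree sg _ => t tab; rewrite f_tau // tauE. Qed.

Let sff : supported 0 1 (flip f).
Proof. by have := supported_flip sf; rewrite subrr subr0. Qed.

Let zc c : isb (rho c) = isb l -> actc z c (if rho c == l then f else flip f).
Proof.
move=> cb; have s : supported 0 1 (if pos l then f else flip f) by case: ifP.
have := Z_actc s cb; congr actc; have [->|->] := letter_cases cb.
  by rewrite eqxx; case: (pos l); rewrite ?flipK.
by rewrite inv_letter_neq pos_inv; case: (pos l); rewrite /= ?flipK.
Qed.

Let flgf : (flip g ^ flip f = hflip g)%g.
Proof. by rewrite -flipJ gf flipJ flip_tau. Qed.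

Let s01 u : supported 0 (1 / 2) u -> supported 0 1 u.
Proof. by move=> su; apply: supportedS su _ _; lra. Qed.

(** On [a, b] the map f is the translation by 1/2, so conjugation by [z] moves g from the left to
    the right half of the cells labelled l, and its reflection from the right to the left half of
    those with the inverse label. *)
Lemma lambda_shift h : lambda P g h -> lambda (shiftp P) g (h ^ z)%g.
Proof.
move=> /(lambda_cells _ sg2) hh; apply/(lambda_shift_cells _ sg2) => c cb.
have sF : supported 0 1 (flip g) by have := supported_flip (s01 sg2); rewrite subrr subr0.
have := hh c cb; have := zc cb; case: ifP => _ hz; case: ifP => _ hc.
- by rewrite -gf; apply: actcJ => //; exact: s01.
- by rewrite -(conj1g f); apply: actcJ => //; exact: supported1.
- by rewrite -flgf; apply: actcJ.
- by rewrite -(conj1g (flip f)); apply: actcJ => //; exact: supported1.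
Qed.

Lemma lambda_unshift h : lambda (shiftp P) g h -> lambda P g (h ^ z^-1)%g.
Proof.
move=> /(lambda_shift_cells _ sg2) hh; apply/(lambda_cells _ sg2) => c cb.
have := hh c cb; have := zc cb; case: ifP => _ hz; case: ifP => _ hc.
- rewrite -(conjgK f g) gf; apply: actcJ => //; last exact: actcV.
    have l0 : 0 <= a + 1 / 2 by have h0 : 0 <= a := a0; lra.
    have l1 : b + 1 / 2 <= 1 by have h0 : b <= 1 / 2 := b2; lra.
    by have := supportedJ (g := tau) sg; rewrite !tauE => h'; apply: supportedS h' _ _.
  exact: supportedV.
- by rewrite -(conj1g (f^-1)%g); apply: actcJ; [exact: supported1|exact: supportedV| |exact: actcV].
- rewrite -(conjgK (flip f) (flip g)) flgf; apply: actcJ => //; last exact: actcV.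
    by apply: s01; exact: supported_hflip2.
  exact: supportedV.
- by rewrite -(conj1g ((flip f)^-1)%g); apply: actcJ; [exact: supported1|exact: supportedV| |exact: actcV].
Qed.

End Shift.

(** The base case: an element of the family of l acts on the left half of the cells labelled l and,
    reflected, on the right half of the others. A negative l requires [flip g], since [Z] reflects
    on cells with negative labels. *)
Lemma lambda_letter l g : supported 0 (1 / 2) g ->
  lambda [:: (1, l)] g (Z (isb l) (if pos l then g else flip g)).
Proof.
move=> sg; apply/(@lambda_cells l) => //; first by rewrite inE.
have s : supported 0 1 g by apply: supportedS sg _ _; lra.
have s' : supported 0 1 (flip g) by have := supported_flip s; rewrite subrr subr0.
move=> c cb; have sp : supported 0 1 (if pos l then g else flip g) by case: ifP.
have := Z_actc sp cb; congr actc; rewrite /fwd /bwd /= subrK addrK !andbT.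
have [->|->] := letter_cases cb.
  by rewrite eqxx; case: (pos l); rewrite ?flipK.
by rewrite inv_letter_neq eqxx pos_inv; case: (pos l); rewrite /= ?flipK.
Qed.

End Cells.

(** * Words as patterns *)

Fixpoint pat (W : seq letter) (p : int) : seq (int * letter) :=
  if W is l :: W' then (p, l) :: pat W' (p + 1) else [::].

Lemma pat_cat W W' p : pat (W ++ W') p = pat W p ++ pat W' (p + (size W)%:Z).
Proof.
elim: W p => [|l W IH] p /=; first by rewrite addr0.
by rewrite IH; congr (_ :: _ ++ pat _ _); lia.
Qed.

Lemma pat_rcons W l p : pat (rcons W l) p = pat W p ++ [:: (p + (size W)%:Z, l)].
Proof. by rewrite -cats1 pat_cat. Qed.

Lemma shift_pat W p : shiftp (pat W p) = pat W (p - 1).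
Proof.
by elim: W p => //= l W IH p; rewrite -/(shiftp _) IH; congr (_ :: pat _ _); lia.
Qed.

Lemma mem_pat W p i : (i < size W)%N -> (p + i%:Z, nth la W i) \in pat W p.
Proof.
elim: W p i => //= l W IH p [|i] iW; first by rewrite addr0 inE eqxx.
by rewrite inE (_ : p + i.+1%:Z = p + 1 + i%:Z) ?IH ?orbT //; lia.
Qed.

Lemma size_pat W p : size (pat W p) = size W.
Proof. by elim: W p => //= l W IH p; rewrite IH. Qed.

Lemma block_wordS rho m n : block_word rho m n.+1 = rho m :: block_word rho (m + 1) n.
Proof.
apply: (@eq_from_nth _ la) => [|i]; rewrite /= !size_map !size_iota // => ilt.
rewrite (nth_map 0%N) ?size_iota // nth_iota // add0n; case: i ilt => [|i] ilt /=.
  by rewrite addr0.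
by rewrite (nth_map 0%N) ?size_iota // nth_iota // add0n; congr rho; lia.
Qed.

Lemma block_wordSr rho m n : block_word rho m n.+1 = rcons (block_word rho m n) (rho (m + n.+1%:Z)).
Proof. by rewrite /block_word /mkseq -[n.+2]addn1 iotaD map_cat cats1. Qed.

Lemma size_block rho m n : size (block_word rho m n) = n.+1.
Proof. by rewrite size_mkseq. Qed.

Lemma fwd_block rho W p j : W != [::] ->
  fwd rho (pat W p) j = (W == block_word rho (j + p) (size W).-1).
Proof.
case: W => // l W _; elim: W l p => [|l' W IH] l p.
  by rewrite /= /block_word /mkseq /= addr0 andbT eqseq_cons andbT eq_sym.
have -> : fwd rho (pat [:: l, l' & W] p) j = (rho (j + p) == l) && fwd rho (pat (l' :: W) (p + 1)) j by [].
have -> : (size [:: l, l' & W]).-1 = (size (l' :: W)).-1.+1 by [].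
by rewrite IH block_wordS eqseq_cons addrA eq_sym.
Qed.

Lemma inv_wordK : involutive inv_word.
Proof.
move=> w; rewrite /inv_word map_rev revK -map_comp -[RHS]map_id.
by apply: eq_map => l /=; rewrite inv_letterK.
Qed.

Lemma bwd_block rho W p j : W != [::] ->
  bwd rho (pat W p) j = (inv_word W == block_word rho (j + 1 - p - ((size W).-1)%:Z) (size W).-1).
Proof.
case: W => // l W _; elim: W l p => [|l' W IH] l p.
  by rewrite /= /block_word /mkseq /inv_word /= subr0 addr0 andbT eqseq_cons andbT eq_sym.
have -> : bwd rho (pat [:: l, l' & W] p) j =
  (rho (j + 1 - p) == inv_letter l) && bwd rho (pat (l' :: W) (p + 1)) j by [].
have -> : (size [:: l, l' & W]).-1 = (size (l' :: W)).-1.+1 by [].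
rewrite IH block_wordSr.
have -> : inv_word [:: l, l' & W] = rcons (inv_word (l' :: W)) (inv_letter l).
  by rewrite /inv_word [map _ (l :: _)]/= rev_cons.
rewrite eqseq_rcons andbC [rho _ == _]eq_sym; congr (_ && _); last by congr (_ == rho _); lia.
by congr (_ == block_word _ _ _); lia.
Qed.

(** * Elements localized at words *)

Section Words.
Variable R : realType.
Implicit Types (f g h u w z : homeo R) (c : bool) (j : int) (t : R).
Variable c0 : homeo R.
Hypothesis c0_F : thompsonF R c0.
Hypothesis c0_supp : supp c0 = `]0, 1 / 4[%classic.
Hypothesis c0_gt : forall x : R, 0 < x < 1 / 4 -> x < c0 x.
Variable fI : nat * nat -> nat * nat -> homeo R.
Hypothesis fI_transfer : is_transfer fI.
Variable rho : int -> letter.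
Hypothesis hrho : labelling rho.

(* K is a standard dyadic interval in the interior of the half cell [0, 1/2]. *)
Variables p n : nat.
Hypotheses (p_gt0 : (0 < p)%N) (p_lt : (p.+1 < 2 ^ n)%N).
Let K : nat * nat := (p, n.+1).
(** The translate of [K] by 1/2. *)
Let K' : nat * nat := (p + 2 ^ n, n.+1)%N.
Let a : R := sd_aff R K 0.
Let b : R := sd_aff R K 1.

Let K_inner : inner R K.
Proof. by apply/innerP; rewrite /= expnS; split=> //; lia. Qed.
Let K'_inner : inner R K'.
Proof. by apply/innerP; rewrite /= expnS; split; lia. Qed.
Let a_gt0 : 0 < a. Proof. by case: (inner_aff K_inner). Qed.
Let a_ge0 : 0 <= a. Proof. exact: ltW. Qed.
Let bE : b = p.+1%:R / 2 ^+ n / 2.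
Proof. by rewrite /b sd_aff1 /K /= exprS invfM [2^-1 * _]mulrC mulrA. Qed.
Let b_le2 : b <= 1 / 2.
Proof.
rewrite bE ler_pM2r ?invr_gt0 // ler_pdivrMr ?pow2_gt0 // mul1r -natrX ler_nat.
exact: ltnW.
Qed.
(** A standard dyadic interval strictly inside [0, 1/2] does not straddle the midpoint 1/4. *)
Let ab4 : b <= 1 / 4 \/ 1 / 4 <= a.
Proof.
have [m mn] : exists m, n = m.+1 by case: n p_lt => [|m _]; [rewrite expn0; lia|exists m].
have g0 := pow2_gt0 R m.
rewrite /a /b sd_aff0 sd_aff1 /K /= mn !exprS.
rewrite ler_pdivrMr ?ler_pdivlMr ?mulr_gt0 //.
have -> : 1 / 4 * (2 * (2 * 2 ^+ m)) = (2 ^ m)%:R :> R by rewrite natrX; lra.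
by rewrite !ler_nat; lia.
Qed.
Let ab : a < b. Proof. by rewrite homeo_ltE. Qed.

Definition FcK : set (homeo R) := [set g | exists2 s, Fc R s & g = (s ^ sd_aff R K)%g].

Lemma FcK_supported g : FcK g -> supported a b g.
Proof. by move=> [s /Fc_sub01 ss ->]; exact: supportedJ. Qed.

Lemma FcK_supported2 g : FcK g -> supported 0 (1 / 2) g.
Proof. by move=> /FcK_supported sg; apply: supportedS sg _ _. Qed.

Lemma FcK_Fc g : FcK g -> Fc R g.
Proof. by move=> [s Fs ->]; apply: copy_Fc => //; [exact: Fc_dpl|exact: Fc_sub01]. Qed.

Let f0 := fI K K'.

Let f0_Fc : Fc R f0. Proof. exact: fI_Fc. Qed.

Let f0_tau t : a <= t <= b -> f0 t = t + 1 / 2.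
Proof.
move=> tab; rewrite -(homeoVK (sd_aff R K) t) /f0 fI_aff //; last first.
  by rewrite -(homeo_leE (sd_aff R K) 0) -(homeo_leE (sd_aff R K) _ 1) homeoVK.
rewrite !sd_affE /= natrD natrX exprS; have := pow2_gt0 R n => ?.
by field; rewrite gt_eqF.
Qed.

Definition realizes (A : set (homeo R)) P : Prop :=
  forall g, FcK g -> exists2 h, A h & lambda rho P g h.

Definition Z_normalized (A : set (homeo R)) : Prop :=
  forall h f c, A h -> Fc R f -> A (h ^ Z rho c f)%g.

Lemma realizes_shift A P l : Z_normalized A -> (1, l) \in P ->
  realizes A P <-> realizes A (shiftp P).
Proof.
move=> nA lP; have s0 := Fc_sub01 f0_Fc.
have fl : Fc R (if pos l then f0 else flip f0) by case: ifP => // _; exact: Fc_flip.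
split=> hP g Kg; have [h Ah hh] := hP g Kg; have sg := FcK_supported Kg.
  exists (h ^ Z rho (isb l) (if pos l then f0 else flip f0))%g; first exact: (nA _ _ _ Ah fl).
  exact: (lambda_shift hrho lP a_ge0 b_le2 sg s0 f0_tau hh).
exists (h ^ (Z rho (isb l) (if pos l then f0 else flip f0))^-1)%g.
  by rewrite -ZV; [exact: (nA _ _ _ Ah (FcV fl))| |exact: Fc_sub01].
exact: (lambda_unshift hrho lP a_ge0 b_le2 sg s0 f0_tau hh).
Qed.

Lemma realizes_eq A P P' : fwd rho P =1 fwd rho P' -> bwd rho P =1 bwd rho P' ->
  realizes A P -> realizes A P'.
Proof.
by move=> ef eb hP g Kg; have [h Ah hh] := hP g Kg; exists h => //; exact: lambda_eq hh.
Qed.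

(* By perfectness of Fc it suffices to treat commutators. *)
Lemma realizes_commg A B C P P' : is_subgroup C ->
  (forall g g' h h', FcK g -> FcK g' -> A h -> B h' ->
     lambda rho P g h -> lambda rho P' g' h' -> C [~ h, h']%g) ->
  realizes A P -> realizes B P' -> realizes C (P ++ P').
Proof.
move=> gC ABC hP hP' _ [s Fs ->].
have := Fc_perfect c0_F c0_supp c0_gt fI_transfer Fs.
have /subgroupP[C1 CM CV] := gC.
have /subgroupP[F1 FM FV] := @Fc_subgroup R.
have KF x : Fc R x -> FcK (x ^ sd_aff R K)%g by exists x.
suff : derived (Fc R) `<=` [set s | Fc R s /\
    exists2 h, C h & lambda rho (P ++ P') (s ^ sd_aff R K)%g h].
  by move=> h /h[].
apply: gen_sub.
  apply/subgroupP; split=> [|x y [Fx [h Ch hh]] [Fy [h' Ch' hh']]|x [Fx [h Ch hh]]] /=.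
  - by split=> //; exists 1%g => //; rewrite conj1g; exact: lambda1.
  - split; first exact: FM.
    exists (h * h')%g; first exact: CM.
    by rewrite conjMg; apply: lambdaM => //; exact: FcK_supported2 (KF _ Fx).
  - split; first exact: FV.
    exists (h^-1)%g; first exact: CV.
    by rewrite conjVg; apply: lambdaV => //; exact: FcK_supported2 (KF _ Fx).
move=> _ [x Fx] [y Fy <-]; split; first exact: FcR.
have [h Ah hh] := hP _ (KF x Fx); have [h' Bh' hh'] := hP' _ (KF y Fy).
exists [~ h, h']%g; first exact: (ABC _ _ _ _ (KF x Fx) (KF y Fy) Ah Bh' hh hh').
rewrite conjRg; apply: (lambdaR a_ge0 b_le2 ab4 _ _ hh hh'); exact: FcK_supported (KF _ _).
Qed.

Lemma realizes_cat A B P P' : is_subgroup A -> (forall x y, A x -> B y -> A [~ x, y]%g) ->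
  realizes A P -> realizes B P' -> realizes A (P ++ P').
Proof. by move=> gA AB; apply: realizes_commg => // g g' h h' _ _ Ah Bh' _ _; exact: AB. Qed.

(** The half cell is shifted across one letter of W at a time. With offset 1 the word starts at its
    right end; with offset 1 - [size W] the word stops at its left end. *)
Lemma realizes_move A W k : Z_normalized A -> (k <= size W)%N ->
  realizes A (pat W 1) <-> realizes A (pat W (1 - k%:Z)).
Proof.
move=> nA; elim: k => [|k IH] kW; first by rewrite subr0.
rewrite IH; last exact: ltnW.
have /realizes_shift -> // : (1, nth la W k) \in pat W (1 - k%:Z).
  by have := mem_pat (1 - k%:Z) kW; rewrite subrK.
by rewrite shift_pat (_ : 1 - k.+1%:Z = 1 - k%:Z - 1) //; lia.
Qed.

Variable G : set (homeo R).
Hypothesis G_subgroup : is_subgroup G.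
Hypothesis ZG : forall f c, Fc R f -> G (Z rho c f).

Let nG : Z_normalized G.
Proof. by move=> h f c Gh Ff; apply: subgroupJ G_subgroup Gh (ZG c Ff). Qed.

(** Letters are appended one at a time: once the half cell is moved between W and the new letter l,
    one takes commutators with elements localized at l. *)
Lemma realizes_G W : W != [::] -> realizes G (pat W 1).
Proof.
elim/last_ind: W => [//|W l IH] _; have [->|W0] := eqVneq W [::].
  move=> g Kg; eexists; last exact: (lambda_letter hrho l (FcK_supported2 Kg)).
  by apply: ZG; have Fg := FcK_Fc Kg; case: ifP => // _; exact: Fc_flip.
apply/(@realizes_move _ _ (size W)) => //; first by rewrite size_rcons.
rewrite pat_rcons subrK; apply: (@realizes_cat G G) => //.
- by move=> x y Gx Gy; exact: subgroupR.
- by apply/realizes_move => //; exact: IH.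
move=> g Kg; eexists; last exact: (lambda_letter hrho l (FcK_supported2 Kg)).
by apply: ZG; have Fg := FcK_Fc Kg; case: ifP => // _; exact: Fc_flip.
Qed.

Variable N : set (homeo R).
Hypothesis N_normal : normal_in N G.
Hypothesis quasi : quasi_periodic rho.

Let gN : is_subgroup N. Proof. by case: N_normal. Qed.
Let NJ x y : N x -> G y -> N (x ^ y)%g. Proof. by case: N_normal => _ _; exact. Qed.
Let nN : Z_normalized N. Proof. by move=> h f c Nh Ff; apply: NJ => //; exact: ZG. Qed.
Let NR x y : N x -> G y -> N [~ x, y]%g.
Proof.
move=> Nx Gy; have /subgroupP[_ NM NV] := gN; rewrite commgEl.
by apply: NM; [exact: NV|exact: NJ].
Qed.

(** Commutators of elements of N localized at [W0] with elements of G localized at W lie in N. They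
    are localized at W, whose constraints include those of [W0] once the offsets are aligned. *)
Lemma realizes_infix W0 W : W0 != [::] -> realizes N (pat W0 1) -> infix W0 W ->
  realizes N (pat W 1).
Proof.
move=> W00 h /infixP[A [B WE]]; have W1 : W != [::] by rewrite WE; case: (A) => //; case: (W0) W00.
apply/(@realizes_move _ _ (size A)) => //; first by rewrite WE size_cat leq_addr.
have G1 : realizes G (pat W (1 - (size A)%:Z)).
  apply/realizes_move => //; first by rewrite WE size_cat leq_addr.
  exact: realizes_G.
have := realizes_cat gN NR h G1; rewrite {1 2}WE !pat_cat subrK.
by apply: realizes_eq => j; rewrite /fwd /bwd !all_cat; do !case: all.
Qed.

Lemma fwd_rcons W l q j : fwd rho (pat (rcons W l) q) j =
  fwd rho (pat W q) j && (rho (j + (q + (size W)%:Z)) == l).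
Proof. by rewrite pat_rcons /fwd all_cat /= andbT. Qed.
Lemma bwd_rcons W l q j : bwd rho (pat (rcons W l) q) j =
  bwd rho (pat W q) j && (rho (j + 1 - (q + (size W)%:Z)) == inv_letter l).
Proof. by rewrite pat_rcons /bwd all_cat /= andbT. Qed.

(** The places reading W are divided according to the next letter, so the product of four elements
    localized at the one-letter extensions is localized at W; at each place at most one factor
    acts. *)
Lemma realizes_split W : W != [::] -> (forall l, realizes N (pat (rcons W l) 1)) ->
  realizes N (pat W 1).
Proof.
move=> W0 hW g Kg; have sg := FcK_supported2 Kg; have sf := supported_hflip2 sg.
have s1 := @supported1 R 0 (1 / 2).
have [h1 N1 l1] := hW la g Kg; have [h2 N2 l2] := hW lb g Kg.
have [h3 N3 l3] := hW la_inv g Kg; have [h4 N4 l4] := hW lb_inv g Kg.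
have /subgroupP[_ NM _] := gN.
exists (h1 * (h2 * (h3 * h4)))%g; first by do !apply: (NM) => //.
move=> j; have Wn : pat W 1 != [::] by rewrite -size_eq0 size_pat size_eq0.
pose u l := if fwd rho (pat (rcons W l) 1) j then g
  else if bwd rho (pat (rcons W l) 1) j then hflip g else 1%g.
have su l : supported 0 (1 / 2) (u l) by rewrite /u; do !case: ifP.
have act h l : lambda rho (pat (rcons W l) 1) g h -> acts h j (u l).
  move=> hh; have [k1 k2 k3] := hh j; rewrite /u; case: ifPn => [/k1 //|q1].
  by case: ifPn => [/k2 //|]; exact: k3.
have : acts (h1 * (h2 * (h3 * h4)))%g j (u la * (u lb * (u la_inv * u lb_inv)))%g.
  apply: actsM (su la) (act _ _ l1) _; apply: actsM (su lb) (act _ _ l2) _.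
  exact: actsM (su la_inv) (act _ _ l3) (act _ _ l4).
have uE l : u l = if fwd rho (pat W 1) j then
      (if rho (j + (1 + (size W)%:Z)) == l then g else 1%g)
    else if bwd rho (pat W 1) j then
      (if rho (j + 1 - (1 + (size W)%:Z)) == inv_letter l then hflip g else 1%g)
    else 1%g.
  rewrite /u fwd_rcons bwd_rcons; case F: (fwd rho (pat W 1) j) => /=.
    by rewrite (fwd_bwd hrho Wn F).
  by case: (bwd rho (pat W 1) j).
rewrite !uE => H; split=> [p1|p1|p1 p2]; move: H.
- by rewrite p1; case: (rho _) => /=; rewrite ?mulg1 ?mul1g.
- rewrite p1; have -> : fwd rho (pat W 1) j = false.
    by apply/negP => /(fwd_bwd hrho Wn); rewrite p1.
  by case: (rho _) => /=; rewrite ?mulg1 ?mul1g.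
by rewrite (negbTE p1) (negbTE p2) !mulg1.
Qed.

Variables (m0 : int) (n0 : nat).
Hypothesis W0_realized : realizes N (pat (block_word rho m0 n0) 1).

Lemma realizes_N W : W != [::] -> realizes N (pat W 1).
Proof.
have [M hM] := quasi.1 m0 n0.
suff H d : forall W, W != [::] -> (M <= size W + d)%N -> realizes N (pat W 1).
  by move=> W0; apply: (H M) => //; rewrite leq_addl.
elim: d => [|d IH] {}W W0 hW; last first.
  apply: realizes_split => // l; apply: IH; first by case: (W).
  by rewrite size_rcons; lia.
have sW : (size W).-1.+1 = size W by rewrite prednK // lt0n size_eq0.
have [[m Wm]|nocc] := pselect (exists m, W = block_word rho m (size W).-1).
  apply: (realizes_infix _ W0_realized).
    by rewrite -size_eq0 size_block.
  by rewrite Wm; apply: hM; rewrite sW -(addn0 (size W)).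
(* A word that is read nowhere is realized by the identity: its inverse is read nowhere either, as
   the words of rho are closed under inverses. *)
move=> g Kg; exists 1%g; first by have /subgroupP[] := gN.
move=> j; split=> //.
  by rewrite fwd_block // => /eqP Wm; case: nocc; exists (j + 1).
rewrite bwd_block // => /eqP Wm; case: nocc.
have [m' [n' E]] := quasi.2 (j + 1 - 1 - ((size W).-1)%:Z) (size W).-1.
rewrite -Wm inv_wordK in E; exists m'; have := congr1 size E; rewrite size_block => En.
by rewrite -{1}E -En.
Qed.

(** One-letter words give the maps supported inside [K], and every element of [Fc] is conjugate in
    [Fc] to such a map. *)
Lemma Z_in_N f c : Fc R f -> N (Z rho c f).
Proof.
have hK g : FcK g -> N (Z rho c g).
  move=> Kg; pose l := if c then lb else la.
  have [|h Nh hh] := @realizes_N [:: l] _ g Kg; first by [].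
  rewrite (_ : Z rho c g = h) //.
  have := lambda_letter hrho l (FcK_supported2 Kg).
  have -> : isb l = c by rewrite /l; case: (c).
  have -> : pos l by rewrite /l; case: (c).
  by move=> /lambda_uniq; apply.
move=> Ff; have [x [y [x0 xy y1 sf]]] := Fc_supp Ff.
have b1 : b < 1 by apply: (le_lt_trans b_le2); lra.
have [u [Fu ua ub]] := squeeze c0_F c0_supp c0_gt x0 y1 a_gt0 ab b1.
have Nu : N (Z rho c (f ^ u)%g).
  apply: hK; exists ((f ^ u) ^ (sd_aff R K)^-1)%g; last by rewrite conjgKV.
  have sfu := supportedJ (g := u) sf; have sfK := supportedJ (g := ((sd_aff R K)^-1)%g) sfu.
  apply: (Fc_of _ _ _ sfK).
  - apply: dplJ; last by apply: dplV; exact: sd_aff_dpl.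
    by apply: dplJ; exact: Fc_dpl.
  - by rewrite -(homeo_ltE (sd_aff R K)) homeoVK.
  - by rewrite -(homeo_ltE (sd_aff R K)) homeoVK.
have := NJ Nu (ZG c (FcV Fu)); rewrite -ZJ ?conjgK //; apply: Fc_sub01 => //; last exact: FcV.
exact: FcJ.
Qed.

End Words.

(** Used with x = h and w = (h^-1)^k, where k is in a normal subgroup: the product of x and w is
    then [h^-1, k], so [h, h'] lies in that subgroup. *)
Lemma commg_absorb (G : groupType) (x y w : G) : commute w x -> commute w y ->
  ([~ x * w, y] = [~ x, y])%g.
Proof.
move=> wx wy; have xw := commute_sym wx.
rewrite !commgEl !conjgE; apply: (mulgI (x * w)%g); rewrite mulVKg.
have -> : (x * w * (x^-1 * (y^-1 * (x * y))) = w * (y^-1 * (x * y)))%g.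
  by rewrite -wx -!mulgA mulVKg.
by rewrite -[in LHS]wx -[in LHS]mulgA !mulgA -(commuteV wy) -!mulgA.
Qed.

(** * Locality of the action *)

Section Locality.
Variable R : realType.
Implicit Types (f g h u w z : homeo R) (i j d : int) (t x y v : R) (s : bool).
Variable rho : int -> letter.
Hypothesis hrho : labelling rho.

(* The isometries of R preserving the half-integers, on R and on doubles of
   half-integers. *)
Definition isom s d x : R := if s then x + hc R d else hc R d - x.
Definition isomi s d i : int := if s then i + d else d - i.
Definition signed s (l : letter) : letter := if s then l else inv_letter l.

Definition compat s d x (k : nat) : Prop :=
  forall i, `|i%:~R - 2 * x| <= k%:R -> rho (isomi s d i) = signed s (rho i).

(* The action of [f] near [x] is determined by the labels near [x]. *)
Definition tame f : Prop := exists k e : nat,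
  (forall s d x, compat s d x k -> f (isom s d x) = isom s d (f x)) /\
  (forall x, `|f x - x| <= e%:R).

Lemma compat_near s d x y (k k' : nat) : compat s d x k ->
  k'%:R + 2 * `|y - x| <= k%:R -> compat s d y k'.
Proof.
move=> h kk i iy; apply: h; apply: le_trans kk; apply: le_trans (lerD iy (lexx _)).
have -> : i%:~R - 2 * x = (i%:~R - 2 * y) + 2 * (y - x) by ring.
by apply: (le_trans (ler_normD _ _)); rewrite lerD2l normrM ger0_norm.
Qed.

Lemma tame_subgroup : is_subgroup [set f | tame f].
Proof.
apply/subgroupP; split.
- by exists 0%N, 0%N; split=> // x; rewrite subrr normr0.
- move=> f g [k1 [e1 [f1 f2]]] [k2 [e2 [g1 g2]]].
  (* A displacement by [e1] on the line is one by 2 [e1] in the doubled units in which labels are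
     indexed. *)
  exists (k1 + k2 + (e1 + e1))%N, (e1 + e2)%N; split=> [s d x hx|x].
    rewrite !homeoM f1; last first.
      by apply: (compat_near hx); rewrite subrr normr0 mulr0 addr0 ler_nat; lia.
    rewrite g1 //; apply: (compat_near hx); rewrite !natrD.
    by have := f2 x; have := ler0n R k1; lra.
  rewrite homeoM natrD; have -> : g (f x) - x = (g (f x) - f x) + (f x - x) by ring.
  by apply: (le_trans (ler_normD _ _)); rewrite addrC lerD.
move=> f [k [e [f1 f2]]]; exists (k + (e + e))%N, e; split=> [s d y hy|y]; last first.
  by rewrite distrC -{1}(homeoVK f y).
apply: (@homeo_inj _ f); rewrite homeoVK f1 ?homeoVK //.
apply: (compat_near hy); rewrite !natrD.
by have := f2 ((f^-1)%g y); rewrite homeoVK distrC; lra.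
Qed.

Lemma cell_decomp b x : exists c t, [/\ isb (rho c) = b, 0 <= t <= 1 & x = hc R (c - 1) + t].
Proof.
have [j [t [/andP[t0 t2] ->]]] := hc_decomp x; have [jb|jb] := eqVneq (isb (rho j)) b.
  exists j, (t + 1 / 2); split=> //; first by apply/andP; split; lra.
  by rewrite -{1}(subrK 1 j) hcS; lra.
exists (j + 1), t; rewrite addrK; split=> //; last by apply/andP; split; lra.
by rewrite (isb_next hrho); move: jb; case: isb; case: b.
Qed.

Lemma Z_tame b f : supported 0 1 f -> tame (Z rho b f).
Proof.
move=> sf; have fl01 : supported 0 1 (flip f).
  by have := supported_flip sf; rewrite subrr subr0.
exists 2%N, 1%N; split=> [s d x hx|x]; have [c [t [cb t01 xE]]] := cell_decomp b x; last first.
  have hZ := Z_actc hrho sf cb; rewrite xE hZ //.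
  set f' := if _ then _ else _; have : 0 <= f' t <= 1.
    by apply: supported_in => //; rewrite /f'; case: ifP.
  rewrite (_ : _ + _ - _ = f' t - t); last by ring.
  by move: t01 => /andP[? ?] /andP[? ?]; rewrite ler_norml; apply/andP; split; lra.
have hZ := Z_actc hrho sf cb.
have cE : rho (isomi s d c) = signed s (rho c).
  apply: hx; rewrite xE /hc intrB; case/andP: t01 => ? ?.
  by rewrite ler_norml; apply/andP; split; lra.
have cb' : isb (rho (isomi s d c)) = b by rewrite cE /signed; case: ifP; rewrite ?isb_inv.
have hZ' := Z_actc hrho sf cb'.
rewrite xE hZ //; rewrite /isom; case: s cE hZ' {cb' hx} => /= cE hZ'.
  have E (u : R) : hc R (c - 1) + u + hc R d = hc R (c + d - 1) + u.
    by rewrite /hc !(intrD, intrB); lra.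
  by rewrite !E hZ' // cE.
have E (u : R) : hc R d - (hc R (c - 1) + u) = hc R (d - c - 1) + (1 - u).
  by rewrite /hc !(intrD, intrB); lra.
rewrite !E hZ'; last by case/andP: t01 => ? ?; apply/andP; split; lra.
by rewrite cE pos_inv; case: (pos _) => /=; rewrite flipE ?subKr.
Qed.

Hypothesis quasi : quasi_periodic rho.

(** With period c, an inverse of a word of length c + 1 extends to a symmetry i |-> e - i inverting
    all labels of rho. If e is even, the label at e/2 would be its own inverse; if e is odd, the
    symmetry would exchange the two families of letters. *)
Lemma not_periodic (c : nat) : (0 < c)%N -> exists i, rho (i + c%:Z) <> rho i.
Proof.
move=> c0; apply: contrapT => hn.
have per i : rho (i + c%:Z) = rho i by apply: contrapT => h; apply: hn; exists i.
have perz (q : int) i : rho (i + q * c%:Z) = rho i.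
  have pos' (q' : nat) k : rho (k + q'%:Z * c%:Z) = rho k.
    elim: q' => [|q' IH]; first by rewrite mul0r addr0.
    by rewrite -IH -[RHS]per; congr rho; lia.
  case: (lerP 0 q) => q0; first by rewrite -(gez0_abs q0) pos'.
  rewrite -(pos' `|q|%N (i + q * c%:Z)); congr rho.
  by rewrite ltz0_abs //; lia.
have [m [n E]] := quasi.2 0 c.
have nc : n = c.
  by have := congr1 size E; rewrite size_block /inv_word size_rev size_map size_block => -[].
rewrite {}nc in E; pose e := m + c%:Z.
have refl (r : nat) : (r <= c)%N -> rho (e - r%:Z) = inv_letter (rho r%:Z).
  move=> rc; have := congr1 (fun W : seq letter => nth la W (c - r)%N) E.
  rewrite /inv_word nth_rev; last by rewrite size_map size_block; lia.
  rewrite size_map size_block (nth_map la); last by rewrite size_block; lia.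
  rewrite /block_word !nth_mkseq; try lia.
  rewrite (_ : (m + _) = e - r%:Z); last by rewrite /e; lia.
  by rewrite (_ : (0 + _) = r%:Z); last by lia.
have refl' i : rho (e - i) = inv_letter (rho i).
  have [q [r [rc ->]]] : exists q : int, exists r : nat, (r <= c)%N /\ i = r%:Z + q * c%:Z.
    have hc0 : c%:Z != 0 by lia.
    exists (i %/ c%:Z)%Z, `|(i %% c%:Z)%Z|%N.
    rewrite gez0_abs ?modz_ge0 // addrC -divz_eq; split=> //.
    by have := ltz_mod i hc0; have := modz_ge0 i hc0; lia.
  by rewrite perz -refl // -[RHS](perz (- q)); congr rho; lia.
have [e2|e2] := eqVneq (e %% 2)%Z 0.
  have := refl' (e %/ 2)%Z; rewrite (_ : e - _ = (e %/ 2)%Z); last by lia.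
  by move=> /esym/eqP; rewrite inv_letter_neq.
have := labelling_isbD (e - 0) 0 hrho; rewrite refl' isb_inv eqxx; lia.
Qed.



(** * Windows of labels around a half cell *)

Section Window.
Variables (j0 : int) (L : nat).

(** Symmetric under i |-> 2 j0 + 1 - i, the reflection of the half cell [j0]. *)
Definition window i : Prop := j0 - L%:Z <= i <= j0 + L%:Z + 1.
Definition window_word : seq letter := block_word rho (j0 - L%:Z) (L + L).+1.
Definition window_pat : pattern := pat window_word (- L%:Z).

Lemma window_fwd j i : fwd rho window_pat j -> window i -> rho (i + (j - j0)) = rho i.
Proof.
move=> /allP hP /andP[i1 i2]; pose r := absz (i - (j0 - L%:Z))%R.
have rL : (r < size window_word)%N by rewrite size_block; lia.
have /hP /eqP := mem_pat (- L%:Z) rL; rewrite /= nth_mkseq; last by lia.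
have -> : j + (- L%:Z + r%:Z) = i + (j - j0) by rewrite /r; lia.
by have -> : j0 - L%:Z + r%:Z = i by rewrite /r; lia.
Qed.

Lemma window_bwd j i : bwd rho window_pat j -> window i ->
  rho ((j + 1 + j0) - i) = inv_letter (rho i).
Proof.
move=> /allP hP /andP[i1 i2]; pose r := absz (i - (j0 - L%:Z))%R.
have rL : (r < size window_word)%N by rewrite size_block; lia.
have /hP /eqP := mem_pat (- L%:Z) rL; rewrite /= nth_mkseq; last by lia.
have -> : j + 1 - (- L%:Z + r%:Z) = j + 1 + j0 - i by rewrite /r; lia.
by have -> : j0 - L%:Z + r%:Z = i by rewrite /r; lia.
Qed.

Lemma lambda_moved a b g h x : 0 <= a -> b <= 1 / 2 -> supported a b g ->
  lambda rho window_pat g h -> h x != x ->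
  exists s d v, [/\ x = isom s d v, hc R j0 + a < v < hc R j0 + b &
    forall i, window i -> rho (isomi s d i) = signed s (rho i)].
Proof.
move=> a0 b2 sg hh; have [j [t [t2 ->]]] := hc_decomp x; have [h1 h2 h3] := hh j.
have [F|F] := boolP (fwd rho window_pat j).
  rewrite h1 // => gt; exists true, (j - j0), (hc R j0 + t); split.
  - by rewrite /isom /hc intrB; lra.
  - have : a < t < b by apply: contraNT gt => tab; rewrite sg.
    by move=> /andP[? ?]; apply/andP; split; lra.
  - by move=> i; exact: window_fwd.
have [B|B] := boolP (bwd rho window_pat j); last by rewrite h3 // homeo1 eqxx.
rewrite h2 // hflipE => gt; exists false, (j + 1 + j0), (hc R j0 + (1 / 2 - t)); split.
- by rewrite /isom /hc !intrD; lra.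
- have : a < 1 / 2 - t < b by apply: contraNT gt => tab; rewrite sg // subKr.
  by move=> /andP[? ?]; apply/andP; split; lra.
- by move=> i; exact: window_bwd.
Qed.

(** The centre of the reflection lies in the window: it is either a position whose label would be
    its own inverse, or the middle of two adjacent positions, whose labels are in different
    families. *)
Lemma no_reflection d (k : nat) : (k < L)%N -> `|d - 2 * j0| <= k%:Z ->
  (forall i, window i -> window (d - i) -> rho (d - i) = inv_letter (rho i)) -> False.
Proof.
move=> kL dj hd; have [d2|d2] := eqVneq (d %% 2)%Z 0.
  have := hd (d %/ 2)%Z; rewrite (_ : d - _ = (d %/ 2)%Z); last by lia.
  have w2 : window (d %/ 2)%Z by rewrite /window; lia.
  by move=> /(_ w2 w2)/esym/eqP; rewrite inv_letter_neq.
have dE : d - (d %/ 2)%Z = (d %/ 2)%Z + 1 by lia.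
have := hd (d %/ 2)%Z; rewrite dE => h.
have := isb_next hrho (d %/ 2)%Z; rewrite h; first by rewrite isb_inv; case: isb.
  by rewrite /window; lia.
by rewrite /window; lia.
Qed.

(** Every d with absolute value at most k divides k!, so steps of d lead from [i0] to i0 + k!. Thus
    a single witness [i0], chosen before d is known, excludes all small periods at once. *)
Lemma no_period d (k : nat) i0 : 0 < `|d| <= k%:Z -> rho (i0 + (k`!)%:Z) <> rho i0 ->
  (absz (i0 - j0)%R + k`! < L)%N ->
  (forall i, window i -> window (i + d) -> rho (i + d) = rho i) -> False.
Proof.
move=> dk i0k hL hd.
wlog d0 : d dk hd / 0 < d.
  move=> hw; have [d0|d0|d0] := ltgtP 0 d; last by move: dk; rewrite -d0 normr0 ltxx.
    exact: hw d0.
  apply: (hw (- d)); rewrite ?normrN ?oppr_gt0 // => i wi wd.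
  by have := hd (i - d); rewrite subrK => ->.
have [q kE] : exists q : nat, (k`!)%:Z = q%:Z * d.
  have : (`|d| %| k`!)%N by apply: dvdn_fact; lia.
  by move=> /dvdnP[q ->]; exists q; rewrite PoszM gez0_abs // ltW.
have step (m : nat) : (m <= q)%N -> rho (i0 + m%:Z * d) = rho i0.
  elim: m => [|m IH] mq; first by rewrite mul0r addr0.
  have md : 0 <= m%:Z * d by rewrite mulr_ge0 // ltW.
  have mS : m.+1%:Z * d <= (k`!)%:Z by rewrite kE ler_pM2r.
  rewrite -IH; last exact: ltnW.
  have E : m.+1%:Z * d = m%:Z * d + d by rewrite -addn1 PoszD mulrDl mul1r.
  by rewrite E addrA hd // /window; rewrite E in mS; lia.
by apply: i0k; rewrite kE step.
Qed.

End Window.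

(* A homeomorphism without fixed points in ]v1, v2[ moving this interval off
   itself moves all matching copies of it off each other: otherwise rho would
   have a local period or a local reflection symmetry. *)
Lemma window_disjoint f j0 a b : tame f -> 0 <= a -> b <= 1 / 2 ->
  (forall v, hc R j0 + a < v < hc R j0 + b -> ~~ (hc R j0 + a < f v < hc R j0 + b)) ->
  exists L, forall g g' h h' x, supported a b g -> supported a b g' ->
    lambda rho (window_pat j0 L) g h -> lambda rho (window_pat j0 L) g' h' ->
    h x != x -> h' (f x) = f x.
Proof.
(* Below, y and v' differ by at most e + 1/2, and v' is within 1/2 of the left end of the half cell.
   In doubled units this bounds a translation from v' to y by 2e + 1 and the offset c - 2 j0 of a
   reflection by 2e + 3. *)
move=> [k [e [f1 f2]]] a0 b2 fV; pose K := (e + e).+3.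
have fact0 : (0 < K`!)%N by exact: fact_gt0.
have [i0 hi0] := not_periodic fact0.
have [L [kL KL i0L]] : exists L : nat,
    [/\ (k + 1 < L)%N, (K < L)%N & (absz (i0 - j0)%R + K`! < L)%N].
  by exists (k + K + (absz (i0 - j0)%R + K`!)).+2; move: (_ + K`!)%N => r; split; lia.
exists L => g g' h h' x sg sg' hh hh' hx; apply/eqP/negPn/negP => hfx.
have [s [d [v [xE vV hsd]]]] := lambda_moved a0 b2 sg hh hx.
have [s' [d' [v' [fxE v'V hsd']]]] := lambda_moved a0 b2 sg' hh' hfx.
have vj : 2 * hc R j0 = j0%:~R by rewrite /hc; lra.
have fvE : f (isom s d v) = isom s d (f v).
  apply: f1 => i hi; apply: hsd; rewrite /window.
  case/andP: vV => v1 v2.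
  have : `|(i - j0)%:~R| <= (k + 1)%:R :> R.
    rewrite intrB natrD; apply: le_trans (lerD hi (lexx _)).
    have -> : i%:~R - j0%:~R = (i%:~R - 2 * v) + (2 * v - j0%:~R) by ring.
    apply: le_trans (ler_normD _ _) _; rewrite lerD2l ler_norml -vj.
    by apply/andP; split; lra.
  rewrite -intr_norm pmulrn ler_int => hi'.
  by move: hi' kL; clear; lia.
rewrite xE {}fvE in fxE.
have := f2 v; move: fV => /(_ v vV); move: (f v) fxE => y fxE yV yv.
case/andP: vV => v1 v2; case/andP: v'V => v1' v2'.
have close : `|y - v'| <= e%:R + 1 / 2.
  have -> : y - v' = (y - v) + (v - v') by ring.
  apply: le_trans (ler_normD _ _) _; rewrite lerD // ler_norml.
  by apply/andP; split; lra.
have period c : y = v' + hc R c ->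
    (forall i, window j0 L i -> window j0 L (i + c) -> rho (i + c) = rho i) -> False.
  move=> yE; have [c0|c0] := eqVneq c 0.
    by move: yV; rewrite yE c0 /hc mul0r addr0 v1' v2'.
  apply: (@no_period j0 L c K i0) => //.
  rewrite normr_gt0 c0 /= -(ler_int R) intr_norm.
  move: close; rewrite yE addrAC subrr add0r /hc normrM [`|2^-1|]ger0_norm; last by lra.
  rewrite -(pmulrn) /K -addn3 !natrD; lra.
have reflection c : y = hc R c - v' ->
    (forall i, window j0 L i -> window j0 L (c - i) -> rho (c - i) = inv_letter (rho i)) -> False.
  move=> yE; apply: (@no_reflection j0 L c K) => //.
  rewrite -(ler_int R) intr_norm intrB intrM -[X in 2 * X]vj.
  have -> : c%:~R = 2 * (y + v') :> R by rewrite yE /hc; lra.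
  rewrite -(pmulrn) /K -addn3 !natrD.
  by move: close; rewrite !ler_norml => /andP[? ?]; apply/andP; split; lra.
(* Composing one matching isometry with the inverse of the other carries v' to y: a translation if
   both have the same orientation, a reflection otherwise. *)
move: fxE hsd hsd'; rewrite /isom /isomi /signed; case: s {xE}; case: s' => yE hsd hsd'.
- apply: (period (d' - d)) => [|i wi wi']; first by move: yE; clear; rewrite /hc intrB; lra.
  by rewrite -hsd // -(hsd' i wi); congr rho; clear; lia.
- apply: (reflection (d' - d)) => [|i wi wi']; first by move: yE; clear; rewrite /hc intrB; lra.
  by rewrite -hsd // -(hsd' i wi); congr rho; clear; lia.
- apply: (reflection (d - d')) => [|i wi wi']; first by move: yE; clear; rewrite /hc intrB; lra.
  by apply: (can_inj inv_letterK); rewrite inv_letterK -hsd // -(hsd' i wi); congr rho; clear; lia.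
apply: (period (d - d')) => [|i wi wi']; first by move: yE; clear; rewrite /hc intrB; lra.
by apply: (can_inj inv_letterK); rewrite -hsd // -(hsd' i wi); congr rho; clear; lia.
Qed.

Lemma commute_disjoint u w : (forall x, u x != x -> w x = x) -> commute u w.
Proof.
move=> uw; apply: homeo_ext => x; rewrite !homeoM.
have [ux|ux] := eqVneq (u x) x; last first.
  by rewrite (uw _ ux) uw //; apply: contra ux => /eqP /(@homeo_inj _ u) ->.
rewrite ux; have [->//|uwx] := eqVneq (u (w x)) (w x).
by have /(@homeo_inj _ w) wx := uw _ uwx; move: uwx; rewrite wx ux eqxx.
Qed.

End Locality.

(** * Simplicity *)

Section Simplicity.
Variable R : realType.
Implicit Types (f g h u w z : homeo R) (c : bool) (i j d : int) (t x y v : R).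
Variable c0 : homeo R.
Hypothesis c0_F : thompsonF R c0.
Hypothesis c0_supp : supp c0 = `]0, 1 / 4[%classic.
Hypothesis c0_gt : forall x : R, 0 < x < 1 / 4 -> x < c0 x.
Hypothesis c0_double : forall t : R, 0 < t < 1 / 16 -> c0 t = 2 * t.
Variables (nu2 nu3 : homeo R).
Hypothesis nu23_gen : gen [set nu2; nu3] = F_on `[1 / 16, 15 / 16]%classic.
Variable fI : nat * nat -> nat * nat -> homeo R.
Hypothesis fI_transfer : is_transfer fI.
Variables I J : nat * nat.
Hypothesis I_inner : inner R I.
Hypothesis J_inner : inner R J.
Hypothesis JI : sup (sd_itv R J) < inf (sd_itv R I).
Variable sigma : homeo R.
Hypothesis sigma_supp : supported (sd_aff R I 0) (sd_aff R I 1) sigma.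

Lemma Fc_nontrivial : exists2 f, Fc R f & f != 1%g.
Proof.
have [||f [df sf fx]] := @move_point R c0 c0_F c0_supp c0_gt (1 / 4) (1 / 2) (3 / 4); try lra.
exists f; first by apply: (Fc_of df _ _ sf); lra.
by apply: contra fx => /eqP ->.
Qed.

Lemma sd_lt : sd_aff R J 1 < sd_aff R I 0.
Proof.
move: JI; rewrite /sd_itv sup_itv ?inf_itv ?bnd_simp -?sd_aff0 -?sd_aff1 //;
  by rewrite ltW // homeo_ltE.
Qed.

Let f0 := fI I J.
Let eta := ((sigma^-1) ^ f0)%g.

Let f0_Fc : Fc R f0. Proof. exact: fI_Fc. Qed.
Let f00 : f0 (sd_aff R I 0) = sd_aff R J 0.
Proof. by rewrite /f0 fI_aff ?lexx ?ler01. Qed.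
Let f01 : f0 (sd_aff R I 1) = sd_aff R J 1.
Proof. by rewrite /f0 fI_aff ?lexx ?ler01. Qed.

Let eta_supp : supported (sd_aff R J 0) (sd_aff R J 1) eta.
Proof. by rewrite -f00 -f01; apply: supportedJ; exact: supportedV. Qed.

Lemma xiE : xi fI I J sigma = (sigma * eta)%g.
Proof.
have e : xi_fun fI I J sigma = (sigma * eta)%g.
  have [_ _ _ fV] := fI_transfer I_inner J_inner.
  apply/funext => x; rewrite /xi_fun; have -> : (sigma * eta)%g x = eta (sigma x) by [].
  have xI : (x \in sd_itv R I) = (sd_aff R I 0 <= x <= sd_aff R I 1).
    by apply/idP/idP => [/set_mem/sd_itvE|/sd_itvE/mem_set].
  have xJ : (x \in sd_itv R J) = (sd_aff R J 0 <= x <= sd_aff R J 1).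
    by apply/idP/idP => [/set_mem/sd_itvE|/sd_itvE/mem_set].
  have lt := sd_lt; rewrite xI xJ; case: ifPn => [xI'|xI'].
    rewrite eta_supp //; have /andP[h _] := supported_in sigma_supp xI'.
    by apply/negP => /andP[_]; lra.
  have -> : sigma x = x.
    by apply: sigma_supp; apply: contra xI' => /andP[? ?]; rewrite !ltW.
  case: ifPn => xJ'; first by rewrite /eta conjgE fV mulgA.
  by rewrite eta_supp //; apply: contra xJ' => /andP[? ?]; rewrite !ltW.
by apply: homeo_ext => x; rewrite homeo_ofE e //; exact: homeoP.
Qed.

Lemma xi_sub01 : supported 0 1 (xi fI I J sigma).
Proof.
have [i0 i1] := inner_aff I_inner; have [l0 l1] := inner_aff J_inner.
rewrite xiE; apply: supportedM; [apply: supportedS sigma_supp _ _|apply: supportedS eta_supp _ _];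
  exact: ltW.
Qed.

(* With u equal to f0 on J and to the identity on I, both sides are the product of
   sigma and of the inverse of the copy of sigma in J f0. *)
Lemma xi_relation : exists f u, [/\ Fc R f, Fc R u &
  (xi fI I J sigma * xi fI I J sigma ^ f = xi fI I J sigma ^ u)%g].
Proof.
have lt := sd_lt; have [l0 _] := inner_aff J_inner.
have J01 : sd_aff R J 0 < sd_aff R J 1 by rewrite homeo_ltE.
have lt' : f0 (sd_aff R J 1) < sd_aff R J 0 by rewrite -f00 homeo_ltE.
have [e [e' [e0 ee' e'1 sf]]] := Fc_supp f0_Fc.
(* The map s fixes everything from the left end of J on, and pushes the left end of the support of
   [f0] beyond f0(J). The conjugate v of f0^-1 by s therefore fixes f0(J), but still equals f0^-1 on
   f0(I) = J. *)
have [s [l [r [ds l0' r0 ss he]]]] := push c0_F c0_supp c0_gt e0 lt'.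
have Fs : Fc R s by apply: (Fc_of ds l0' _ ss); have [_ ?] := inner_aff J_inner; lra.
have {he} he : f0 (sd_aff R J 1) <= s e.
  case: he => // he; rewrite ss; last by apply/negP => /andP[_]; lra.
  by apply: le_trans he; exact: ltW.
have sfix x : sd_aff R J 0 <= x -> s x = x /\ (s^-1)%g x = x.
  move=> hx; have sx : s x = x by apply: ss; apply/negP => /andP[_]; lra.
  by split=> //; rewrite -{1}sx homeoK.
pose v := ((f0^-1) ^ s)%g; have Fv : Fc R v by apply: FcJ => //; exact: FcV.
have vs : supported (s e) (s e') v by apply: supportedJ; exact: supportedV.
pose u := (f0 * v)%g; exists f0, u; split=> //; first exact: FcM.
have uJ x : sd_aff R J 0 <= x <= sd_aff R J 1 -> u x = f0 x.
  move=> /andP[_ xJ]; rewrite homeoM vs //; apply/negP => /andP[h _].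
  have : f0 x <= f0 (sd_aff R J 1) by rewrite homeo_leE.
  lra.
have uI x : sd_aff R I 0 <= x <= sd_aff R I 1 -> u x = (1%g : homeo R) x.
  move=> /andP[xI _]; have hx : sd_aff R J 0 <= f0 x by rewrite -f00 homeo_leE.
  rewrite homeoM /v homeoJE (sfix _ hx).2 homeoK (sfix x _).1 //; lra.
rewrite xiE (conjMg sigma eta f0) (conjMg sigma eta u) (conj_agree sigma_supp uI) conjg1 (conj_agree eta_supp uJ).
by rewrite {1}/eta conjVg mulgA mulgVK.
Qed.

Variable rho : int -> letter.
Hypothesis hrho : labelling rho.

Let nu1s := nu1_sub01 c0_F c0_supp.
Let nus := nu2_Fc nu23_gen.

Definition Grp : set (homeo R) := G_rho_alpha (nu1 c0) nu2 nu3 (xi fI I J sigma) rho.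

Lemma Grp_subgroup : is_subgroup Grp. Proof. exact: gen_subgroup. Qed.

Lemma Grp_sub (A : set (homeo R)) : is_subgroup A ->
  (forall c f, [set nu1 c0; nu2; nu3; xi fI I J sigma] f -> A (Z rho c f)) -> Grp `<=` A.
Proof.
move=> gA hA; apply: gen_sub => // x [hx|[->|->]]; last 2 first.
- by apply: (hA true); right.
- by apply: (hA false); right.
have : G_rho (nu1 c0) nu2 nu3 rho `<=` A; last exact.
apply: gen_sub => // y [[[[[->|->]|->]|->]|->]|->].
- by apply: (hA true); left; left; left.
- by apply: (hA true); left; left; right.
- by apply: (hA true); left; right.
- by apply: (hA false); left; left; left.
- by apply: (hA false); left; left; right.
- by apply: (hA false); left; right.
Qed.

Lemma Grp_gen c f : [set nu1 c0; nu2; nu3; xi fI I J sigma] f -> Grp (Z rho c f).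
Proof.
have Gs (x : homeo R) : G_rho (nu1 c0) nu2 nu3 rho x -> Grp x by move=> hx; apply: sub_gen; left.
move=> [[[->|->]|->]|->].
- by apply: Gs; apply: sub_gen; case: c; [do 5 left|left; left; right].
- by apply: Gs; apply: sub_gen; case: c; [do 4 left; right|left; right].
- by apply: Gs; apply: sub_gen; case: c; [do 3 left; right|right].
- by apply: sub_gen; right; case: c; [left|right].
Qed.

Lemma Grp_fg : finitely_generated Grp.
Proof.
exists [seq Z rho c f | c <- [:: true; false], f <- [:: nu1 c0; nu2; nu3; xi fI I J sigma]].
apply/seteqP; split.
  apply: Grp_sub; first exact: gen_subgroup.
  move=> c f hf; apply: sub_gen; apply/allpairsP; exists (c, f); split=> //=.
    by case: c.
  by rewrite !inE; case: hf => [[[->|->]|->]|->]; rewrite eqxx ?orbT.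
apply: gen_sub; first exact: Grp_subgroup.
move=> _ /allpairsP[[c f] /= [_ hf ->]]; apply: Grp_gen.
by move: hf; rewrite !inE => /or4P[]/eqP->; [do 3 left|left; left; right|left; right|right].
Qed.

Lemma Grp_Fc c f : Fc R f -> Grp (Z rho c f).
Proof.
move=> Ff; have /subgroupP[G1 GM GV] := Grp_subgroup.
have H : gen [set nu1 c0; nu2; nu3] `<=` [set f | supported 0 1 f /\ Grp (Z rho c f)].
  apply: gen_sub.
    apply/subgroupP; split=> [|x y [sx Gx] [sy Gy]|x [sx Gx]].
    - by split; [exact: supported1|rewrite Z1].
    - by split; [exact: supportedM|rewrite ZM //; exact: GM].
    - by split; [exact: supportedV|rewrite ZV //; exact: GV].
  have [F2 F3] := nus.
  move=> x [[->|->]|->]; split => //; try exact: Fc_sub01; apply: Grp_gen.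
  - by do 3 left.
  - by left; left; right.
  - by left; right.
exact: (H _ (Fc_gen_nu c0_F c0_supp c0_gt c0_double nu23_gen Ff)).2.
Qed.

Lemma Grp_tame : Grp `<=` [set f | tame rho f].
Proof.
have [F2 F3] := nus.
apply: Grp_sub; first exact: tame_subgroup.
by move=> c f [[[->|->]|->]|->]; apply: Z_tame => //; try exact: Fc_sub01; exact: xi_sub01.
Qed.

(** The cells of the other family are centred at the endpoints of those of family c. Both [nu1 c0]
    and d are their own reflections, so all cells of a family carry the same copy. *)
Lemma Z_nu1 c : exists2 d, Fc R d & Z rho c (nu1 c0) = Z rho (~~ c) d.
Proof.
have [d [Fd fd dr dl]] := nu1_swap c0_F c0_supp; exists d => //.
have sd := Fc_sub01 Fd.
have nuc b j : isb (rho j) = b -> actc (Z rho b (nu1 c0)) j (nu1 c0).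
  by move=> jb; have := Z_actc hrho nu1s jb; rewrite flip_nu1 // if_same.
have dc b j : isb (rho j) = b -> actc (Z rho b d) j d.
  by move=> jb; have := Z_actc hrho sd jb; rewrite fd if_same.
apply: homeo_ext => x; have [j [t [t2 ->]]] := hc_decomp x.
have [jc|jc] := eqVneq (isb (rho j)) c.
  have /actc_half[_ hl] := nuc _ _ jc.
  have jc' : isb (rho (j + 1)) = ~~ c by rewrite (isb_next hrho) jc.
  have /actc_half[hr _] := dc _ _ jc'; rewrite addrK in hr.
  by rewrite hl // hr // dl //; lra.
have jc0 : isb (rho j) = ~~ c by move: jc; case: isb; case: c.
have jc' : isb (rho (j + 1)) = c by rewrite (isb_next hrho) jc0 negbK.
have /actc_half[hr _] := nuc _ _ jc'; rewrite addrK in hr.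
have /actc_half[_ hl] := dc _ _ jc0.
by rewrite hr // hl // dr //; lra.
Qed.

(** Let q be the first multiple of e = 2^-(n+1) beyond v1, in units of e. One of q, q + 1, q + 2
    starts a grid interval that touches no endpoint of its half cell, which consists of N = 2^n > 3
    such intervals; 4e < v2 - v1 leaves enough room. *)
Lemma interval_cell v1 v2 : v1 < v2 -> exists j (p n : nat),
  [/\ (0 < p)%N, (p.+1 < 2 ^ n)%N, v1 < hc R j + sd_aff R (p, n.+1) 0 &
      hc R j + sd_aff R (p, n.+1) 1 < v2].
Proof.
move=> v12; have d0 : 0 < (v2 - v1) / 4 by lra.
have [m mw] := pow2_small d0.
pose n := m.+2; pose e : R := (2 ^+ n.+1)^-1.
have e0 : 0 < e by rewrite invr_gt0 pow2_gt0.
have ew : e < (v2 - v1) / 4.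
  apply: le_lt_trans mw; rewrite lef_pV2 ?posrE ?pow2_gt0 //.
  by rewrite ler_eXn2l ?ltr1n // /n; lia.
pose q := Num.floor (v1 / e) + 1.
have := floor_itv (v1 / e); rewrite intrD -/q ler_pdivlMr // ltr_pdivrMr // => /andP[q1 q2].
have qE : (Num.floor (v1 / e))%:~R = q%:~R - 1 :> R by rewrite /q intrD addrK.
rewrite qE in q1 q2.
have N4 : (3 < 2 ^ n)%N by rewrite /n !expnS; have := expn_gt0 2 m; lia.
pose N : int := (2 ^ n)%N%:Z.
have [q' [j [r [q'q qjr r0 rN]]]] : exists (q' j r : int),
    [/\ q <= q' <= q + 2, q' = j * N + r, 0 < r & r + 1 < N].
  have N0 : N != 0 by rewrite /N; lia.
  have := divz_eq q N; have := modz_ge0 q N0; have := ltz_mod q N0.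
  rewrite gtr0_norm; last by rewrite /N; lia.
  move: (q %/ N)%Z (q %% N)%Z => k r rN r0 qE'.
  have NN : 3 < N by rewrite /N; lia.
  move: (N) (q) rN r0 qE' NN; clear => {}N {}q rN r0 qE' NN.
  have [r1|r1] := eqVneq r 0; first by exists (q + 1), k, 1; split; lia.
  have [r2|r2] := eqVneq r (N - 1).
    by exists (q + 2), (k + 1), 1; split; rewrite ?mulrDl; lia.
  by exists q, k, r; split; lia.
have [p rE] : exists p : nat, r = p by exists `|r|%N; lia.
have hE x : hc R j + sd_aff R (p, n.+1) x = (q'%:~R + x) * e.
  rewrite sd_affE /= -/e qjr rE /hc intrD intrM /N /= -pmulrn natrX.
  have -> : j%:~R / 2 = j%:~R * 2 ^+ n * e :> R.
    by rewrite /e exprS; field; rewrite gt_eqF // pow2_gt0.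
  by rewrite -pmulrn; ring.
exists j, p, n; split; rewrite ?hE.
- by lia.
- by rewrite /N in rN; lia.
- have : q%:~R <= q'%:~R :> R by rewrite ler_int; case/andP: q'q.
  by rewrite -(ler_pM2r e0); lra.
- have : q'%:~R <= q%:~R + 2 :> R by rewrite -[2]/(2%:~R) -intrD ler_int; case/andP: q'q.
  by rewrite -(ler_pM2r e0) mulrDl; lra.
Qed.

(** With m the midpoint of x and f x, the interval between f^-1 m and m is mapped onto the one
    between m and f m. *)
Lemma displaced_interval f : f != 1%g -> exists v1 v2, v1 < v2 /\
  forall v, v1 < v < v2 -> ~~ (v1 < f v < v2).
Proof.
move=> f1; have [x fx] : exists x, f x != x.
  apply: contrapT => h; move/eqP: f1; apply; apply: homeo_ext => x; apply/eqP.
  by apply/negPn/negP => fx; apply: h; exists x.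
have [xf|fx'|e] := ltgtP x (f x); last by rewrite -e eqxx in fx.
  exists ((f^-1)%g ((x + f x) / 2)), ((x + f x) / 2); split.
    by rewrite -(homeo_ltE f) homeoVK; apply: (@lt_trans _ _ (f x)); rewrite ?homeo_ltE; lra.
  move=> v /andP[v1 _]; apply/negP => /andP[_].
  by move: v1; rewrite -(homeo_ltE f) homeoVK; lra.
exists ((x + f x) / 2), ((f^-1)%g ((x + f x) / 2)); split.
  by rewrite -(homeo_ltE f) homeoVK; apply: (@lt_trans _ _ (f x)); rewrite ?homeo_ltE; lra.
move=> v /andP[_ v1]; apply/negP => /andP[+ _].
by move: v1; rewrite -(homeo_ltE f) homeoVK; lra.
Qed.

Hypothesis quasi : quasi_periodic rho.

Lemma normal_Fc N c f : normal_in N Grp -> N <> [set 1%g] -> Fc R f -> N (Z rho c f).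
Proof.
move=> nN N1; have [gN NG NJ] := nN; have /subgroupP[n1 NM NV] := gN.
have gG := Grp_subgroup.
have NRl (x y : homeo R) : N x -> Grp y -> N [~ x, y]%g.
  by move=> Nx Gy; rewrite commgEl; apply: NM; [exact: NV|exact: NJ].
have NRr (x y : homeo R) : Grp x -> N y -> N [~ x, y]%g.
  by move=> Gx Ny; rewrite -invgR; apply: NV; exact: NRl.
have [k Nk k1] : exists2 k, N k & k != 1%g.
  apply: contrapT => h; apply: N1; apply/seteqP; split=> [x Nx|_ ->] //.
  by apply/eqP/negPn/negP => x1; apply: h; exists x.
have [v1 [v2 [v12 kV]]] := displaced_interval k1.
have [j [p [n [p0 pn va vb]]]] := interval_cell v12.
set a := sd_aff R (p, n.+1) 0 in va; set b := sd_aff R (p, n.+1) 1 in vb.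
have a0 : 0 <= a by rewrite /a sd_aff0 divr_ge0 // ltW // pow2_gt0.
have b2 : b <= 1 / 2.
  rewrite /b sd_aff1 /= exprS invfM mulrCA -[X in _ <= X]mulrC ler_pM2l ?invr_gt0 //.
  by rewrite ler_pdivrMr ?pow2_gt0 // mul1r -natrX ler_nat ltnW.
have kV' v : hc R j + a < v < hc R j + b -> ~~ (hc R j + a < k v < hc R j + b).
  move=> /andP[h1 h2]; have : ~~ (v1 < k v < v2).
    by apply: kV; rewrite (lt_trans va h1) (lt_trans h2 vb).
  by apply: contra => /andP[h3 h4]; rewrite (lt_trans va h3) (lt_trans h4 vb).
have tk : tame rho k := Grp_tame (NG _ Nk).
have [L hL] := window_disjoint hrho quasi tk a0 b2 kV'.
have ZG f' c' : Fc R f' -> Grp (Z rho c' f') by exact: Grp_Fc.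
pose W := window_word rho j L.
have W0 : W != [::] by rewrite -size_eq0 size_block.
have GW : realizes rho p n Grp (window_pat rho j L).
  have := realizes_move fI_transfer hrho p0 pn (A := Grp) (W := W) (k := L.+1).
  rewrite (_ : 1 - L.+1%:Z = - L%:Z); last by lia.
  move=> <-; [|by move=> h f' c' Gh Ff'; exact: (subgroupJ gG Gh (ZG _ _ Ff'))|by rewrite size_block; lia].
  exact: (realizes_G c0_F c0_supp c0_gt fI_transfer hrho p0 pn gG ZG W0).
have NW : realizes rho p n N (window_pat rho j L ++ window_pat rho j L).
  apply: (realizes_commg c0_F c0_supp c0_gt fI_transfer p0 pn gN _ GW GW).
  move=> g g' h h' /FcK_supported sg /FcK_supported sg' Gh Gh' hh hh'.
  have dis x : h x != x -> h (k x) = k x by exact: (hL _ _ _ _ _ sg sg hh hh).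
  have dis' x : h x != x -> h' (k x) = k x by exact: (hL _ _ _ _ _ sg sg' hh hh').
  (* The points moved by (h^-1)^k are images under k of points moved by h, hence are fixed by h and
     by h'. So [h, h'] = [[h^-1, k], h'], which lies in N because k does. *)
  have comm z : (forall x, h x != x -> z (k x) = k x) -> commute ((h^-1) ^ k)%g z.
    move=> hz; rewrite conjVg; apply: commute_sym; apply: commuteV; apply: commute_sym.
    apply: commute_disjoint => x hx; rewrite -(homeoVK k x); apply: hz.
    by apply: contra hx => /eqP hx; rewrite homeoJE hx homeoVK.
  rewrite -(commg_absorb (comm _ dis) (comm _ dis')); apply: NRl => //.
  rewrite (_ : (h * h^-1 ^ k = [~ h^-1, k])%g); last by rewrite commgEl invgK.
  by apply: NRr => //; have /subgroupP[_ _] := gG; apply.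
have {NW} NW : realizes rho p n N (window_pat rho j L).
  by apply: realizes_eq NW => i; rewrite /fwd /bwd all_cat andbb.
have nNZ : Z_normalized rho N by move=> h f' c' Nh Ff'; apply: NJ => //; exact: ZG.
apply: (Z_in_N c0_F c0_supp c0_gt fI_transfer hrho p0 pn gG ZG nN quasi (m0 := j - L%:Z) (n0 := (L + L).+1)).
have := realizes_move fI_transfer hrho p0 pn (A := N) (W := W) (k := L.+1) nNZ.
by rewrite (_ : 1 - L.+1%:Z = - L%:Z); [move=> ->; [|rewrite size_block; lia]|lia].
Qed.

Lemma Grp_simple : simple_group Grp.
Proof.
split=> [G1|N nN].
  have [f Ff /eqP f1] := Fc_nontrivial; apply: f1.
  have : Grp (Z rho true f) by exact: Grp_Fc.
  rewrite G1 => /= Zf; apply: (Z_inj hrho (b := true)); [exact: Fc_sub01|exact: supported1|].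
  by rewrite (Z1 _ hrho); exact: Zf.
have [|N1] := pselect (N = [set 1%g]); [by left|right].
have [gN NG NJ] := nN; have /subgroupP[n1 NM NV] := gN.
apply/seteqP; split=> //; have NF c f := @normal_Fc N c f nN N1; have [F2 F3] := nus.
apply: Grp_sub => // c f [[[->|->]|->]|->]; try exact: NF.
  by have [d Fd ->] := Z_nu1 c; exact: NF.
have [f' [u [Ff Fu E]]] := xi_relation; set X := Z rho c (xi fI I J sigma).
have sf : supported 0 1 f' by exact: Fc_sub01.
have su : supported 0 1 u by exact: Fc_sub01.
have sx := xi_sub01.
have GX : Grp X by apply: Grp_gen; right.
have {}E : (X * X ^ Z rho c f' = X ^ Z rho c u)%g.
  by rewrite -!ZJ // -ZM ?E //; exact: supportedJ_in.
(* The relation X X^f = X^u reads X^f = [X, u], which is in N because u is. *)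
have XE : (X ^ Z rho c f' = [~ X, Z rho c u])%g by rewrite commgEl -E mulKg.
have Nu := NF c u Fu; have Nf := NF c f' Ff.
rewrite -(conjgK (Z rho c f') X) XE -invgR commgEl; apply: (NJ); last by apply: NG; exact: NV.
by apply: (NV); apply: NM; [exact: NV|exact: NJ].
Qed.

End Simplicity.

(** * The paperfolding labelling *)

(* The sign of i is decided by the class mod 4 of the
   odd part of i. It is odd under i |-> -i, whence the inverses of words. *)
Section Paperfolding.
Implicit Types (i t m D : int) (k K n : nat).

Definition fold_sign i : bool :=
  `[< i = 0 \/ exists k t, i = 2 ^+ k * (4 * t + 1) >].

Definition paperfolding i : letter :=
  if (i %% 2)%Z == 0 then (if fold_sign i then la else la_inv)
  else (if fold_sign i then lb else lb_inv).

Lemma odd_part i : i != 0 -> exists k t, i = 2 ^+ k * (4 * t + 1) \/ i = 2 ^+ k * (4 * t + 3).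
Proof.
have [n] := ubnP `|i|%N; elim: n i => // n IH i; rewrite ltnS => iN i0.
have [e|o] := eqVneq (i %% 2)%Z 0.
  have [||k [t h]] := IH (i %/ 2)%Z; try lia.
  exists k.+1, t; rewrite exprS -!mulrA; have iE : i = 2 * (i %/ 2)%Z by lia.
  by case: h => h; [left|right]; rewrite {1}iE h.
exists 0%N, (i %/ 4)%Z; rewrite expr0 !mul1r.
by have [e|e] := eqVneq (i %% 4)%Z 1; [left|right]; lia.
Qed.

Lemma odd_part_neq k k' t t' : 2 ^+ k * (4 * t + 1) <> 2 ^+ k' * (4 * t' + 3) :> int.
Proof.
wlog kk : k k' t t' / (k <= k')%N.
  move=> hw; case: (leqP k k') => [|/ltnW] kk; first exact: hw.
  move=> E; apply: (hw k' k (- t' - 1) (- t - 1) kk); apply: oppr_inj.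
  have e1 : - (4 * (- t' - 1) + 1) = 4 * t' + 3 by ring.
  have e2 : - (4 * (- t - 1) + 3) = 4 * t + 1 by ring.
  by rewrite -!mulrN e1 e2.
have [d ->] : exists d, k' = (k + d)%N by exists (k' - k)%N; rewrite subnKC.
rewrite exprD -mulrA => /mulfI h; have {h} : 4 * t + 1 = 2 ^+ d * (4 * t' + 3).
  by apply: h; rewrite expf_neq0.
by case: d => [|d]; rewrite ?expr0 ?exprS -?mulrA; [lia|move: (2 ^+ d * _) => x; lia].
Qed.

Lemma fold_sign1 k t : fold_sign (2 ^+ k * (4 * t + 1)).
Proof. by apply/asboolP; right; exists k, t. Qed.

Lemma fold_sign3 k t : fold_sign (2 ^+ k * (4 * t + 3)) = false.
Proof.
apply/asboolP => -[/eqP|[k' [t' /esym]]]; last exact: odd_part_neq.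
by rewrite mulf_eq0 expf_eq0 /= andbF /=; lia.
Qed.

Lemma fold_sign0 : fold_sign 0. Proof. by apply/asboolP; left. Qed.

Lemma fold_signN i : i != 0 -> fold_sign (- i) = ~~ fold_sign i.
Proof.
move=> /odd_part[k [t [->|->]]].
  have e : - (4 * t + 1) = 4 * (- t - 1) + 3 by ring.
  by rewrite fold_sign1 -mulrN e fold_sign3.
have e : - (4 * t + 3) = 4 * (- t - 1) + 1 by ring.
by rewrite fold_sign3 -mulrN e fold_sign1.
Qed.

(** The power of 2 in i is at most 2^K, so the translation changes the odd part by a multiple of
    4. *)
Lemma fold_sign_period K i t : i != 0 -> `|i| < 2 ^+ K -> fold_sign (i + 2 ^+ K * (4 * t)) = fold_sign i.
Proof.
move=> i0 iK; have [k [u hu]] := odd_part i0.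
have [v [iE v0]] : exists v : int, i = 2 ^+ k * v /\ v != 0.
  by case: hu => ->; [exists (4 * u + 1)|exists (4 * u + 3)]; split=> //; lia.
have kK : (k <= K)%N.
  have h : (2 : int) ^+ k < 2 ^+ K.
    apply: le_lt_trans iK; rewrite iE normrM ger0_norm ?exprn_ge0 //.
    by rewrite ler_peMr ?exprn_ge0 //; lia.
  by apply: ltnW; move: h; rewrite ltr_eXn2l.
have E : 2 ^+ K * (4 * t) = 2 ^+ k * (4 * (2 ^+ (K - k) * t)).
  by rewrite -{1}(subnKC kK) exprD; ring.
rewrite E; move: (2 ^+ (K - k) * t) => r; case: hu => ->.
  have e : 4 * u + 1 + 4 * r = 4 * (u + r) + 1 by ring.
  by rewrite -mulrDr e !fold_sign1.
have e : 4 * u + 3 + 4 * r = 4 * (u + r) + 3 by ring.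
by rewrite -mulrDr e !fold_sign3.
Qed.

Lemma paperfolding_labelling : labelling paperfolding.
Proof.
move=> n; rewrite /paperfolding (_ : ((2 * n) %% 2)%Z = 0); last by lia.
rewrite (_ : ((2 * n + 1) %% 2)%Z = 1); last by lia.
by split; case: ifP.
Qed.

(** The factor 4t + 1 takes care of i = 0, which has positive sign by convention and is sent to a
    number of positive sign. *)
Lemma paperfolding_shift K i t : `|i| < 2 ^+ K ->
  paperfolding (i + 2 ^+ K * (4 * (4 * t + 1))) = paperfolding i.
Proof.
move=> iK; rewrite /paperfolding.
have -> : ((i + 2 ^+ K * (4 * (4 * t + 1))) %% 2)%Z = (i %% 2)%Z.
  have -> : 2 ^+ K * (4 * (4 * t + 1)) = 2 * (2 ^+ K * (2 * (4 * t + 1))) by ring.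
  by move: (2 ^+ K * _) => r; lia.
have [->|i0] := eqVneq i 0; last by rewrite fold_sign_period.
have e : 2 ^+ K * (4 * (4 * t + 1)) = 2 ^+ K.+2 * (4 * t + 1) by rewrite !exprS; ring.
by rewrite add0r fold_sign0 e fold_sign1.
Qed.

(** The factor 3 makes the image of 0 negative, so that the label at 0 is inverted like all
    others. *)
Lemma paperfolding_reflect K i : `|i| < 2 ^+ K ->
  paperfolding (2 ^+ K * (4 * 3) - i) = inv_letter (paperfolding i).
Proof.
move=> iK; rewrite /paperfolding.
have -> : ((2 ^+ K * (4 * 3) - i) %% 2)%Z = (i %% 2)%Z by move: (2 ^+ K) => r; lia.
have -> : fold_sign (2 ^+ K * (4 * 3) - i) = ~~ fold_sign i.
  have [->|i0] := eqVneq i 0; last first.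
    by rewrite addrC fold_sign_period ?normrN ?oppr_eq0 // fold_signN.
  have e : (2 : int) ^+ K * (4 * 3) = 2 ^+ K.+2 * (4 * 0 + 3) by rewrite !exprS; ring.
  by rewrite subr0 fold_sign0 e fold_sign3.
by case: ifP; case: fold_sign.
Qed.

Lemma infix_block rho m n m' n' : m' <= m -> m + n%:Z <= m' + n'%:Z ->
  infix (block_word rho m n) (block_word rho m' n').
Proof.
move=> h1 h2; pose d := absz (m - m')%R; pose e := (n' - (d + n))%N.
have E : n'.+1 = (d + (n.+1 + e))%N by rewrite /e /d; lia.
apply/infixP; exists (mkseq (fun r : nat => rho (m' + r%:Z)) d).
exists (mkseq (fun r : nat => rho (m + n.+1%:Z + r%:Z)) e).
have mE : m = m' + d%:Z by rewrite /d; lia.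
rewrite /block_word /mkseq E !iotaD !map_cat !add0n; congr (_ ++ _); congr (_ ++ _).
  rewrite -{1}[d]addn0 iotaDl -map_comp; apply: eq_map => r /=; congr rho.
  by rewrite mE; lia.
rewrite -{1}[(d + n.+1)%N]addn0 iotaDl -map_comp; apply: eq_map => r /=; congr rho.
by rewrite mE; lia.
Qed.

Lemma block_bound m n : exists K, forall i, m <= i <= m + n%:Z -> `|i| < 2 ^+ K.
Proof.
exists (absz m + n)%N => i hi; have : `|i| <= (absz m + n)%N%:Z by lia.
move=> /le_lt_trans; apply; rewrite -natrX; have := ltn_expl (absz m + n) (isT : 1 < 2)%N.
by rewrite natz ltz_nat.
Qed.

Lemma paperfolding_quasi_periodic : quasi_periodic paperfolding.
Proof.
split=> m n; have [K hK] := block_bound m n.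
  (* The copies given by [paperfolding_shift] for consecutive t are 16 times 2^K apart. *)
  pose D : nat := (2 ^ K * 16)%N; exists (D + n).+1 => m' n' hn.
  have D0 : (0 < D)%N by rewrite muln_gt0 expn_gt0.
  have DE : D%:Z = 2 ^+ K * 16 by rewrite /D PoszM -natrX natz.
  pose b := m + 2 ^+ K * 4; pose t := ((m' - b) %/ D%:Z)%Z + 1.
  have tE : m + 2 ^+ K * (4 * (4 * t + 1)) = b + t * D%:Z by rewrite /b DE; ring.
  have hD : m' <= b + t * D%:Z <= m' + D%:Z.
    have Dn0 : D%:Z != 0 by lia.
    have := divz_eq (m' - b) D%:Z; have := modz_ge0 (m' - b) Dn0.
    have := ltz_mod (m' - b) Dn0; rewrite /t mulrDl mul1r.
    by move: ((_ %/ _)%Z * _) (_ %% _)%Z => u v; lia.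
  have -> : block_word paperfolding m n = block_word paperfolding (b + t * D%:Z) n.
    apply: (@eq_from_nth _ la) => [|i]; rewrite !size_block // ltnS => iN.
    rewrite /block_word !nth_mkseq // -tE addrAC paperfolding_shift //.
    by apply: hK; lia.
  by apply: infix_block; lia.
exists (2 ^+ K * (4 * 3) - (m + n%:Z)), n.
apply: (@eq_from_nth _ la) => [|i].
  by rewrite size_block /inv_word size_rev size_map size_block.
rewrite size_block ltnS => iN; rewrite /inv_word nth_rev; last by rewrite size_map size_block.
rewrite size_map size_block (nth_map la); last by rewrite size_block; lia.
rewrite /block_word !nth_mkseq; try lia.
rewrite -(paperfolding_reflect (K := K)); last by apply: hK; lia.
by congr paperfolding; lia.
Qed.

End Paperfolding.

(** * Counting isomorphism types *)

Section Embeddings.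
Implicit Types G H K : groupType.

Definition embeds G H (A : set G) (B : set H) : Prop := exists phi : G -> H,
  [/\ forall x, A x -> B (phi x), forall x y, A x -> A y -> phi x = phi y -> x = y &
      forall x y, A x -> A y -> phi (x * y)%g = (phi x * phi y)%g].

Lemma isog_embeds G H (A : set G) (B : set H) : group_isog A B -> embeds A B.
Proof.
move=> [phi [hf hi hs] hm]; exists phi; split=> // x y Ax Ay; apply: hi; exact/mem_set.
Qed.

Lemma isog_refl G (A : set G) : group_isog A A.
Proof. by exists id => //; split=> // y Ay; exists y. Qed.

Lemma isog_sym G H (A : set G) (B : set H) : is_subgroup A -> group_isog A B -> group_isog B A.
Proof.
move=> /subgroupP[_ AM _] [phi [hf hi hs] hm].
have hinj x y : A x -> A y -> phi x = phi y -> x = y.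
  by move=> Ax Ay; apply: hi; exact/mem_set.
pose psi y := xget 1%g [set x | A x /\ phi x = y].
have psiP y : B y -> A (psi y) /\ phi (psi y) = y.
  by move=> /hs[x Ax xy]; apply: (@xgetPex _ 1%g [set x | A x /\ phi x = y]); exists x.
exists psi; first split.
- by move=> y /psiP[].
- move=> x y /set_mem /psiP[_ xE] /set_mem /psiP[_ yE] e; by rewrite -xE -yE e.
- move=> x Ax; exists (phi x); first exact: hf.
  by have [Ap pE] := psiP _ (hf x Ax); exact: hinj.
move=> x y /psiP[Ax xE] /psiP[Ay yE]; have Axy := AM _ _ Ax Ay.
have : B (x * y)%g by rewrite -xE -yE -hm //; exact: hf.
by move=> /psiP[Ap pE]; apply: hinj => //; rewrite pE hm // xE yE.
Qed.

Lemma countable_gen G (X : set G) : countable X -> countable (gen X).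
Proof.
move=> /countable_injP[f finj]; pose e n := xget 1%g [set x | X x /\ f x = n].
have eP x : X x -> e (f x) = x.
  move=> Xx; have [Xe fe] : [set x' | X x' /\ f x' = f x] (e (f x)).
    by apply: xgetPex; exists x.
  by apply: finj => //; exact: mem_set.
pose ev := foldr (fun (c : bool * nat) u => ((if c.1 then e c.2 else (e c.2)^-1) * u)%g) 1%g.
have evM s t : ev (s ++ t) = (ev s * ev t)%g.
  by elim: s => [|c s IH] /=; rewrite ?mul1g // IH mulgA.
have evV s : exists t, ev t = ((ev s)^-1)%g.
  elim: s => [|c s [t tE]]; first by exists [::]; rewrite /= invg1.
  exists (t ++ [:: (~~ c.1, c.2)]); rewrite evM tE /= mulg1 invgM; congr (_ * _)%g.
  by case: c.1 => //=; rewrite invgK.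
apply: (@sub_countable _ _ _ (range ev)); last first.
  apply: (@sub_countable _ _ _ [set: seq (bool * nat)]); [exact: card_image_le|exact: countableP].
apply: subset_card_le; apply: gen_sub.
  apply/subgroupP; split.
  - by exists [::].
  - by move=> _ _ [s _ <-] [t _ <-]; exists (s ++ t); rewrite ?evM.
  - by move=> _ [s _ <-]; have [t tE] := evV s; exists t.
by move=> x Xx; exists [:: (true, f x)] => //=; rewrite mulg1 eP.
Qed.

End Embeddings.

(** * Rigidity of marked groups *)

Section Rigidity.
Variable R : realType.
Implicit Types (e f g h u w : homeo R).
Variable c0 : homeo R.
Hypothesis c0_F : thompsonF R c0.
Hypothesis c0_supp : supp c0 = `]0, 1 / 4[%classic.
Hypothesis c0_gt : forall x : R, 0 < x < 1 / 4 -> x < c0 x.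
Hypothesis c0_double : forall t : R, 0 < t < 1 / 16 -> c0 t = 2 * t.
Variables (nu2 nu3 : homeo R).
Hypothesis nu23_gen : gen [set nu2; nu3] = F_on `[1 / 16, 15 / 16]%classic.

(* A homeomorphism of [0, 1] is determined by the commutation relations between
   Fc and its conjugate. *)
Lemma commute_determines e e' : supported 0 1 e -> supported 0 1 e' ->
  (forall g h, Fc R g -> Fc R h -> commute h (g ^ e')%g -> commute h (g ^ e)%g) -> e = e'.
Proof.
move=> se se' hc; apply: homeo_ext => p; apply/eqP/negPn/negP => pe.
have p01 : 0 < p < 1 by apply: contraNT pe => p01; rewrite se ?se'.
case/andP: p01 => p0 p1.
(* A neighbourhood of p with disjoint images under e and e', separated by the midpoint [m] of e p
   and e' p. *)
have [a [b [/andP[a0 ap] /andP[pb b1] disj]]] : exists a b,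
    [/\ 0 < a < p, p < b < 1 & (e b <= e' a) \/ (e' b <= e a)].
  pose m := (e p + e' p) / 2.
  have lo (x : R) : x < p -> exists a, 0 < a < p /\ x <= a.
    move=> xp; exists (Num.max x (p / 2)); rewrite le_max lexx; split=> //.
    by rewrite lt_max gt_max xp; apply/andP; split; [apply/orP; right|]; lra.
  have hi (x : R) : p < x -> exists b, p < b < 1 /\ b <= x.
    move=> px; exists (Num.min x ((p + 1) / 2)); rewrite ge_min lexx; split=> //.
    by rewrite lt_min gt_min px; apply/andP; split; [|apply/orP; right]; lra.
  have [pp|pp|pp] := ltgtP (e p) (e' p); last by rewrite pp eqxx in pe.
    have [a [ha am]] : exists a, 0 < a < p /\ (e'^-1)%g m <= a.
      by apply: lo; rewrite -(homeo_ltE e') homeoVK /m; lra.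
    have [b [hb bm]] : exists b, p < b < 1 /\ b <= (e^-1)%g m.
      by apply: hi; rewrite -(homeo_ltE e) homeoVK /m; lra.
    exists a, b; split=> //; left; apply: (@le_trans _ _ m).
      by rewrite -(homeoVK e m) homeo_leE.
    by rewrite -{1}(homeoVK e' m) homeo_leE.
  have [a [ha am]] : exists a, 0 < a < p /\ (e^-1)%g m <= a.
    by apply: lo; rewrite -(homeo_ltE e) homeoVK /m; lra.
  have [b [hb bm]] : exists b, p < b < 1 /\ b <= (e'^-1)%g m.
    by apply: hi; rewrite -(homeo_ltE e') homeoVK /m; lra.
  exists a, b; split=> //; right; apply: (@le_trans _ _ m).
    by rewrite -(homeoVK e' m) homeo_leE.
  by rewrite -{1}(homeoVK e m) homeo_leE.
have [g [dg sg gp]] := move_point c0_F c0_supp c0_gt ap pb.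
have Fg : Fc R g := Fc_of dg a0 b1 sg.
have e00 : e 0 = 0 by apply: se; rewrite ltxx.
have e11 : e 1 = 1 by apply: se; rewrite ltxx andbF.
have ea0 : 0 < e a by rewrite -[X in X < _]e00 homeo_ltE.
have eb1 : e b < 1 by rewrite -[X in _ < X]e11 homeo_ltE.
pose k := (g ^ e)%g; have sk : supported (e a) (e b) k by exact: supportedJ.
pose q := e p; pose r := k q.
have qab : e a < q < e b by rewrite !homeo_ltE ap pb.
have rab : e a < r < e b by rewrite /r (supported_itv _ sk).
have rE : r = e (g p) by rewrite /r /k homeoJ.
have rq : r != q by rewrite rE /q; apply: contra gp => /eqP/(@homeo_inj _ e)->.
(* As h fixes q but moves its image r under g^e, it does not commute with g^e; it commutes with
   g^e', whose support is disjoint from its own. *)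
have [h [dh sh hr hq]] : exists h, [/\ dpl h, supported (e a) (e b) h, h r != r & h q = q].
  case/andP: qab => q1 q2; case/andP: rab => r1 r2.
  have [qr|rq'|qr] := ltgtP q r; last by rewrite qr eqxx in rq.
    have [h [dh sh hr]] := move_point c0_F c0_supp c0_gt qr r2.
    exists h; split=> //; first by apply: supportedS sh _ _ => //; exact: ltW.
    by apply: sh; rewrite ltxx.
  have [h [dh sh hr]] := move_point c0_F c0_supp c0_gt r1 rq'.
  exists h; split=> //; first by apply: supportedS sh _ _ => //; exact: ltW.
  by apply: sh; rewrite ltxx andbF.
have Fh : Fc R h := Fc_of dh ea0 eb1 sh.
have sg' : supported (e' a) (e' b) (g ^ e')%g by exact: supportedJ.
have : commute h (g ^ e)%g.
  apply: hc => //; case: disj => d.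
    exact: supported_comm (supportedS sh (lexx _) d) sg'.
  by apply/commute_sym; exact: supported_comm (supportedS sg' (lexx _) d) sh.
move=> hk; have := congr1 (fun f : homeo R => f q) hk.
rewrite !homeoM hq -/k -/r => /esym/eqP; exact/negP.
Qed.

(** To be the identity for the groups Gamma_alpha, and [Z rho true] for the groups G_rho_alpha. *)
Variable z : homeo R -> homeo R.
Hypothesis zM : forall f g, supported 0 1 f -> supported 0 1 g -> z (f * g)%g = (z f * z g)%g.
Hypothesis z_inj : forall f g, supported 0 1 f -> supported 0 1 g -> z f = z g -> f = g.

Let z1 : z 1%g = 1%g.
Proof.
by apply: (mulgI (z 1%g)); rewrite -zM ?mulg1 //; exact: supported1.
Qed.
Let zV f : supported 0 1 f -> z (f^-1)%g = ((z f)^-1)%g.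
Proof.
move=> sf; apply: (mulgI (z f)); rewrite -zM ?mulgV //; exact: supportedV.
Qed.

(** The two homomorphisms agree on the image of [Fc], which the marked elements generate.
    Commutation of h with g^e' passes through phi', and comes back through the injective phi as
    commutation of h with g^e. *)
Lemma marking_determines (A A' : set (homeo R)) (phi phi' : homeo R -> homeo R) e e' :
  is_subgroup A -> is_subgroup A' -> supported 0 1 e -> supported 0 1 e' ->
  (forall f, [set nu1 c0; nu2; nu3] f -> A (z f) /\ A' (z f)) -> A (z e) -> A' (z e') ->
  (forall x y, A x -> A y -> phi x = phi y -> x = y) ->
  (forall x y, A x -> A y -> phi (x * y)%g = (phi x * phi y)%g) ->
  (forall x y, A' x -> A' y -> phi' (x * y)%g = (phi' x * phi' y)%g) ->
  (forall f, [set nu1 c0; nu2; nu3] f -> phi (z f) = phi' (z f)) -> phi (z e) = phi' (z e') ->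
  e = e'.
Proof.
move=> /subgroupP[A1 AM AV] /subgroupP[A'1 A'M A'V] se se' Anu Ae Ae' inj hM hM' enu ee.
have h1 : phi 1%g = 1%g by apply: (mulgI (phi 1%g)); rewrite -hM ?mulg1.
have h1' : phi' 1%g = 1%g by apply: (mulgI (phi' 1%g)); rewrite -hM' ?mulg1.
have hV x : A x -> phi (x^-1)%g = ((phi x)^-1)%g.
  by move=> Ax; apply: (mulgI (phi x)); rewrite -hM ?mulgV //; exact: AV.
have hV' x : A' x -> phi' (x^-1)%g = ((phi' x)^-1)%g.
  by move=> Ax; apply: (mulgI (phi' x)); rewrite -hM' ?mulgV //; exact: A'V.
have agree : Fc R `<=` [set f | [/\ supported 0 1 f, A (z f), A' (z f) & phi (z f) = phi' (z f)]].
  apply: subset_trans (Fc_gen_nu c0_F c0_supp c0_gt c0_double nu23_gen) _; apply: gen_sub.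
    apply/subgroupP; split=> [|f g [sf Af Af' ef] [sg Ag Ag' eg]|f [sf Af Af' ef]] /=.
    - by split; rewrite ?z1 ?h1 ?h1' //; exact: supported1.
    - split; rewrite ?zM //; [exact: supportedM|exact: AM|exact: A'M|].
      by rewrite hM // hM' // ef eg.
    - split; rewrite ?zV //; [exact: supportedV|exact: AV|exact: A'V|].
      by rewrite hV // hV' // ef.
  move=> f hf; have [Af Af'] := Anu f hf; split=> //; last exact: enu.
  have [F2 F3] := nu2_Fc nu23_gen.
  by case: hf => [[->|->]|->]; [exact: nu1_sub01|exact: Fc_sub01|exact: Fc_sub01].
apply: commute_determines => // g h Fg Fh hc.
have [sg Ag Ag' eg] := agree g Fg; have [sh Ah Ah' eh] := agree h Fh.
have zJ f u : supported 0 1 f -> supported 0 1 u -> z (f ^ u)%g = (z f ^ z u)%g.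
  move=> sf su; have sV := supportedV su.
  by rewrite !conjgE zM ?zM ?zV //; exact: supportedM.
have phiJ x y : A x -> A y -> A (x ^ y)%g /\ phi (x ^ y)%g = (phi x ^ phi y)%g.
  move=> Ax Ay; have [Vy xy] := (AV _ Ay, AM _ _ Ax Ay); rewrite !conjgE.
  by split; [exact: AM|rewrite hM // hV // hM].
have phiJ' x y : A' x -> A' y -> A' (x ^ y)%g /\ phi' (x ^ y)%g = (phi' x ^ phi' y)%g.
  move=> Ax Ay; have [Vy xy] := (A'V _ Ay, A'M _ _ Ax Ay); rewrite !conjgE.
  by split; [exact: A'M|rewrite hM' // hV' // hM'].
have [AJ pJ] := phiJ _ _ Ag Ae; have [AJ' pJ'] := phiJ' _ _ Ag' Ae'.
have sJ := supportedJ_in sg se; have sJ' := supportedJ_in sg se'.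
have hc' : (z h * z g ^ z e' = z g ^ z e' * z h)%g by rewrite -zJ // -!zM // hc.
have : (z h * z g ^ z e = z g ^ z e * z h)%g.
  apply: inj; [exact: AM|exact: AM|rewrite (hM (z h)) // (hM (z g ^ z e)%g) // pJ eg eh ee -pJ' -(hM' (z h)) // -(hM' (z g ^ z e')%g) //].
  by rewrite hc'.
by rewrite -zJ // -!zM // => /z_inj; apply; exact: supportedM.
Qed.

(** The values of an embedding into C on the four marked elements form a point of a countable set,
    and this point determines e. *)
Lemma countable_markings (T : Type) (B : set T) (A : T -> set (homeo R)) (e : T -> homeo R)
    (C : set (homeo R)) : countable C ->
  (forall b, B b -> [/\ is_subgroup (A b), supported 0 1 (e b), A b (z (e b)),
     (forall f, [set nu1 c0; nu2; nu3] f -> A b (z f)) & embeds (A b) C]) ->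
  countable (e @` B).
Proof.
move=> cC hB.
have [phi phiP] : {phi : T -> homeo R -> homeo R & forall b, B b ->
    [/\ forall x, A b x -> C (phi b x), forall x y, A b x -> A b y -> phi b x = phi b y -> x = y &
      forall x y, A b x -> A b y -> phi b (x * y)%g = (phi b x * phi b y)%g]}.
  apply: (@choice _ _ (fun b (phi : homeo R -> homeo R) => B b -> [/\ forall x, A b x -> C (phi x),
    forall x y, A b x -> A b y -> phi x = phi y -> x = y &
      forall x y, A b x -> A b y -> phi (x * y)%g = (phi x * phi y)%g])).
  move=> b; have [Bb|nB] := pselect (B b); last by exists id => /nB.
  by have [_ _ _ _ [f hf]] := hB b Bb; exists f.
pose t b := (phi b (z (nu1 c0)), phi b (z nu2), (phi b (z nu3), phi b (z (e b)))).
have tC : countable (t @` B).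
  apply: (@sub_countable _ _ _ ((C `*` C) `*` (C `*` C))).
    apply: subset_card_le => _ [b Bb <-]; have [p1 _ _] := phiP b Bb.
    have [_ _ Ae Anu _] := hB b Bb.
    split=> /=; split=> /=; apply: p1 => //; apply: Anu.
    - by left; left.
    - by left; right.
    - by right.
  by apply: countableX; exact: countableX.
have et b b' : B b -> B b' -> t b = t b' -> e b = e b'.
  move=> Bb Bb' [t1 t2 t3 t4]; have [p1 p2 p3] := phiP b Bb; have [p1' p2' p3'] := phiP b' Bb'.
  have [gA sb Ae Anu _] := hB b Bb; have [gA' sb' Ae' Anu' _] := hB b' Bb'.
  apply: (@marking_determines (A b) (A b') (phi b) (phi b')) => //.
    by move=> f hf; split; [exact: Anu|exact: Anu'].
  by move=> f [[->|->]|->].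
have /countable_injP[f finj] := tC; apply/countable_injP.
have [[b0 Bb0]|nB] := pselect (exists b, B b); last first.
  exists (fun _ => 0%N) => x y /set_mem[b Bb]; by case: nB; exists b.
have [s sP] : {s : homeo R -> T & forall x, (e @` B) x -> B (s x) /\ e (s x) = x}.
  apply: (@choice _ _ (fun x b => (e @` B) x -> B b /\ e b = x)) => x.
  by have [[b Bb <-]|h] := pselect ((e @` B) x); [exists b|exists b0 => /h].
exists (fun x => f (t (s x))) => x y /set_mem/sP[Bx xE] /set_mem/sP[By yE] h.
rewrite -xE -yE; apply: et => //; apply: finj h; apply/mem_set.
  by exists (s x).
by exists (s y).
Qed.

End Rigidity.

(** * Cardinality of the continuum *)

Section Continuum.
Variable R : realType.

(** Digits 0 and 2 in base 3, which make expansions unique: the limits form the Cantor set. *)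
Definition triadic_sum (b : nat -> bool) (n : nat) : R :=
  \sum_(i < n) (b i)%:R * (2 / 3 ^+ i.+1).

Lemma triadic_sumS b n : triadic_sum b n.+1 = triadic_sum b n + (b n)%:R * (2 / 3 ^+ n.+1).
Proof. by rewrite /triadic_sum big_ord_recr. Qed.

Lemma triadic_sum_bound b n d :
  triadic_sum b n <= triadic_sum b (n + d) <= triadic_sum b n + ((3 ^+ n)^-1 - (3 ^+ (n + d))^-1).
Proof.
elim: d => [|d /andP[IH1 IH2]]; first by rewrite addn0 subrr addr0 lexx.
have p0 : 0 < (3 ^+ (n + d).+1)^-1 :> R by rewrite invr_gt0 exprn_gt0.
have e : (3 ^+ (n + d))^-1 = 3 * (3 ^+ (n + d).+1)^-1 :> R.
  by rewrite exprS invfM mulrA divff ?mul1r // pnatr_eq0.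
rewrite addnS triadic_sumS; move: IH2; rewrite e.
by case: (b _) => /=; rewrite ?mul1r ?mul0r => IH2; apply/andP; split; lra.
Qed.

Definition cantor_real (b : nat -> bool) : R := sup (range (triadic_sum b)).

Lemma cantor_real_bound b n :
  triadic_sum b n <= cantor_real b <= triadic_sum b n + (3 ^+ n)^-1.
Proof.
have ub m : triadic_sum b m <= triadic_sum b n + (3 ^+ n)^-1.
  have [nm|mn] := leqP n m.
    have /andP[_] := triadic_sum_bound b n (m - n); rewrite subnKC // => h.
    have : 0 < (3 ^+ m)^-1 :> R by rewrite invr_gt0 exprn_gt0.
    lra.
  have /andP[h _] := triadic_sum_bound b m (n - m); rewrite subnKC 1?ltnW // in h.
  have : 0 < (3 ^+ n)^-1 :> R by rewrite invr_gt0 exprn_gt0.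
  lra.
apply/andP; split.
  apply: ub_le_sup; last by exists n.
  by exists (triadic_sum b n + (3 ^+ n)^-1) => _ [m _ <-].
by apply: ge_sup; [exists (triadic_sum b n); exists n|move=> _ [m _ <-]].
Qed.

(** At the first differing digit n the partial sums differ by 2/3^(n+1), more than the bound
    1/3^(n+1) on the remaining digits. *)
Lemma cantor_real_inj : injective cantor_real.
Proof.
move=> b b' bb'; apply: contrapT => nbb'.
have ex : exists n, b n != b' n.
  apply: contrapT => h; apply: nbb'; apply/funext => n; apply/eqP/negPn/negP => bn.
  by apply: h; exists n.
case: (ex_minnP ex) => n bn nmin.
have S : triadic_sum b n = triadic_sum b' n.
  apply: eq_bigr => i _; have [//|h] := eqVneq (b i) (b' i); first by move=> ->.
  by have := nmin _ h; have := ltn_ord i; lia.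
have p0 : 0 < (3 ^+ n.+1)^-1 :> R by rewrite invr_gt0 exprn_gt0.
have /andP[l1 u1] := cantor_real_bound b n.+1; have /andP[l2 u2] := cantor_real_bound b' n.+1.
move: bn l1 u1 l2 u2; rewrite bb' !triadic_sumS S.
by case: (b n); case: (b' n) => //= _; rewrite ?mul1r ?mul0r => *; lra.
Qed.

Lemma cantor_real01 b : 0 <= cantor_real b <= 1.
Proof.
have := cantor_real_bound b 0; rewrite /triadic_sum big_ord0 expr0 invr1 add0r.
by [].
Qed.

(** A real is coded by its lower Dedekind cut. *)
Lemma real_to_cantor : exists f : R -> nat -> bool, injective f.
Proof.
pose f (x : R) (n : nat) : bool := if unpickle n is Some q then ratr (q : rat) < x else false.
have h (x y : R) : x < y -> f x <> f y.
  move=> xy e; have [q] := rat_in_itvoo xy; rewrite in_itv /= => /andP[xq qy].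
  have := congr1 (fun g => g (pickle q)) e; rewrite /f pickleK qy.
  by rewrite (lt_gtF xq).
exists f => x y e; have [xy|yx|//] := ltgtP x y.
  by case: (h _ _ xy).
by case: (h _ _ yx).
Qed.

(* Konig's diagonal argument, applied to the partition of the sequences of
   elements of the Cantor set by their index in the fibre of q. *)
Lemma countable_fibers_section (Q : Type) (q : (nat -> bool) -> Q) :
  (forall c, countable [set b | q b = c]) ->
  exists s : (nat -> bool) -> (nat -> bool), injective (q \o s).
Proof.
move=> qc.
have [F hF] : {F : Q -> (nat -> bool) -> nat & forall c, {in [set b | q b = c] &, injective (F c)}}.
  by apply: (@choice _ _ (fun c (f : (nat -> bool) -> nat) => {in [set b | q b = c] &, injective f})) => c;
    have /countable_injP := qc c.
pose idx b := F (q b) b.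
have idx_inj b b' : q b = q b' -> idx b = idx b' -> b = b'.
  by move=> e; rewrite /idx e => h; apply: (hF (q b')) h; exact/mem_set.
pose enc (x : nat -> nat -> bool) m := if unpickle m is Some ik then x ik.1 ik.2 else false.
have enc_inj : injective enc.
  move=> x y e; apply/funext => i; apply/funext => k.
  by have := congr1 (fun f => f (pickle (i, k))) e; rewrite /enc pickleK.
(* Otherwise every n misses some value [v n] as n-th coordinate of the arrays of index n; the array
   v, at its own index, contradicts this. Arrays of the same index n with distinct n-th coordinates
   then lie in distinct classes. *)
have [n hn] : exists n, forall v, exists x, idx (enc x) = n /\ x n = v.
  apply: contrapT => h.
  have [v hv] : {v : nat -> nat -> bool & forall n x, idx (enc x) = n -> x n <> v n}.
    apply: (@choice _ _ (fun n v => forall x, idx (enc x) = n -> x n <> v)) => n.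
    apply: contrapT => hn; apply: h; exists n => v; apply: contrapT => hv.
    by apply: hn; exists v => x xn xv; apply: hv; exists x.
  exact: (hv _ v erefl erefl).
have [s hs] := choice hn.
exists (enc \o s) => v v' /= e.
have [iv sv] := hs v; have [iv' sv'] := hs v'.
by rewrite -sv -sv'; congr (_ n); apply: enc_inj; apply: idx_inj => //; rewrite iv iv'.
Qed.

Lemma continuum_classes (Q : Type) (B : set R) (q : R -> Q) :
  countable (`]0, 1[%classic `\` B) -> (forall x, B x -> countable [set y | B y /\ q y = q x]) ->
  exists s : (nat -> bool) -> R, (forall b, B (s b)) /\ injective (q \o s).
Proof.
move=> cB qc; pose j b := (cantor_real b + 1) / 3.
have j_inj : injective j by move=> b b' h; apply: cantor_real_inj; rewrite /j in h; lra.
have j01 b : `]0, 1[%classic (j b).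
  by have := cantor_real01 b; rewrite /j /= in_itv /= => /andP[? ?]; apply/andP; split; lra.
(* All parameters outside B form one additional class, countable by hypothesis. *)
pose q' b := if pselect (B (j b)) then Some (q (j b)) else None.
have pull (A : set R) (A' : set (nat -> bool)) : (forall b, A' b -> A (j b)) -> countable A -> countable A'.
  move=> AA' /countable_injP[f hf]; apply/countable_injP; exists (f \o j).
  move=> b b' /set_mem Ab /set_mem Ab' h; apply: j_inj; apply: hf h; apply/mem_set; exact: AA'.
have [|s hs] := @countable_fibers_section _ q'.
  case=> [c|]; last first.
    by apply: pull cB => b; rewrite /= /q'; case: pselect => // nB _; split; [exact: j01|].
  have [[b0 [Bb0 qb0]]|h] := pselect (exists b, B (j b) /\ q (j b) = c); last first.
    apply: (@pull set0) => // b; rewrite /= /q'; case: pselect => // Bb [e].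
    by apply: h; exists b.
  by apply: pull (qc _ Bb0) => b; rewrite /= /q'; case: pselect => // Bb [->].
(* By injectivity at most one sequence is sent outside B; prescribing the first bit avoids it. *)
have [c hc] : exists c : bool, forall b, b 0%N = c -> B (j (s b)).
  have [[b0 nB]|h] := pselect (exists b, ~ B (j (s b))); last first.
    by exists true => b _; apply: contrapT => nB; apply: h; exists b.
  exists (~~ b0 0%N) => b b0b; apply: contrapT => nB'.
  have : (q' \o s) b = (q' \o s) b0 by rewrite /= /q'; do 2!case: pselect.
  by move=> /hs e; move: b0b; rewrite e; case: (b0 0%N).
pose pre (b : nat -> bool) n := if n is m.+1 then b m else c.
exists (fun b => j (s (pre b))); split=> [b|b b' /= e]; first exact: hc.
have : (q' \o s) (pre b) = (q' \o s) (pre b').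
  rewrite /= /q'; case: pselect => [Bb|/(_ (hc _ erefl))//].
  by case: pselect => [Bb'|/(_ (hc _ erefl))//]; rewrite e.
move=> /hs h; apply/funext => n.
by have := congr1 (fun f => f n.+1) h.
Qed.

End Continuum.

(** * Parameters with isomorphic groups *)

Section IsomorphismTypes.
Variable R : realType.
Variable c0 : homeo R.
Hypothesis c0_F : thompsonF R c0.
Hypothesis c0_supp : supp c0 = `]0, 1 / 4[%classic.
Hypothesis c0_gt : forall x : R, 0 < x < 1 / 4 -> x < c0 x.
Hypothesis c0_double : forall t : R, 0 < t < 1 / 16 -> c0 t = 2 * t.
Variables (nu2 nu3 : homeo R).
Hypothesis nu23_gen : gen [set nu2; nu3] = F_on `[1 / 16, 15 / 16]%classic.
Variable f_ : R -> homeo R.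
Let B : set R := `]0, 1[ `\` dyadic R.
Hypothesis f_PL : forall alpha, B alpha -> PL01 (f_ alpha) /\ slope_at0 (f_ alpha) alpha.
Variable fI : nat * nat -> nat * nat -> homeo R.
Hypothesis fI_transfer : is_transfer fI.
Variables I J : nat * nat.
Hypothesis I_inner : inner R I.
Hypothesis J_inner : inner R J.
Hypothesis JI : sup (sd_itv R J) < inf (sd_itv R I).
Variable sigma : R -> homeo R.
Hypothesis sigma_PL : forall alpha, B alpha ->
  [/\ PL01 (sigma alpha),
      forall x : R, (`[0, 1] `\` sd_itv R I) x -> sigma alpha x = x
    & group_isog (gen (sigma alpha |` F_on (sd_itv R I)))
                 (gen (f_ alpha |` thompsonF R))].

Let PL_sub01 (f : homeo R) : PL01 f -> supported 0 1 f.
Proof. by case=> sf _; apply/supportedP. Qed.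

Lemma sigma_supported alpha : B alpha -> supported (sd_aff R I 0) (sd_aff R I 1) (sigma alpha).
Proof.
move=> /sigma_PL[[s01 _] sI _]; apply/supportedP => x sx.
have x01 := s01 _ sx; rewrite /= in_itv /=; apply/sd_itvE.
by apply: contrapT => xI; move/eqP: sx; apply; apply: sI.
Qed.

Lemma dyadic_countable : countable (dyadic R).
Proof.
apply: (@sub_countable _ _ _ (range (fun mn : int * nat => mn.1%:~R / 2 ^+ mn.2 : R))).
  by apply: subset_card_le => x [m [n ->]]; exists (m, n).
apply: (@sub_countable _ _ _ [set: int * nat]); [exact: card_image_le|exact: countableP].
Qed.

Lemma slope_inj alpha beta : B alpha -> B beta -> f_ alpha = f_ beta -> alpha = beta.
Proof.
move=> /f_PL[_ sa] /f_PL[_ sb] e; rewrite e in sa.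
exact: (cvg_unique (@norm_hausdorff _ _) sa sb).
Qed.

Let Gamma alpha : set (homeo R) := gen (f_ alpha |` thompsonF R).

(** If sigma_beta = sigma_alpha, then Gamma_beta embeds in the fixed countable group generated by
    sigma_alpha and F_I. Marked by f_beta, it leaves countably many possible f_beta, each of which
    determines beta as its slope at 0. *)
Lemma Gamma_countable_fiber alpha : B alpha -> countable [set beta | B beta /\ sigma beta = sigma alpha].
Proof.
move=> Ba; pose D : set R := [set beta | B beta /\ sigma beta = sigma alpha].
have [_ _ iso] := sigma_PL Ba.
pose C := gen (sigma alpha |` F_on (sd_itv R I)).
have [F2 F3] := nu2_Fc nu23_gen.
have nuF f : [set nu1 c0; nu2; nu3] f -> thompsonF R f.
  by move=> [[->|->]|->]; [exact: nu1_F|exact: Fc_F|exact: Fc_F].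
have cC : countable C.
  apply: (@sub_countable _ _ _ (gen [set` [:: sigma alpha; nu1 c0; nu2; nu3]])); last first.
    by apply: countable_gen; apply: finite_set_countable; exact: finite_seq.
  apply: subset_card_le; apply: gen_sub; first exact: gen_subgroup.
  move=> f [->|[/thompsonFP[df _] sf]]; first by apply: sub_gen; rewrite /= inE eqxx.
  have [i0 i1] := inner_aff I_inner.
  have Ff : Fc R f.
    apply: (Fc_of df i0 i1); apply/supportedP => x /sf /sd_itvE.
    by rewrite /= in_itv.
  apply: genS (Fc_gen_nu c0_F c0_supp c0_gt c0_double nu23_gen Ff) => g.
  by rewrite /= !inE => -[[->|->]|->]; rewrite eqxx ?orbT.
have cf : countable (f_ @` D).
  apply: (@countable_markings R c0 c0_F c0_supp c0_gt c0_double nu2 nu3 nu23_gen id _ _ R D Gamma f_ C) => //.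
  move=> beta [Bb sb]; have [pl _] := f_PL Bb; split.
  - exact: gen_subgroup.
  - exact: PL_sub01.
  - by apply: sub_gen; left.
  - by move=> f hf; apply: sub_gen; right; exact: nuF.
  apply: isog_embeds; apply: isog_sym; first exact: gen_subgroup.
  by have [_ _] := sigma_PL Bb; rewrite sb.
have /countable_injP[k hk] := cf; apply/countable_injP; exists (k \o f_).
move=> x y /set_mem Dx /set_mem Dy /= h; apply: slope_inj; [by case: Dx|by case: Dy|].
by apply: hk h; apply/mem_set; [exists x|exists y].
Qed.

Variable rho : int -> letter.
Hypothesis hrho : labelling rho.

Let G alpha := G_rho_alpha (nu1 c0) nu2 nu3 (xi fI I J (sigma alpha)) rho.

Lemma xi_inj alpha beta : B alpha -> B beta ->
  xi fI I J (sigma alpha) = xi fI I J (sigma beta) -> sigma alpha = sigma beta.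
Proof.
move=> Ba Bb e; have [sa sb] := (@sigma_supported _ Ba, @sigma_supported _ Bb).
apply: homeo_ext => x; have [xI|xI] := boolP (sd_aff R I 0 < x < sd_aff R I 1); last first.
  by rewrite (sa _ xI) (sb _ xI).
have xI' : x \in sd_itv R I.
  by apply/mem_set/sd_itvE; case/andP: xI => ? ?; rewrite !ltW.
have E gamma : B gamma -> xi fI I J (sigma gamma) x = sigma gamma x.
  move=> Bg; rewrite /xi homeo_ofE; first by rewrite /xi_fun xI'.
  apply: xi_homeo => // y /= sy; apply/sd_itvE; have sg := @sigma_supported _ Bg.
  have : sd_aff R I 0 < y < sd_aff R I 1 by apply: contraNT sy => /sg ->.
  by move=> /andP[? ?]; rewrite !ltW.
by rewrite -E // e E.
Qed.

(** Countably many xi_beta, hence countably many sigma_beta, are possible, and each sigma_beta comes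
    from countably many beta. *)
Lemma G_countable_fiber alpha : B alpha -> countable [set beta | B beta /\ group_isog (G beta) (G alpha)].
Proof.
move=> Ba; pose D : set R := [set beta | B beta /\ group_isog (G beta) (G alpha)].
have cG : countable (G alpha).
  have [s sE] : finitely_generated (G alpha) := Grp_fg c0 nu2 nu3 fI I J (sigma alpha) rho.
  rewrite sE.
  by apply: countable_gen; apply: finite_set_countable; exact: finite_seq.
have gen_in beta c f : [set nu1 c0; nu2; nu3; xi fI I J (sigma beta)] f -> G beta (Z rho c f).
  exact: Grp_gen.
have cx : countable ((fun beta => xi fI I J (sigma beta)) @` D).
  apply: (@countable_markings R c0 c0_F c0_supp c0_gt c0_double nu2 nu3 nu23_gen (Z rho true) _ _ R D G _ (G alpha)) => //.
  - by move=> f g sf sg; exact: ZM.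
  - by move=> f g sf sg; exact: Z_inj.
  move=> beta [Bb isob]; split.
  - exact: gen_subgroup.
  - exact: (xi_sub01 fI_transfer I_inner J_inner JI (sigma_supported Bb)).
  - by apply: gen_in; right.
  - by move=> f hf; apply: gen_in; left.
  exact: isog_embeds.
have cs : countable (sigma @` D).
  have /countable_injP[k hk] := cx; apply/countable_injP.
  have [s sP] : {s : homeo R -> R & forall x, (sigma @` D) x -> D (s x) /\ sigma (s x) = x}.
    apply: (@choice _ _ (fun x b => (sigma @` D) x -> D b /\ sigma b = x)) => x.
    by have [[b Db <-]|h] := pselect ((sigma @` D) x); [exists b|exists 0 => /h].
  exists (fun x => k (xi fI I J (sigma (s x)))).
  move=> x y /set_mem/sP[[Bx Dx] xE] /set_mem/sP[[By Dy] yE] h; rewrite -xE -yE.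
  by apply: xi_inj => //; apply: hk h; apply/mem_set; [exists (s x)|exists (s y)].
apply: (@sub_countable _ _ _ (\bigcup_(x in sigma @` D) [set beta | B beta /\ sigma beta = x])).
  by apply: subset_card_le => beta Db; exists (sigma beta); [exists beta|case: Db].
apply: bigcup_countable => // x [beta [Bb _] <-].
exact: Gamma_countable_fiber.
Qed.

End IsomorphismTypes.

Theorem theorem1p4 (R : realType)
  (c0 : homeo R)
  (c0_F : thompsonF R c0)
  (c0_supp : supp c0 = `]0, 1 / 4[%classic)
  (c0_gt : forall x : R, 0 < x < 1 / 4 -> x < c0 x)
  (c0_double : forall t : R, 0 < t < 1 / 16 -> c0 t = 2 * t)
  (nu2 nu3 : homeo R)
  (nu23_gen : gen [set nu2; nu3] = F_on `[1 / 16, 15 / 16]%classic)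
  (f_ : R -> homeo R)
  (f_PL : forall alpha : R, (`]0, 1[ `\` dyadic R) alpha ->
     PL01 (f_ alpha) /\ slope_at0 (f_ alpha) alpha)
  (fI : nat * nat -> nat * nat -> homeo R)
  (fI_transfer : is_transfer fI)
  (I : nat * nat) (I_inner : inner R I)
  (sigma : R -> homeo R)
  (sigma_PL : forall alpha : R, (`]0, 1[ `\` dyadic R) alpha ->
     [/\ PL01 (sigma alpha),
         forall x : R, (`[0, 1] `\` sd_itv R I) x -> sigma alpha x = x
       & group_isog (gen (sigma alpha |` F_on (sd_itv R I)))
                    (gen (f_ alpha |` thompsonF R))])
  (J : nat * nat) (J_inner : inner R J)
  (JI : sup (sd_itv R J) < inf (sd_itv R I)) :
  let S : set (set (homeo R)) :=
    [set G : set (homeo R) | exists (rho : int -> letter) (alpha : R),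
       [/\ labelling rho, quasi_periodic rho,
           (`]0, 1[ `\` dyadic R) alpha
         & G = G_rho_alpha (nu1 c0) nu2 nu3 (xi fI I J (sigma alpha)) rho]] in
  (forall G, S G ->
     [/\ is_subgroup G, finitely_generated G & simple_group G]) /\
  ([set [set K | S K /\ group_isog K G] | G in S] #= [set: R])%card.
Proof.
move=> S; split=> [_ [rho [alpha [hrho qrho Ba ->]]]|].
  have ss := sigma_supported sigma_PL Ba.
  split; [exact: Grp_subgroup|exact: Grp_fg|].
  exact: (Grp_simple c0_F c0_supp c0_gt c0_double nu23_gen fI_transfer I_inner J_inner JI ss hrho qrho).
pose rho := paperfolding; have hrho := paperfolding_labelling.
pose B : set R := `]0, 1[ `\` dyadic R.
pose G (rho : int -> letter) alpha := G_rho_alpha (nu1 c0) nu2 nu3 (xi fI I J (sigma alpha)) rho.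
pose cls (H : set (homeo R)) := [set K | S K /\ group_isog K H].
have SG alpha : B alpha -> S (G rho alpha).
  by move=> Ba; exists rho, alpha; split=> //; exact: paperfolding_quasi_periodic.
apply/card_eqPle; split.
  pose code (ra : (int -> letter) * R) := cls (G ra.1 ra.2).
  apply: (@card_le_trans _ _ _ [set: (int -> letter) * R]).
    apply: (@card_le_trans _ _ _ (range code)); last exact: card_image_le.
    by apply: subset_card_le => _ [_ [r [alpha [_ _ _ ->]]] <-]; exists (r, alpha).
  have [f finj] := real_to_cantor R.
  (* A pair (rho, alpha) as one bit sequence: the graph of rho together with the bits of alpha. *)
  pose enc (ra : (int -> letter) * R) (n : nat) : bool :=
    if unpickle n is Some x then match x : (int * letter) + nat with
      | inl il => ra.1 il.1 == il.2
      | inr m => f ra.2 m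
      end else false.
  apply/pcard_injP; exists (fun ra => cantor_real R (enc ra)).
  move=> [r a] [r' a'] _ _ /(@cantor_real_inj R) e; congr (_, _).
    apply/funext => i; have := congr1 (fun h => h (pickle (inl (i, r' i) : (int * letter) + nat))) e.
    by rewrite /enc pickleK /= eqxx => /eqP.
  apply: finj; apply/funext => m.
  by have := congr1 (fun h => h (pickle (inr m : (int * letter) + nat))) e; rewrite /enc pickleK.
have [||s [sB sinj]] := @continuum_classes R _ B (fun alpha => cls (G rho alpha)).
- apply: (@sub_countable _ _ _ (dyadic R)); last exact: dyadic_countable.
  by apply: subset_card_le => x [x01 nB]; apply: contrapT => nd; exact: nB.
- move=> alpha Ba.
  have := G_countable_fiber c0_F c0_supp c0_gt c0_double nu23_gen f_PL fI_transfer I_inner J_inner JI sigma_PL hrho Ba.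
  apply: (sub_countable (subset_card_le _)) => beta [Bb e]; split; first exact: Bb.
  (* Each group belongs to its own class, so equal classes give an isomorphism. *)
  have : cls (G rho beta) (G rho beta) by split; [exact: SG|exact: isog_refl].
  by rewrite e => -[].
have [f finj] := real_to_cantor R.
have : ([set: R] #<= range (fun x => cls (G rho (s (f x)))))%card.
  have /card_eqPle[_ //] : (range (fun x => cls (G rho (s (f x)))) #= [set: R])%card.
  by apply: inj_card_eq => x y _ _ /sinj /finj.
move=> /card_le_trans; apply; apply: subset_card_le => _ [x _ <-].
by exists (G rho (s (f x))) => //; apply: SG; exact: sB.
Qed.
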